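(* Let $H\in C^k(D_\rho)$, $k\ge4$, be such that $H(0)=0$, $dH(0)=0$ and $d^2H(0)>0$. Then there exists a $C^{k-3}$ area-preserving diffeomorphism $\Psi^+:D_\rho\to D_{\rho'}$, $\Psi^+(0)=0$, and a $C^{[k/2]-1}$ function $h$, $h(0)=0$, $h'(0)\ne0$, such that $$H(x)=h\big(I(\Psi^+(x))\big).$$
   Context: The plane $\mathbb R^2=\{x=(x_1,x_2)\}$ is endowed with the standard area form $\omega_0=dx_1\wedge dx_2$; area-preserving means preserving $\omega_0$. For $\rho>0$, $D_\rho$ denotes the disc $\{|x|<\rho\}$ (and likewise $D_{\rho'}$). The action variable is $I:=r^2/2$, where $(r,\phi)$ are the polar coordinates in the plane. $[\cdot]$ is the integer part.
   Formalization: The diffeomorphism is defined on some open neighbourhood U of 0 inside D_ρ and maps U onto D_ρ', instead of on all of D_ρ, where the claim fails (e.g. H = x1^2 + 2 x2^2); the identity holds on U. *)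

(* Defs.v *)
From Stdlib Require Import Reals.
From Coquelicot Require Import Coquelicot.
Open Scope R_scope.

Definition plane : Type := (R * R)%type.

Definition origin : plane := (0, 0).

Definition radius (x : plane) : R := sqrt (fst x ^ 2 + snd x ^ 2).

Definition open_disc (rho : R) (x : plane) : Prop := radius x < rho.

Definition action (x : plane) : R := radius x ^ 2 / 2.

Definition curry2 (f : plane -> R) (u v : R) : R := f (u, v).

(** [d1^i d2^j f] at [x]. *)
Definition pd (i j : nat) (f : plane -> R) (x : plane) : R :=
  partial_derive i j (curry2 f) (fst x) (snd x).

(** Class C^n on [U], meant for open [U].  At one point, Coquelicot's
    [ex_diff_n] says that all iterated partial derivatives of order at most [n]
    exist and are continuous there; as the partial derivatives are total
    functions, requiring it at every point of an open set is exactly C^n. *)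
Definition class_C (n : nat) (U : plane -> Prop) (f : plane -> R) : Prop :=
  forall x, U x -> ex_diff_n (curry2 f) n (fst x) (snd x).

Definition class_C_map (n : nat) (U : plane -> Prop) (F : plane -> plane) : Prop :=
  class_C n U (fun x => fst (F x)) /\ class_C n U (fun x => snd (F x)).

(** Class C^n on [D], meant for open [D]. *)
Definition class_C1d (n : nat) (D : R -> Prop) (h : R -> R) : Prop :=
  forall t, D t -> forall j, (j <= n)%nat ->
    ex_derive_n h j t /\ continuous (Derive_n h j) t.

Definition diff1 (f : plane -> R) (x v : plane) : R :=
  pd 1 0 f x * fst v + pd 0 1 f x * snd v.

Definition tangent_map (F : plane -> plane) (x v : plane) : plane :=
  (diff1 (fun y => fst (F y)) x v, diff1 (fun y => snd (F y)) x v).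

(** The quadratic form of the second differential. *)
Definition diff2 (f : plane -> R) (x v : plane) : R :=
  pd 2 0 f x * fst v ^ 2 + 2 * pd 1 1 f x * fst v * snd v + pd 0 2 f x * snd v ^ 2.

Definition omega0 (v w : plane) : R := fst v * snd w - snd v * fst w.

(** The pullback of [omega0] by [F] is [omega0] on [U]; orientation is
    therefore preserved too. *)
Definition area_preserving (U : plane -> Prop) (F : plane -> plane) : Prop :=
  forall x, U x -> forall v w,
    omega0 (tangent_map F x v) (tangent_map F x w) = omega0 v w.

Definition diffeomorphism (n : nat) (U V : plane -> Prop) (F : plane -> plane) : Prop :=
  class_C_map n U F /\ (forall x, U x -> V (F x)) /\
  exists G : plane -> plane,
    class_C_map n V G /\ (forall y, V y -> U (G y)) /\
    (forall x, U x -> G (F x) = x) /\ (forall y, V y -> F (G y) = y).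

(* Main.v *)
Require Import Defs.
From Stdlib Require Import Reals Lra Psatz Lia ClassicalEpsilon.
From Coquelicot Require Import Coquelicot.
Open Scope R_scope.

(** A triangular Morse chart [M] of class C^(k-2) gives [H = |M|^2 / 2]; let [p] be
    the Jacobian determinant of its inverse, of class C^(k-3).  It remains to find a
    map preserving the circles [|y| = const] as a family and whose Jacobian
    determinant is [p].  With [q] the mean of [p] over rotations,
    [K y = 2 int_0^1 s q (s y) ds] and [w y = 1/(2 pi) int_0^(2 pi) t p (R_t y) dt],
    one has [K + (y . grad K) / 2 = q] and [d_phi w = p - q], so that
    [y |-> sqrt (K y) R_(w y / q y) y] is such a map; being built from integrals over
    [y] itself, it loses no derivative.  Its action is [I (|y|^2 / 2)], where [I'] is
    [q] as a function of [|y|^2 / 2]: an even function of class C^(2m) of [r] is a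
    function of class C^m of [r^2 / 2].  Finally [h] is the inverse of [I]. *)

(** The shape of the map is forced by its Jacobian. For K invariant under rotations, the determinant
    of y |-> sqrt (K y) R_(u y) y is (K + (y . grad K) / 2) (1 + d_phi u). As d_phi u has mean zero
    on each circle, the first factor has to be the mean q of p, and the angle has to satisfy d_phi u
    = (p - q) / q; since q is constant on circles, dividing a solution w by q is harmless. The
    computation stays in Cartesian coordinates, because polar ones divide by r and cost derivatives
    at the origin.

    Counting derivatives with k = n + 4: two Hadamard divisions put M in C^(n+2), so p and the final
    map are in C^(n+1). With m = [n/2], q is in particular C^(2m), hence I' is C^m and I is C^(m+1),
    where m + 1 = [k/2] - 1.

    The composite preserves area because p (M x) is the inverse of the determinant of dM at x. Its
    action at x is I (H x), which is why h has to invert I. *)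

(** * Continuity and derivatives of elementary expressions *)

Lemma continuous_Rplus {T : UniformSpace} (f g : T -> R) (z : T) :
  continuous f z -> continuous g z -> continuous (fun z => f z + g z) z.
Proof. exact (continuous_plus (V := R_NormedModule) f g z). Qed.

Lemma continuous_Ropp {T : UniformSpace} (f : T -> R) (z : T) :
  continuous f z -> continuous (fun z => - f z) z.
Proof. exact (continuous_opp (V := R_NormedModule) f z). Qed.

Lemma continuous_Rminus {T : UniformSpace} (f g : T -> R) (z : T) :
  continuous f z -> continuous g z -> continuous (fun z => f z - g z) z.
Proof. exact (continuous_minus (V := R_NormedModule) f g z). Qed.

Lemma continuous_Rmult {T : UniformSpace} (f g : T -> R) (z : T) :
  continuous f z -> continuous g z -> continuous (fun z => f z * g z) z.
Proof. exact (continuous_mult (K := R_AbsRing) f g z). Qed.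

Lemma continuous_pair {T U V : UniformSpace} (f : T -> U) (g : T -> V) (z : T) :
  continuous f z -> continuous g z -> continuous (fun z => (f z, g z)) z.
Proof.
intros Hf Hg.
apply (continuous_comp_2 f g (fun a b => (a, b))); auto.
apply (continuous_ext (fun z => z)); [now intros [] | apply continuous_id].
Qed.

Lemma continuous_fst_comp {T U V : UniformSpace} (f : T -> U * V) (z : T) :
  continuous f z -> continuous (fun z => fst (f z)) z.
Proof.
intros Hf; apply (continuous_comp f fst); auto.
destruct (f z); apply continuous_fst.
Qed.

Lemma continuous_snd_comp {T U V : UniformSpace} (f : T -> U * V) (z : T) :
  continuous f z -> continuous (fun z => snd (f z)) z.
Proof.
intros Hf; apply (continuous_comp f snd); auto.
destruct (f z); apply continuous_snd.
Qed.

Lemma continuous_sin (x : R) : continuous sin x.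
Proof. apply continuity_pt_filterlim, continuity_sin. Qed.

Lemma continuous_cos (x : R) : continuous cos x.
Proof. apply continuity_pt_filterlim, continuity_cos. Qed.

Lemma continuous_Rsin {T : UniformSpace} (f : T -> R) (z : T) :
  continuous f z -> continuous (fun z => sin (f z)) z.
Proof. intros Hf; apply (continuous_comp f sin); auto; apply continuous_sin. Qed.

Lemma continuous_Rcos {T : UniformSpace} (f : T -> R) (z : T) :
  continuous f z -> continuous (fun z => cos (f z)) z.
Proof. intros Hf; apply (continuous_comp f cos); auto; apply continuous_cos. Qed.

Ltac cont :=
  repeat
    match goal with
    | |- continuous (fun _ => ?c) _ => apply continuous_const
    | |- continuous (fun z => z) _ => apply continuous_id
    | |- continuous (fun z => (@?f z, @?g z)) _ => apply (continuous_pair f g)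
    | |- continuous (fun z => @?f z + @?g z) _ => apply (continuous_Rplus f g)
    | |- continuous (fun z => @?f z - @?g z) _ => apply (continuous_Rminus f g)
    | |- continuous (fun z => @?f z * @?g z) _ => apply (continuous_Rmult f g)
    | |- continuous (fun z => - @?f z) _ => apply (continuous_Ropp f)
    | |- continuous (fun z => sin (@?f z)) _ => apply (continuous_Rsin f)
    | |- continuous (fun z => cos (@?f z)) _ => apply (continuous_Rcos f)
    | |- continuous (fun z => fst (@?f z)) _ => apply (continuous_fst_comp f)
    | |- continuous (fun z => snd (@?f z)) _ => apply (continuous_snd_comp f)
    | |- continuous fst _ => apply (continuous_fst_comp (fun z => z))
    | |- continuous snd _ => apply (continuous_snd_comp (fun z => z))
    | |- continuous _ _ => assumption
    end.

Lemma open_preimage {T U : UniformSpace} (f : T -> U) (D : U -> Prop) :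
  (forall x, continuous f x) -> open D -> open (fun x => D (f x)).
Proof. intros Hf; apply open_comp; intros x _; apply Hf. Qed.

Lemma open_gt_cont {T : UniformSpace} (f : T -> R) (c : R) :
  (forall x, continuous f x) -> open (fun x => c < f x).
Proof. intros Hf; apply (open_preimage f (fun x => c < x)); [auto | apply open_gt]. Qed.

Lemma open_lt_cont {T : UniformSpace} (f : T -> R) (c : R) :
  (forall x, continuous f x) -> open (fun x => f x < c).
Proof. intros Hf; apply (open_preimage f (fun x => x < c)); [auto | apply open_lt]. Qed.

Lemma is_derive_Rconst (c x : R) : is_derive (fun _ : R => c) x 0.
Proof. exact (is_derive_const (V := R_NormedModule) c x). Qed.

Lemma is_derive_Rid (x : R) : is_derive (fun t : R => t) x 1.
Proof. exact (is_derive_id (K := R_AbsRing) x). Qed.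

Lemma is_derive_Rplus (f g : R -> R) (x a b : R) :
  is_derive f x a -> is_derive g x b -> is_derive (fun t => f t + g t) x (a + b).
Proof. exact (is_derive_plus (V := R_NormedModule) f g x a b). Qed.

Lemma is_derive_Rmult (f g : R -> R) (x a b : R) :
  is_derive f x a -> is_derive g x b ->
  is_derive (fun t => f t * g t) x (a * g x + f x * b).
Proof.
intros Hf Hg; apply (is_derive_mult (K := R_AbsRing) f g x a b); auto.
intros; apply Rmult_comm.
Qed.

Lemma is_derive_Rcomp (f g : R -> R) (x a b : R) :
  is_derive f (g x) a -> is_derive g x b -> is_derive (fun t => f (g t)) x (b * a).
Proof. exact (is_derive_comp (V := R_NormedModule) f g x a b). Qed.

Lemma is_derive_eq (f : R -> R) (x a b : R) :
  is_derive f x a -> a = b -> is_derive f x b.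
Proof. now intros H <-. Qed.

(** * Calculus of C^n functions *)

Definition space : UniformSpace :=
  prod_UniformSpace R_UniformSpace
    (prod_UniformSpace R_UniformSpace R_UniformSpace).

Definition partials (O : space -> Prop) (F F1 F2 : space -> R) : Prop :=
  forall s u v : R, O (s, (u, v)) ->
    is_derive (fun t : R => F (s, (t, v))) u (F1 (s, (u, v))) /\
    is_derive (fun t : R => F (s, (u, t))) v (F2 (s, (u, v))).

(** Functions [F (s, (u, v))] whose partial derivatives in [(u, v)] of order at
    most [n] exist and are jointly continuous in [(s, u, v)].  The parameter [s]
    is a dummy for functions on the plane; it becomes the integration variable in
    [Cn_RInt]. *)
Fixpoint Cn (n : nat) (O : space -> Prop) (F : space -> R) : Prop :=
  (forall z, O z -> continuous F z) /\
  match n with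
  | 0%nat => True
  | S m => exists F1 F2, partials O F F1 F2 /\ Cn m O F1 /\ Cn m O F2
  end.

Lemma Cn_continuous n O F z : Cn n O F -> O z -> continuous F z.
Proof. destruct n; intros [H _]; apply H. Qed.

Lemma Cn_pred n O F : Cn (S n) O F -> Cn n O F.
Proof.
revert F; induction n as [|n IH]; intros F [Hc [F1 [F2 [HP [H1 H2]]]]].
- now split.
- split; [exact Hc|]; exists F1, F2; auto.
Qed.

Lemma Cn_le n m O F : (n <= m)%nat -> Cn m O F -> Cn n O F.
Proof. induction 1; auto; intros H1; apply IHle, Cn_pred, H1. Qed.

Lemma Cn_subset n (O P : space -> Prop) F :
  (forall z, P z -> O z) -> Cn n O F -> Cn n P F.
Proof.
intros HS; revert F; induction n as [|n IH]; intros F [Hc Hd]; split; auto.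
destruct Hd as [F1 [F2 [HP [H1 H2]]]]; exists F1, F2; repeat apply conj; auto.
intros s u v Hz; apply HP; auto.
Qed.

Lemma open_slice_fst (O : space -> Prop) s u v :
  open O -> O (s, (u, v)) -> locally u (fun t : R => O (s, (t, v))).
Proof.
intros HO; apply (open_preimage (fun t : R => (s, (t, v)) : space) O); auto.
intros x; cont.
Qed.

Lemma open_slice_snd (O : space -> Prop) s u v :
  open O -> O (s, (u, v)) -> locally v (fun t : R => O (s, (u, t))).
Proof.
intros HO; apply (open_preimage (fun t : R => (s, (u, t)) : space) O); auto.
intros x; cont.
Qed.

Lemma partials_ext (O : space -> Prop) F G F1 F2 G1 G2 : open O ->
  (forall z, O z -> F z = G z) -> (forall z, O z -> F1 z = G1 z) ->
  (forall z, O z -> F2 z = G2 z) -> partials O F F1 F2 -> partials O G G1 G2.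
Proof.
intros HO HE H1 H2 HP s u v Hz; rewrite <- H1, <- H2 by auto.
destruct (HP s u v Hz) as [Ha Hb]; split.
- apply (is_derive_ext_loc (fun t => F (s, (t, v)))); auto.
  apply (filter_imp (fun t : R => O (s, (t, v)))); [now auto|].
  now apply open_slice_fst.
- apply (is_derive_ext_loc (fun t => F (s, (u, t)))); auto.
  apply (filter_imp (fun t : R => O (s, (u, t)))); [now auto|].
  now apply open_slice_snd.
Qed.

Lemma Cn_ext n (O : space -> Prop) F G :
  open O -> (forall z, O z -> F z = G z) -> Cn n O F -> Cn n O G.
Proof.
intros HO HE HF.
assert (HC : forall z, O z -> continuous G z).
{ intros z Hz; apply (continuous_ext_loc G F).
  - apply (filter_imp O); auto.
  - eapply Cn_continuous; eauto. }
destruct n as [|n]; split; auto.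
destruct HF as [_ [F1 [F2 [HP HF]]]]; exists F1, F2; split; auto.
eapply partials_ext; eauto.
Qed.

Lemma Cn_S_intro n O F F1 F2 :
  (forall z, O z -> continuous F z) -> partials O F F1 F2 -> Cn n O F1 -> Cn n O F2 ->
  Cn (S n) O F.
Proof. intros; split; auto; exists F1, F2; auto. Qed.

(** Continuity suffices for every n, because no derivative in the parameter is ever taken. *)
Lemma Cn_param n O (f : R -> R) :
  (forall s, continuous f s) -> Cn n O (fun z => f (fst z)).
Proof.
revert f; induction n as [|n IH]; intros f Hf.
- split; auto; intros z _; apply (continuous_comp fst f); auto; cont.
- apply (Cn_S_intro _ _ _ (fun _ => 0) (fun _ => 0)).
  + intros z _; apply (continuous_comp fst f); auto; cont.
  + intros s u v _; cbn [fst snd]; split; apply is_derive_Rconst.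
  + apply (IH (fun _ => 0)); intros; cont.
  + apply (IH (fun _ => 0)); intros; cont.
Qed.

Lemma Cn_const n O (c : R) : Cn n O (fun _ => c).
Proof. apply (Cn_param n O (fun _ => c)); intros; cont. Qed.

Lemma Cn_fst n O : Cn n O (fun z => fst (snd z)).
Proof.
destruct n as [|n]; [split; auto; intros; cont|].
apply (Cn_S_intro _ _ _ (fun _ => 1) (fun _ => 0)); try apply Cn_const.
- intros; cont.
- intros s u v _; cbn [fst snd]; split;
    [apply is_derive_Rid | apply is_derive_Rconst].
Qed.

Lemma Cn_snd n O : Cn n O (fun z => snd (snd z)).
Proof.
destruct n as [|n]; [split; auto; intros; cont|].
apply (Cn_S_intro _ _ _ (fun _ => 0) (fun _ => 1)); try apply Cn_const.
- intros; cont.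
- intros s u v _; cbn [fst snd]; split;
    [apply is_derive_Rconst | apply is_derive_Rid].
Qed.

Lemma partials_plus O F G F1 F2 G1 G2 :
  partials O F F1 F2 -> partials O G G1 G2 ->
  partials O (fun z => F z + G z) (fun z => F1 z + G1 z) (fun z => F2 z + G2 z).
Proof.
intros HF HG s u v Hz; destruct (HF s u v Hz), (HG s u v Hz).
split; now apply is_derive_Rplus.
Qed.

Lemma partials_mult O F G F1 F2 G1 G2 :
  partials O F F1 F2 -> partials O G G1 G2 ->
  partials O (fun z => F z * G z) (fun z => F1 z * G z + F z * G1 z)
    (fun z => F2 z * G z + F z * G2 z).
Proof.
intros HF HG s u v Hz; destruct (HF s u v Hz), (HG s u v Hz).
split; now apply is_derive_Rmult.
Qed.

Lemma Cn_plus n O F G : Cn n O F -> Cn n O G -> Cn n O (fun z => F z + G z).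
Proof.
revert F G; induction n as [|n IH].
- intros F G [HF _] [HG _]; split; auto; intros; apply continuous_Rplus; auto.
- intros F G [HF [F1 [F2 [HP [HF1 HF2]]]]] [HG [G1 [G2 [HQ [HG1 HG2]]]]].
  eapply Cn_S_intro; [|apply partials_plus; eauto| |]; auto.
  intros; apply continuous_Rplus; auto.
Qed.

Lemma Cn_mult n O F G : Cn n O F -> Cn n O G -> Cn n O (fun z => F z * G z).
Proof.
revert F G; induction n as [|n IH]; intros F G HF HG.
- destruct HF, HG; split; auto; intros; apply continuous_Rmult; auto.
- assert (HF' := Cn_pred _ _ _ HF); assert (HG' := Cn_pred _ _ _ HG).
  destruct HF as [HF [F1 [F2 [HP [HF1 HF2]]]]], HG as [HG [G1 [G2 [HQ [HG1 HG2]]]]].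
  eapply Cn_S_intro; [|apply partials_mult; eauto| |];
    try (apply Cn_plus; apply IH; auto).
  intros; apply continuous_Rmult; auto.
Qed.

Lemma Cn_opp n (O : space -> Prop) F : Cn n O F -> Cn n O (fun z => - F z).
Proof.
revert F; induction n as [|n IH]; intros F HF.
- destruct HF; split; auto; intros; apply continuous_Ropp; auto.
- destruct HF as [HF [F1 [F2 [HP [HF1 HF2]]]]].
  apply (Cn_S_intro _ _ _ (fun z => - F1 z) (fun z => - F2 z)); auto.
  + intros; apply continuous_Ropp; auto.
  + intros s u v Hz; destruct (HP s u v Hz).
    split; now apply (is_derive_opp (V := R_NormedModule)).
Qed.

Lemma Cn_minus n O F G : Cn n O F -> Cn n O G -> Cn n O (fun z => F z - G z).
Proof. intros; apply Cn_plus; auto; now apply Cn_opp. Qed.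

(** Both partials near the point and continuity of one of them there already give the total
    differential, which is what the chain rule consumes. *)
Lemma partials_differentiable (O : space -> Prop) F F1 F2 s u v :
  open O -> partials O F F1 F2 -> continuous F1 (s, (u, v)) -> O (s, (u, v)) ->
  differentiable_pt_lim (fun a b => F (s, (a, b))) u v (F1 (s, (u, v))) (F2 (s, (u, v))).
Proof.
intros HO HP HC Hz.
apply filterdiff_differentiable_pt_lim.
apply (is_derive_filterdiff (fun a b => F (s, (a, b))) u v (fun a b => F1 (s, (a, b)))).
- apply (filter_imp (fun y : R * R => O (s, y))).
  + intros [a b] Hy; now destruct (HP s a b Hy).
  + apply (open_preimage (fun y : R * R => (s, y) : space) O); auto; intros; cont.
- now destruct (HP s u v Hz).
- apply (continuous_comp (fun y : R * R => (s, (fst y, snd y)) : space) F1); cont.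
Qed.

Lemma is_derive_comp_2d (F : R -> R -> R) (x y : R -> R) (t lx ly x' y' : R) :
  differentiable_pt_lim F (x t) (y t) lx ly -> is_derive x t x' -> is_derive y t y' ->
  is_derive (fun t => F (x t) (y t)) t (lx * x' + ly * y').
Proof.
intros HF Hx Hy; apply is_derive_Reals, derivable_pt_lim_comp_2d; auto;
  now apply is_derive_Reals.
Qed.

Lemma continuous_Cn_comp n (P : space -> Prop) F (X Y : space -> R) z :
  Cn n P F -> P (fst z, (X z, Y z)) -> continuous X z -> continuous Y z ->
  continuous (fun z => F (fst z, (X z, Y z))) z.
Proof.
intros HF HP HX HY.
apply (continuous_comp (fun z : space => (fst z, (X z, Y z)) : space) F); cont.
eapply Cn_continuous; eauto.
Qed.

Lemma partials_comp n (O P : space -> Prop) F F1 F2 X X1 X2 Y Y1 Y2 :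
  open P -> partials P F F1 F2 -> Cn n P F1 ->
  partials O X X1 X2 -> partials O Y Y1 Y2 ->
  (forall z, O z -> P (fst z, (X z, Y z))) ->
  partials O (fun z => F (fst z, (X z, Y z)))
    (fun z => F1 (fst z, (X z, Y z)) * X1 z + F2 (fst z, (X z, Y z)) * Y1 z)
    (fun z => F1 (fst z, (X z, Y z)) * X2 z + F2 (fst z, (X z, Y z)) * Y2 z).
Proof.
intros HP HF HC HX HY HS s u v Hz; cbn [fst snd].
destruct (HX s u v Hz) as [HX1 HX2], (HY s u v Hz) as [HY1 HY2].
assert (HD := partials_differentiable _ _ _ _ s (X (s, (u, v))) (Y (s, (u, v))) HP HF).
specialize (HD (Cn_continuous _ _ _ _ HC (HS _ Hz)) (HS _ Hz)).
split.
- exact (is_derive_comp_2d (fun a b => F (s, (a, b))) (fun t => X (s, (t, v)))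
    (fun t => Y (s, (t, v))) u _ _ _ _ HD HX1 HY1).
- exact (is_derive_comp_2d (fun a b => F (s, (a, b))) (fun t => X (s, (u, t)))
    (fun t => Y (s, (u, t))) v _ _ _ _ HD HX2 HY2).
Qed.

(** The chain rule writes the partials of the composite as products of [F1], [F2] composed with the
    same X, Y and partials of X, Y. The induction handles the former once X and Y are weakened by
    one class. *)
Lemma Cn_comp n (O P : space -> Prop) F X Y :
  open P -> Cn n P F -> Cn n O X -> Cn n O Y ->
  (forall z, O z -> P (fst z, (X z, Y z))) ->
  Cn n O (fun z => F (fst z, (X z, Y z))).
Proof.
intros HP; revert F; induction n as [|n IH]; intros F HF HX HY HS.
- split; auto; intros z Hz; destruct HX as [HX _], HY as [HY _].
  eapply continuous_Cn_comp; eauto.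
- assert (HX' := Cn_pred _ _ _ HX); assert (HY' := Cn_pred _ _ _ HY).
  assert (HF' := HF).
  destruct HX as [HX [X1 [X2 [HPX [HX1 HX2]]]]], HY as [HY [Y1 [Y2 [HPY [HY1 HY2]]]]].
  destruct HF as [HF [F1 [F2 [HPF [HF1 HF2]]]]].
  eapply Cn_S_intro; [|eapply (partials_comp n O P); eauto| |];
    try (apply Cn_plus; apply Cn_mult; auto).
  intros; eapply continuous_Cn_comp; eauto.
Qed.

(** Partials in the plane variables do not see a change of parameter. With f constant this freezes
    the dummy parameter. *)
Lemma Cn_reparam n (O : space -> Prop) F (f : R -> R) :
  (forall s, continuous f s) -> Cn n O F ->
  Cn n (fun z => O (f (fst z), snd z)) (fun z => F (f (fst z), snd z)).
Proof.
intros Hf; revert F; induction n as [|n IH]; intros F HF.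
- split; auto; intros z Hz.
  apply (continuous_comp (fun z : space => (f (fst z), snd z) : space) F).
  + cont; apply (continuous_comp fst f); auto; cont.
  + eapply Cn_continuous; eauto.
- destruct HF as [HF [F1 [F2 [HP [HF1 HF2]]]]].
  apply (Cn_S_intro _ _ _ (fun z => F1 (f (fst z), snd z)) (fun z => F2 (f (fst z), snd z))); auto.
  + intros z Hz.
    apply (continuous_comp (fun z : space => (f (fst z), snd z) : space) F); auto.
    cont; apply (continuous_comp fst f); auto; cont.
  + intros s u v Hz; apply (HP (f s) u v Hz).
Qed.

(** The partials contain [/ F] itself, one class lower, so the induction runs with F fixed. *)
Lemma Cn_inv n O F : (forall z, O z -> F z <> 0) -> Cn n O F -> Cn n O (fun z => / F z).
Proof.
intros H0; induction n as [|n IH]; intros HF.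
- destruct HF as [HF _]; split; auto; intros z Hz.
  apply (continuous_comp F Rinv); auto; apply continuous_Rinv; auto.
- assert (HF' := Cn_pred _ _ _ HF).
  destruct HF as [HF [F1 [F2 [HP [HF1 HF2]]]]].
  apply (Cn_S_intro _ _ _ (fun z => - (F1 z * (/ F z * / F z)))
    (fun z => - (F2 z * (/ F z * / F z)))).
  + intros z Hz; apply (continuous_comp F Rinv); auto; apply continuous_Rinv; auto.
  + intros s u v Hz; destruct (HP s u v Hz) as [H1 H2]; specialize (H0 _ Hz).
    split; eapply is_derive_eq.
    * apply is_derive_inv; eauto.
    * simpl; field; auto.
    * apply is_derive_inv; eauto.
    * simpl; field; auto.
  + apply Cn_opp, Cn_mult; auto; apply Cn_mult; auto.
  + apply Cn_opp, Cn_mult; auto; apply Cn_mult; auto.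
Qed.

Lemma Cn_sqrt n O F : (forall z, O z -> 0 < F z) -> Cn n O F -> Cn n O (fun z => sqrt (F z)).
Proof.
intros H0; induction n as [|n IH]; intros HF.
- destruct HF as [HF _]; split; auto; intros z Hz.
  apply (continuous_comp F sqrt); auto; apply continuous_sqrt.
- assert (HF' := Cn_pred _ _ _ HF).
  destruct HF as [HF [F1 [F2 [HP [HF1 HF2]]]]].
  assert (HI : Cn n O (fun z => / (2 * sqrt (F z)))).
  { apply Cn_inv; [|apply Cn_mult; auto; apply Cn_const].
    intros z Hz; assert (H := sqrt_lt_R0 _ (H0 z Hz)); lra. }
  apply (Cn_S_intro _ _ _ (fun z => F1 z * / (2 * sqrt (F z)))
    (fun z => F2 z * / (2 * sqrt (F z)))); try (apply Cn_mult; auto).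
  + intros z Hz; apply (continuous_comp F sqrt); auto; apply continuous_sqrt.
  + intros s u v Hz; destruct (HP s u v Hz) as [H1 H2]; specialize (H0 _ Hz).
    split; apply is_derive_sqrt; auto.
Qed.

(** Proved jointly, since each function appears in the partials of the other. *)
Lemma Cn_sin_cos n O F :
  Cn n O F -> Cn n O (fun z => sin (F z)) /\ Cn n O (fun z => cos (F z)).
Proof.
induction n as [|n IH]; intros HF.
- destruct HF as [HF _]; split; (split; [intros z Hz|exact I]).
  + apply (continuous_Rsin F); auto.
  + apply (continuous_Rcos F); auto.
- assert (HF' := Cn_pred _ _ _ HF); destruct (IH HF') as [IHs IHc].
  destruct HF as [HF [F1 [F2 [HP [HF1 HF2]]]]].
  split.
  + apply (Cn_S_intro _ _ _ (fun z => F1 z * cos (F z)) (fun z => F2 z * cos (F z)));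
      try (apply Cn_mult; auto).
    * intros; apply (continuous_Rsin F); auto.
    * intros s u v Hz; destruct (HP s u v Hz) as [H1 H2].
      split; [apply (is_derive_Rcomp sin (fun t => F (s, (t, v))))
             |apply (is_derive_Rcomp sin (fun t => F (s, (u, t))))]; auto; apply is_derive_sin.
  + apply (Cn_S_intro _ _ _ (fun z => F1 z * - sin (F z)) (fun z => F2 z * - sin (F z)));
      try (apply Cn_mult; auto; now apply Cn_opp).
    * intros; apply (continuous_Rcos F); auto.
    * intros s u v Hz; destruct (HP s u v Hz) as [H1 H2].
      split; [apply (is_derive_Rcomp cos (fun t => F (s, (t, v))))
             |apply (is_derive_Rcomp cos (fun t => F (s, (u, t))))]; auto; apply is_derive_cos.
Qed.

(** * Parametric integrals *)

(** Tube lemma: compactness of [a, b] turns continuity at the points of the segment over x into a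
    neighbourhood of x that serves for all s. *)
Lemma uniform_continuity_param (F : space -> R) (a b : R) (x : R * R) (eps : posreal) :
  (forall s, a <= s <= b -> continuous F (s, x)) ->
  exists d : posreal, forall s y, a <= s <= b -> ball x d y ->
    Rabs (F (s, y) - F (s, x)) < eps.
Proof.
intros HC.
(* The compactness result takes a radius defined for every real t; outside [a, b] the radius 1 is a
   dummy. *)
assert (HD : forall t, exists d : posreal, a <= t <= b -> forall s y,
  Rabs (s - t) < d -> ball x d y -> Rabs (F (s, y) - F (t, x)) < eps / 2).
{ intros t; destruct (Classical_Prop.classic (a <= t <= b)) as [Ht|Ht].
  - destruct (HC t Ht (ball (F (t, x)) (pos_div_2 eps)) (locally_ball _ _)) as [d Hd].
    exists d; intros _ s y Hs Hy; apply (Hd (s, y)); split; auto.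
  - exists (mkposreal 1 Rlt_0_1); now intros. }
destruct (compactness_value_1d a b
  (fun t => proj1_sig (constructive_indefinite_description _ (HD t)))) as [d Hd].
exists d; intros s y Hs Hy.
(* The covering interval is only provided under a double negation, hence the classical step. *)
apply Classical_Prop.NNPP; intros HN; apply (Hd s Hs); intros [t [Ht [Hst Hdt]]].
apply HN; clear HN.
destruct (constructive_indefinite_description _ (HD t)) as [dt Hdt']; simpl in *.
assert (H1 := Hdt' Ht s y Hst (ball_le _ _ _ Hdt _ Hy)).
assert (H2 := Hdt' Ht s x Hst (ball_center x dt)).
apply Rabs_def2 in H1; apply Rabs_def2 in H2; apply Rabs_def1; lra.
Qed.

Lemma continuous_slice (F : space -> R) s x :
  continuous F (s, x) -> continuous (fun t : R => F (t, x)) s.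
Proof. intros H; apply (continuous_comp (fun t : R => (t, x) : space) F); cont. Qed.

Lemma ex_RInt_slice (F : space -> R) a b x : a <= b ->
  (forall s, a <= s <= b -> continuous F (s, x)) -> ex_RInt (fun s => F (s, x)) a b.
Proof.
intros Hab HC; apply (ex_RInt_continuous (V := R_CompleteNormedModule)).
rewrite Rmin_left, Rmax_right by lra; intros; now apply continuous_slice, HC.
Qed.

Lemma continuous_RInt_param (F : space -> R) a b (U : R * R -> Prop) x : a <= b ->
  open U -> U x -> (forall s y, a <= s <= b -> U y -> continuous F (s, y)) ->
  continuous (fun y => RInt (fun s => F (s, y)) a b) x.
Proof.
intros Hab HU Hx HC; apply (filterlim_locally (U := R_UniformSpace)); intros eps.
(* The added 1 keeps the denominator positive when a = b. *)
assert (He : 0 < eps / (b - a + 1)) by (apply Rdiv_lt_0_compat; [apply eps | lra]).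
destruct (uniform_continuity_param F a b x (mkposreal _ He)) as [d Hd]; [now auto|].
generalize (filter_and _ _ (HU x Hx) (locally_ball x d)).
apply filter_imp; intros y [HUy Hy].
change (Rabs (RInt (fun s => F (s, y)) a b - RInt (fun s => F (s, x)) a b) < eps).
rewrite <- (RInt_minus (V := R_CompleteNormedModule)) by (apply ex_RInt_slice; auto).
apply Rle_lt_trans with ((b - a) * (eps / (b - a + 1))).
- apply abs_RInt_le_const; auto.
  + apply (ex_RInt_minus (V := R_NormedModule)); apply ex_RInt_slice; auto.
  + intros s Hs; left; apply (Hd s y Hs Hy).
- assert (0 < eps) by apply eps.
  apply Rmult_lt_reg_r with (b - a + 1); [lra|].
  replace ((b - a) * (eps / (b - a + 1)) * (b - a + 1)) with ((b - a) * eps) by (field; lra).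
  nra.
Qed.

(** Differentiation under the integral with an explicit f'. Openness of D transfers continuity from
    f' to [Derive], since the two agree on D. *)
Lemma is_derive_RInt_slice (f f' : R -> R -> R) (a b u : R) (D : R * R -> Prop) :
  a <= b -> open D ->
  locally u (fun w : R => forall t, a <= t <= b -> D (t, w)) ->
  (forall t w, D (t, w) -> is_derive (f t) w (f' t w)) ->
  (forall p, D p -> continuous (fun p => f' (fst p) (snd p)) p) ->
  (forall t w, D (t, w) -> continuous (fun t => f t w) t) ->
  is_derive (fun w => RInt (fun t => f t w) a b) u (RInt (fun t => f' t u) a b).
Proof.
intros Hab HD HL Hf Hc Hi.
rewrite (RInt_ext _ (fun t => Derive (fun w => f t w) u)).
- apply (is_derive_RInt_param (fun u t => f t u) a b u);
    rewrite ?Rmin_left, ?Rmax_right by lra.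
  + revert HL; apply filter_imp; intros w Hw t Ht; eexists; apply Hf; auto.
  + intros t Ht; apply continuity_2d_pt_filterlim.
    assert (HDt : D (t, u)) by (apply (locally_singleton _ _ HL); auto).
    assert (HS : continuous (fun p : R * R => f' (snd p) (fst p)) (u, t)).
    { apply (continuous_comp (fun p : R * R => (snd p, fst p)) (fun p => f' (fst p) (snd p)));
        [cont|]; apply Hc; auto. }
    apply (continuous_ext_loc (fun p => Derive (fun z => f (snd p) z) (fst p)) _ (u, t)) in HS; auto.
    apply (filter_imp (fun p : R * R => D (snd p, fst p))).
    * intros p Hp; symmetry; now apply is_derive_unique, Hf.
    * apply (open_preimage (fun p : R * R => (snd p, fst p)) D); auto.
      intros; cont.
  + revert HL; apply filter_imp; intros w Hw.
    apply (ex_RInt_continuous (V := R_CompleteNormedModule)).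
    rewrite Rmin_left, Rmax_right by lra; intros t Ht; now apply (Hi t w), Hw.
- rewrite Rmin_left, Rmax_right by lra; intros t Ht.
  symmetry; apply is_derive_unique, Hf, (locally_singleton _ _ HL); lra.
Qed.

Lemma partials_RInt a b (O : space -> Prop) (U : R * R -> Prop) F F1 F2 : a <= b ->
  open O -> open U -> (forall s x, a <= s <= b -> U x -> O (s, x)) ->
  (forall z, O z -> continuous F z) -> (forall z, O z -> continuous F1 z) ->
  (forall z, O z -> continuous F2 z) -> partials O F F1 F2 ->
  partials (fun z => U (snd z)) (fun z => RInt (fun s => F (s, snd z)) a b)
    (fun z => RInt (fun s => F1 (s, snd z)) a b) (fun z => RInt (fun s => F2 (s, snd z)) a b).
Proof.
intros Hab HO HU HS HF HF1 HF2 HP s0 u v Hz; cbn [fst snd] in *; split.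
- apply (is_derive_RInt_slice (fun s w => F (s, (w, v))) (fun s w => F1 (s, (w, v)))
    a b u (fun p => O (fst p, (snd p, v)))); cbn [fst snd]; auto.
  + apply (open_preimage (fun p : R * R => (fst p, (snd p, v)) : space) O); auto; intros; cont.
  + apply (filter_imp (fun w : R => U (w, v))); [now auto|].
    apply (open_preimage (fun w : R => (w, v)) U); auto; intros; cont.
  + intros t w Hw; apply HP, Hw.
  + intros p Hp; apply (continuous_comp (fun p : R * R => (fst p, (snd p, v)) : space) F1); auto; cont.
  + intros t w Hw; apply continuous_slice, HF, Hw.
- apply (is_derive_RInt_slice (fun s w => F (s, (u, w))) (fun s w => F2 (s, (u, w)))
    a b v (fun p => O (fst p, (u, snd p)))); cbn [fst snd]; auto.
  + apply (open_preimage (fun p : R * R => (fst p, (u, snd p)) : space) O); auto; intros; cont.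
  + apply (filter_imp (fun w : R => U (u, w))); [now auto|].
    apply (open_preimage (fun w : R => (u, w)) U); auto; intros; cont.
  + intros t w Hw; apply HP, Hw.
  + intros p Hp; apply (continuous_comp (fun p : R * R => (fst p, (u, snd p)) : space) F2); auto; cont.
  + intros t w Hw; apply continuous_slice, HF, Hw.
Qed.

Lemma Cn_RInt n a b (O : space -> Prop) (U : R * R -> Prop) F : a <= b ->
  open O -> open U -> (forall s x, a <= s <= b -> U x -> O (s, x)) -> Cn n O F ->
  Cn n (fun z => U (snd z)) (fun z => RInt (fun s => F (s, snd z)) a b).
Proof.
intros Hab HO HU HS HF.
assert (HC : forall z : space, U (snd z) ->
  continuous (fun z : space => RInt (fun s => F (s, snd z)) a b) z).
{ intros z Hz; apply (continuous_comp (fun z : space => snd z)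
    (fun y => RInt (fun s => F (s, y)) a b)); [cont|].
  apply (continuous_RInt_param F a b U); auto.
  intros; eapply Cn_continuous; eauto. }
revert F HF HC; induction n as [|n IH]; intros F HF HC; [split; auto|].
destruct HF as [HF [F1 [F2 [HP [HF1 HF2]]]]].
apply (Cn_S_intro _ _ _ (fun z => RInt (fun s => F1 (s, snd z)) a b)
  (fun z => RInt (fun s => F2 (s, snd z)) a b)); auto.
- apply (partials_RInt a b O); auto; intros; eapply Cn_continuous; eauto.
- apply IH; auto; intros z Hz; apply (continuous_comp (fun z : space => snd z)
    (fun y => RInt (fun s => F1 (s, y)) a b)); [cont|].
  apply (continuous_RInt_param F1 a b U); auto; intros; eapply Cn_continuous; eauto.
- apply IH; auto; intros z Hz; apply (continuous_comp (fun z : space => snd z)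
    (fun y => RInt (fun s => F2 (s, y)) a b)); [cont|].
  apply (continuous_RInt_param F2 a b U); auto; intros; eapply Cn_continuous; eauto.
Qed.

(** * Functions of class C^n on the plane *)

(** A plane function is regarded as constant in the parameter, so that the whole calculus of [Cn]
    applies to it. *)
Definition Cp (n : nat) (U : plane -> Prop) (f : plane -> R) : Prop :=
  Cn n (fun z => U (snd z)) (fun z => f (snd z)).

Definition pl_partials (U : plane -> Prop) (f f1 f2 : plane -> R) : Prop :=
  forall u v : R, U (u, v) ->
    is_derive (fun t : R => f (t, v)) u (f1 (u, v)) /\
    is_derive (fun t : R => f (u, t)) v (f2 (u, v)).

Lemma Cp_S n U f : Cp (S n) U f ->
  exists f1 f2, pl_partials U f f1 f2 /\ Cp n U f1 /\ Cp n U f2.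
Proof.
intros [HF [F1 [F2 [HP [HF1 HF2]]]]].
(* The witnesses inside [Cn] may still depend on the parameter, which is frozen at 0. *)
exists (fun x => F1 (0, x)), (fun x => F2 (0, x)).
repeat apply conj.
- intros u v Hx; exact (HP 0 u v Hx).
- apply (Cn_reparam n _ _ (fun _ => 0)) in HF1; auto; intros; cont.
- apply (Cn_reparam n _ _ (fun _ => 0)) in HF2; auto; intros; cont.
Qed.

Lemma Cp_S_intro n U f f1 f2 : Cp 0 U f ->
  pl_partials U f f1 f2 -> Cp n U f1 -> Cp n U f2 -> Cp (S n) U f.
Proof.
intros [Hc _] HP H1 H2; apply (Cn_S_intro _ _ _ (fun z => f1 (snd z)) (fun z => f2 (snd z))); auto.
intros s u v Hz; exact (HP u v Hz).
Qed.

Lemma Cp_continuous n U f x : Cp n U f -> U x -> continuous f x.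
Proof.
intros Hf Hx.
apply (continuous_comp (fun x : R * R => (0, x) : space) (fun z => f (snd z)));
  [cont | eapply Cn_continuous; eauto].
Qed.

Lemma continuous_Cp0 (U : plane -> Prop) f : (forall x, U x -> continuous f x) -> Cp 0 U f.
Proof.
intros H; split; auto; intros z Hz; apply (continuous_comp (fun z : space => snd z) f); auto; cont.
Qed.

Lemma open_cylinder (U : plane -> Prop) : open U -> open (fun z : space => U (snd z)).
Proof. intros HU; apply (open_preimage (fun z : space => snd z) U); auto; intros; cont. Qed.

Lemma Cp_comp n (O : space -> Prop) (U : plane -> Prop) f X Y :
  open U -> Cp n U f -> Cn n O X -> Cn n O Y -> (forall z, O z -> U (X z, Y z)) ->
  Cn n O (fun z => f (X z, Y z)).
Proof.
intros HU Hf HX HY HS.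
apply (Cn_comp n O (fun z => U (snd z)) (fun z => f (snd z)) X Y); auto.
now apply open_cylinder.
Qed.

Lemma class_C_Cp n U f : class_C n U f -> Cp n U f.
Proof.
revert f; induction n as [|n IH]; intros f Hf.
- apply continuous_Cp0; intros [u v] Hx; destruct (Hf _ Hx) as [Hc _].
  apply continuity_2d_pt_filterlim in Hc; simpl in Hc.
  apply (continuous_ext (fun z : R * R => f (fst z, snd z))); [now intros []|exact Hc].
- apply (Cp_S_intro _ _ _ (fun x => Derive (fun z => f (z, snd x)) (fst x))
    (fun x => Derive (fun z => f (fst x, z)) (snd x))).
  + apply continuous_Cp0; intros [u v] Hx; destruct (Hf _ Hx) as [Hc _].
    apply continuity_2d_pt_filterlim in Hc; simpl in Hc.
    apply (continuous_ext (fun z : R * R => f (fst z, snd z))); [now intros []|exact Hc].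
  + intros u v Hx; destruct (Hf _ Hx) as [_ [H1 [H2 _]]]; split; now apply Derive_correct.
  + apply IH; intros x Hx; apply (Hf x Hx).
  + apply IH; intros x Hx; apply (Hf x Hx).
Qed.

Lemma Cp_ext n (U : plane -> Prop) f g :
  open U -> (forall x, U x -> f x = g x) -> Cp n U f -> Cp n U g.
Proof.
intros HU HE; apply Cn_ext; [now apply open_cylinder | intros z Hz; now apply HE].
Qed.

Lemma pl_partials_Derive U f f1 f2 x : pl_partials U f f1 f2 -> U x ->
  Derive (fun t => f (t, snd x)) (fst x) = f1 x /\
  Derive (fun t => f (fst x, t)) (snd x) = f2 x.
Proof.
destruct x as [u v]; intros HP Hx; destruct (HP u v Hx).
split; now apply is_derive_unique.
Qed.

(** [ex_diff_n] speaks of the total functions [Derive]; these agree with the given partials on the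
    open set U, which is enough for the induction. *)
Lemma Cp_class_C n (U : plane -> Prop) f : open U -> Cp n U f -> class_C n U f.
Proof.
intros HU; revert f; induction n as [|n IH]; intros f Hf x Hx.
- split; auto; apply continuity_2d_pt_filterlim.
  apply (continuous_ext f); [now intros []|]; rewrite <- surjective_pairing.
  eapply Cp_continuous; eauto.
- split.
  { apply continuity_2d_pt_filterlim.
    apply (continuous_ext f); [now intros []|]; rewrite <- surjective_pairing.
    eapply Cp_continuous; eauto. }
  destruct (Cp_S _ _ _ Hf) as [f1 [f2 [HP [H1 H2]]]].
  assert (HP' := HP (fst x) (snd x)); rewrite <- surjective_pairing in HP'.
  destruct (HP' Hx) as [D1 D2]; repeat apply conj.
  + eexists; apply D1.
  + eexists; apply D2.
  + apply (IH (fun x => Derive (fun t => f (t, snd x)) (fst x))); auto.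
    apply (Cp_ext _ _ f1); auto; intros y Hy; symmetry.
    eapply pl_partials_Derive; eauto.
  + apply (IH (fun x => Derive (fun t => f (fst x, t)) (snd x))); auto.
    apply (Cp_ext _ _ f2); auto; intros y Hy; symmetry.
    eapply pl_partials_Derive; eauto.
Qed.

(** Partials are unique on U, so any given pair inherits the class of the pair hidden in [Cp]. *)
Lemma Cp_partials n (U : plane -> Prop) f f1 f2 : open U -> Cp (S n) U f ->
  pl_partials U f f1 f2 -> Cp n U f1 /\ Cp n U f2.
Proof.
intros HU Hf HP; destruct (Cp_S _ _ _ Hf) as [g1 [g2 [HQ [H1 H2]]]].
split; [apply (Cp_ext n U g1)|apply (Cp_ext n U g2)]; auto; intros x Hx;
  destruct (pl_partials_Derive _ _ _ _ x HP Hx), (pl_partials_Derive _ _ _ _ x HQ Hx); congruence.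
Qed.

Lemma pl_partials_differentiable n (U : plane -> Prop) f f1 f2 u v :
  open U -> pl_partials U f f1 f2 -> Cp n U f1 -> U (u, v) ->
  differentiable_pt_lim (fun a b => f (a, b)) u v (f1 (u, v)) (f2 (u, v)).
Proof.
intros HU HP Hf1 Hx.
apply (partials_differentiable (fun z => U (snd z)) (fun z => f (snd z))
  (fun z => f1 (snd z)) (fun z => f2 (snd z)) 0 u v); auto.
- now apply open_cylinder.
- intros s a b Hz; exact (HP a b Hz).
- eapply Cn_continuous; eauto.
Qed.

(** * Inverse function theorem *)

(** The ball of the maximum norm rather than a disc: it fits the product topology and contains the
    corner joining two of its points by axis-parallel segments. *)
Definition sq (d : R) (x : plane) : Prop := Rabs (fst x) < d /\ Rabs (snd x) < d.

Lemma open_sq d : open (sq d).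
Proof.
apply open_and.
- apply (open_preimage (fun x : R * R => fst x) (fun t => Rabs t < d)); [intros; cont|].
  apply (open_lt_cont (T := R_UniformSpace) Rabs d), continuous_Rabs.
- apply (open_preimage (fun x : R * R => snd x) (fun t => Rabs t < d)); [intros; cont|].
  apply (open_lt_cont (T := R_UniformSpace) Rabs d), continuous_Rabs.
Qed.

Lemma sq_origin d : 0 < d -> sq d (0, 0).
Proof. intros H; split; simpl; rewrite Rabs_R0; auto. Qed.

Lemma sq_le d e x : d <= e -> sq d x -> sq e x.
Proof. intros H []; split; lra. Qed.

Lemma locally_sq (P : plane -> Prop) :
  locally (0, 0) P -> exists d, 0 < d /\ forall x, sq d x -> P x.
Proof.
intros [d Hd]; exists d; split; [apply cond_pos|].
intros [u v] [Hu Hv]; apply Hd; split; simpl in *;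
  [change (Rabs (u - 0) < d) | change (Rabs (v - 0) < d)]; now rewrite Rminus_0_r.
Qed.

Lemma sq_locally d : 0 < d -> locally (0, 0) (sq d).
Proof. intros H; apply open_sq; now apply sq_origin. Qed.

Definition pdist (x y : plane) : R := Rmax (Rabs (fst x - fst y)) (Rabs (snd x - snd y)).

Lemma pdist_fst x y : Rabs (fst x - fst y) <= pdist x y.
Proof. apply Rmax_l. Qed.

Lemma pdist_snd x y : Rabs (snd x - snd y) <= pdist x y.
Proof. apply Rmax_r. Qed.

Lemma pdist_pos x y : 0 <= pdist x y.
Proof. apply Rle_trans with (2 := pdist_fst x y), Rabs_pos. Qed.

Lemma derive_bound_lipschitz (f f' : R -> R) (a b M : R) :
  (forall t, Rmin a b <= t <= Rmax a b -> is_derive f t (f' t) /\ Rabs (f' t) <= M) ->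
  Rabs (f b - f a) <= M * Rabs (b - a).
Proof.
intros H; destruct (MVT_gen f a b f') as [c [Hc ->]].
- intros x Hx; apply H; lra.
- intros x Hx; apply continuity_pt_filterlim, (ex_derive_continuous (V := R_NormedModule)).
  eexists; apply H, Hx.
- rewrite Rabs_mult; apply Rmult_le_compat_r; [apply Rabs_pos | now apply H].
Qed.

Lemma between_abs_lt a b t d : Rabs a < d -> Rabs b < d -> Rmin a b <= t <= Rmax a b -> Rabs t < d.
Proof.
intros Ha Hb [H1 H2]; apply Rabs_def2 in Ha; apply Rabs_def2 in Hb.
revert H1 H2; unfold Rmin, Rmax; destruct (Rle_dec a b); intros; apply Rabs_def1; lra.
Qed.

Lemma lipschitz_sq f f1 f2 d M : 0 <= M ->
  pl_partials (sq d) f f1 f2 ->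
  (forall x, sq d x -> Rabs (f1 x) <= M /\ Rabs (f2 x) <= M) ->
  forall x y, sq d x -> sq d y -> Rabs (f x - f y) <= 2 * M * pdist x y.
Proof.
intros HM HP HB [u v] [u' v'] [Hu Hv] [Hu' Hv']; simpl in *.
(* The path goes through the corner (u', v), so the mean value theorem in one variable applies
   twice. *)
replace (f (u, v) - f (u', v')) with
  ((f (u, v) - f (u', v)) + (f (u', v) - f (u', v'))) by ring.
eapply Rle_trans; [apply Rabs_triang|].
assert (H1 : Rabs (f (u, v) - f (u', v)) <= M * Rabs (u - u')).
{ apply (derive_bound_lipschitz (fun t => f (t, v)) (fun t => f1 (t, v))).
  intros t Ht; assert (Hx : sq d (t, v)) by (split; auto; now apply (between_abs_lt u' u)).
  split; [apply HP, Hx | apply HB, Hx]. }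
assert (H2 : Rabs (f (u', v) - f (u', v')) <= M * Rabs (v - v')).
{ apply (derive_bound_lipschitz (fun t => f (u', t)) (fun t => f2 (u', t))).
  intros t Ht; assert (Hx : sq d (u', t)) by (split; auto; now apply (between_abs_lt v' v)).
  split; [apply HP, Hx | apply HB, Hx]. }
assert (H3 := pdist_fst (u, v) (u', v')); assert (H4 := pdist_snd (u, v) (u', v')); simpl in *.
nra.
Qed.

Lemma geometric_steps_converge (a : nat -> R) (C q : R) : 0 <= q < 1 ->
  (forall n, Rabs (a (S n) - a n) <= C * q ^ n) -> exists l : R, is_lim_seq a l.
Proof.
intros Hq Ha.
assert (HS : ex_series (fun n => a (S n) - a n)).
{ apply (ex_series_le (V := R_CompleteNormedModule) _ (fun n => C * q ^ n)); [exact Ha|].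
  apply (ex_series_scal_l C (fun n => q ^ n)), ex_series_geom.
  rewrite Rabs_pos_eq; lra. }
destruct HS as [l Hl]; exists (l + a 0%nat).
apply is_lim_seq_incr_1.
apply (is_lim_seq_ext (fun n => sum_n (fun n => a (S n) - a n) n + a 0%nat)).
- induction n as [|n IH]; [rewrite sum_O; ring|].
  rewrite sum_Sn; change plus with Rplus; lra.
- apply (is_lim_seq_plus' _ (fun _ => a 0%nat)); [exact Hl | apply is_lim_seq_const].
Qed.

(** Banach iteration from the origin: the steps shrink like 2^-n, and the box, being closed,
    contains the limit. *)
Lemma contraction_fixpoint (T1 T2 : plane -> R) (c : R) : 0 <= c ->
  let box x := Rabs (fst x) <= c /\ Rabs (snd x) <= c in
  (forall x, box x -> box (T1 x, T2 x)) ->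
  (forall x y, box x -> box y -> Rabs (T1 x - T1 y) <= / 2 * pdist x y /\
     Rabs (T2 x - T2 y) <= / 2 * pdist x y) ->
  exists x, box x /\ T1 x = fst x /\ T2 x = snd x.
Proof.
intros Hc box Hbox HT.
set (X := fix X n := match n with O => (0, 0) | S n => (T1 (X n), T2 (X n)) end).
assert (HX : forall n, box (X n)).
{ induction n; simpl; [|auto]; unfold box; simpl; rewrite Rabs_R0; lra. }
set (C := pdist (X 1%nat) (X 0%nat)).
assert (HD : forall n, pdist (X (S n)) (X n) <= C * (/ 2) ^ n).
{ induction n as [|n IH]; [simpl; unfold C; simpl; lra|].
  destruct (HT (X (S n)) (X n) (HX (S n)) (HX n)) as [H1 H2].
  replace (C * (/ 2) ^ S n) with (/ 2 * (C * (/ 2) ^ n)) by (simpl; ring).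
  apply Rmax_lub; simpl in *; lra. }
destruct (geometric_steps_converge (fun n => fst (X n)) C (/ 2)) as [a Ha]; [lra| |].
{ intros n; eapply Rle_trans; [apply pdist_fst | apply HD]. }
destruct (geometric_steps_converge (fun n => snd (X n)) C (/ 2)) as [b Hb]; [lra| |].
{ intros n; eapply Rle_trans; [apply pdist_snd | apply HD]. }
assert (Hab : box (a, b)).
{ split; simpl.
  - apply (is_lim_seq_le (fun n => Rabs (fst (X n))) (fun _ => c) (Rabs a) c).
    + intros n; apply HX.
    + apply (is_lim_seq_abs _ a), Ha.
    + apply is_lim_seq_const.
  - apply (is_lim_seq_le (fun n => Rabs (snd (X n))) (fun _ => c) (Rabs b) c).
    + intros n; apply HX.
    + apply (is_lim_seq_abs _ b), Hb.
    + apply is_lim_seq_const. }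
assert (Hlim : is_lim_seq (fun n => / 2 * (Rabs (fst (X n) - a) + Rabs (snd (X n) - b))) 0).
{ replace (Finite 0) with (Rbar_mult (/ 2) 0) by (simpl; now rewrite Rmult_0_r).
  apply is_lim_seq_scal_l.
  replace (Finite 0) with (Finite (Rabs (a - a) + Rabs (b - b)))
    by (f_equal; rewrite !Rminus_diag, Rabs_R0; ring).
  apply is_lim_seq_plus'.
  - apply (is_lim_seq_abs _ (a - a)), is_lim_seq_minus'; [exact Ha | apply is_lim_seq_const].
  - apply (is_lim_seq_abs _ (b - b)), is_lim_seq_minus'; [exact Hb | apply is_lim_seq_const]. }
assert (Hmax : forall n, pdist (X n) (a, b) <= Rabs (fst (X n) - a) + Rabs (snd (X n) - b)).
{ intros n; assert (H1 := Rabs_pos (fst (X n) - a)); assert (H2 := Rabs_pos (snd (X n) - b)).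
  apply Rmax_lub; simpl; lra. }
(* A coordinate of the iterates tends to l, while the contraction estimate makes its shift tend to
   m. *)
assert (HE : forall (x : nat -> R) (l m : R), is_lim_seq x l ->
  (forall n, Rabs (x (S n) - m) <= / 2 * pdist (X n) (a, b)) -> m = l).
{ intros x l m Hx Hm.
  assert (H0 : is_lim_seq (fun n => x (S n) - m) 0).
  { apply is_lim_seq_abs_0, (is_lim_seq_le_le (fun _ => 0) _
      (fun n => / 2 * (Rabs (fst (X n) - a) + Rabs (snd (X n) - b)))); auto.
    - intros n; split; [apply Rabs_pos|].
      eapply Rle_trans; [apply Hm|]; specialize (Hmax n); lra.
    - apply is_lim_seq_const. }
  apply is_lim_seq_incr_1 in Hx.
  assert (H1 := is_lim_seq_minus' _ _ _ _ Hx (is_lim_seq_const m)).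
  apply is_lim_seq_unique in H0; apply is_lim_seq_unique in H1.
  rewrite H0 in H1; injection H1; lra. }
exists (a, b); split; [exact Hab|]; split; simpl.
- apply (HE (fun n => fst (X n)) a (T1 (a, b)) Ha); intros n; simpl.
  apply (HT (X n) (a, b)); auto.
- apply (HE (fun n => snd (X n)) b (T2 (a, b)) Hb); intros n; simpl.
  apply (HT (X n) (a, b)); auto.
Qed.

Lemma is_derive_of_linear_bound (g : R -> R) (u l C : R) :
  (forall eps : posreal, locally u (fun t => Rabs (g t - g u - l * (t - u)) <= eps * C * Rabs (t - u))) ->
  is_derive g u l.
Proof.
intros H; apply is_derive_Reals; intros eps Heps.
assert (HC := Rabs_pos C).
(* This choice turns the non-strict bound with factor C, of whatever sign, into a strict one. *)
assert (He : 0 < eps / (2 * (Rabs C + 1))) by (apply Rdiv_lt_0_compat; lra).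
destruct (H (mkposreal _ He)) as [d Hd]; exists d; intros h Hh Hhd.
assert (Hb : ball u d (u + h)).
{ change (Rabs (u + h - u) < d); now replace (u + h - u) with h by ring. }
specialize (Hd _ Hb); simpl in Hd; replace (u + h - u) with h in Hd by ring.
assert (Hh0 := Rabs_pos_lt h Hh).
replace ((g (u + h) - g u) / h - l) with ((g (u + h) - g u - l * h) * / h) by (field; auto).
rewrite Rabs_mult, Rabs_inv.
apply Rmult_lt_reg_r with (Rabs h); auto.
rewrite Rmult_assoc, Rinv_l, Rmult_1_r by lra.
eapply Rle_lt_trans; [exact Hd|].
apply Rmult_lt_compat_r; auto.
assert (HCC := Rle_abs C).
apply Rle_lt_trans with (eps / (2 * (Rabs C + 1)) * Rabs C).
- apply Rmult_le_compat_l; lra.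
- apply Rmult_lt_reg_r with (2 * (Rabs C + 1)); [lra|].
  replace (eps / (2 * (Rabs C + 1)) * Rabs C * (2 * (Rabs C + 1))) with (eps * Rabs C) by (field; lra).
  nra.
Qed.

(* [e1], [e2] are the components of the velocity prescribed for [F o g]. *)
Lemma is_derive_inverse_curve (F1 F2 : R -> R -> R) (g1 g2 : R -> R) (u a b c d e1 e2 : R) :
  differentiable_pt_lim F1 (g1 u) (g2 u) a b ->
  differentiable_pt_lim F2 (g1 u) (g2 u) c d -> a * d - b * c <> 0 ->
  locally u (fun t => Rabs (g1 t - g1 u) <= 2 * Rabs (t - u) /\
    Rabs (g2 t - g2 u) <= 2 * Rabs (t - u) /\
    F1 (g1 t) (g2 t) = F1 (g1 u) (g2 u) + e1 * (t - u) /\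
    F2 (g1 t) (g2 t) = F2 (g1 u) (g2 u) + e2 * (t - u)) ->
  is_derive g1 u ((d * e1 - b * e2) / (a * d - b * c)) /\
  is_derive g2 u ((a * e2 - c * e1) / (a * d - b * c)).
Proof.
intros H1 H2 HD HL; set (D := a * d - b * c) in *.
(* The linearisation errors of F1 and F2 along the curve are o(|t - u|), because the curve is
   Lipschitz at u. *)
assert (HE : forall eps : posreal, locally u (fun t =>
  exists r1 r2, Rabs r1 <= eps * 2 * Rabs (t - u) /\ Rabs r2 <= eps * 2 * Rabs (t - u) /\
   e1 * (t - u) = a * (g1 t - g1 u) + b * (g2 t - g2 u) + r1 /\
   e2 * (t - u) = c * (g1 t - g1 u) + d * (g2 t - g2 u) + r2)).
{ intros eps; destruct (H1 eps) as [d1 Hd1], (H2 eps) as [d2 Hd2], HL as [d3 Hd3].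
  (* The curve moves at most twice as far as t, hence the halved radius. *)
  assert (Hm : 0 < Rmin (Rmin d1 d2 / 2) d3).
  { assert (P1 := cond_pos d1); assert (P2 := cond_pos d2); assert (P3 := cond_pos d3).
    apply Rmin_glb_lt; [|auto]; apply Rdiv_lt_0_compat; [apply Rmin_glb_lt; auto | lra]. }
  exists (mkposreal _ Hm); intros t Ht; change (Rabs (t - u) < Rmin (Rmin d1 d2 / 2) d3) in Ht.
  assert (Hd : Rabs (t - u) < d3) by (eapply Rlt_le_trans; [apply Ht | apply Rmin_r]).
  assert (Hd' : Rabs (t - u) < Rmin d1 d2 / 2) by (eapply Rlt_le_trans; [apply Ht | apply Rmin_l]).
  assert (Hd1' := Rmin_l d1 d2); assert (Hd2' := Rmin_r d1 d2).
  destruct (Hd3 t Hd) as [L1 [L2 [E1 E2]]].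
  assert (HM : Rmax (Rabs (g1 t - g1 u)) (Rabs (g2 t - g2 u)) <= 2 * Rabs (t - u))
    by (apply Rmax_lub; auto).
  assert (Hep := cond_pos eps).
  specialize (Hd1 (g1 t) (g2 t) ltac:(lra) ltac:(lra)).
  specialize (Hd2 (g1 t) (g2 t) ltac:(lra) ltac:(lra)).
  exists (F1 (g1 t) (g2 t) - F1 (g1 u) (g2 u) - (a * (g1 t - g1 u) + b * (g2 t - g2 u))).
  exists (F2 (g1 t) (g2 t) - F2 (g1 u) (g2 u) - (c * (g1 t - g1 u) + d * (g2 t - g2 u))).
  repeat apply conj.
  - eapply Rle_trans; [apply Hd1|]; rewrite Rmult_assoc; apply Rmult_le_compat_l; lra.
  - eapply Rle_trans; [apply Hd2|]; rewrite Rmult_assoc; apply Rmult_le_compat_l; lra.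
  - rewrite E1; ring.
  - rewrite E2; ring. }
assert (HDp : 0 < Rabs (/ D)) by (apply Rabs_pos_lt, Rinv_neq_0_compat, HD).
assert (HX : forall p q r1 r2 m, Rabs r1 <= m -> Rabs r2 <= m ->
  Rabs (/ D * (p * r1 + q * r2)) <= m * (Rabs (/ D) * (Rabs p + Rabs q))).
{ intros p q r1 r2 m Hr1 Hr2; rewrite Rabs_mult.
  assert (Rabs (p * r1 + q * r2) <= Rabs p * m + Rabs q * m).
  { eapply Rle_trans; [apply Rabs_triang|]; rewrite !Rabs_mult.
    apply Rplus_le_compat; apply Rmult_le_compat_l; auto; apply Rabs_pos. }
  nra. }
split.
- apply (is_derive_of_linear_bound _ _ _ (2 * (Rabs (/ D) * (Rabs (- d) + Rabs b)))).
  intros eps; generalize (HE eps); apply filter_imp; intros t [r1 [r2 [B1 [B2 [E1 E2]]]]].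
  (* Cramer's rule applied to the two perturbed linear equations leaves only a combination of the
     errors. *)
  replace (g1 t - g1 u - (d * e1 - b * e2) / D * (t - u)) with (/ D * (- d * r1 + b * r2)).
  + eapply Rle_trans; [apply HX; eauto | apply Req_le; ring].
  + replace ((d * e1 - b * e2) / D * (t - u))
      with (/ D * (d * (e1 * (t - u)) - b * (e2 * (t - u)))) by (field; auto).
    rewrite E1, E2; replace (g1 t - g1 u) with (/ D * (D * (g1 t - g1 u))) at 1 by (field; auto).
    unfold D at 3; ring.
- apply (is_derive_of_linear_bound _ _ _ (2 * (Rabs (/ D) * (Rabs c + Rabs (- a))))).
  intros eps; generalize (HE eps); apply filter_imp; intros t [r1 [r2 [B1 [B2 [E1 E2]]]]].
  replace (g2 t - g2 u - (a * e2 - c * e1) / D * (t - u)) with (/ D * (c * r1 + - a * r2)).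
  + eapply Rle_trans; [apply HX; eauto | apply Req_le; ring].
  + replace ((a * e2 - c * e1) / D * (t - u))
      with (/ D * (a * (e2 * (t - u)) - c * (e1 * (t - u)))) by (field; auto).
    rewrite E1, E2; replace (g2 t - g2 u) with (/ D * (D * (g2 t - g2 u))) at 1 by (field; auto).
    unfold D at 3; ring.
Qed.

Lemma Cp_subset n (U V : plane -> Prop) f : (forall x, V x -> U x) -> Cp n U f -> Cp n V f.
Proof. intros HS; apply Cn_subset; intros z; apply HS. Qed.

Lemma pl_partials_subset (U V : plane -> Prop) f f1 f2 :
  (forall x, V x -> U x) -> pl_partials U f f1 f2 -> pl_partials V f f1 f2.
Proof. intros HS HP u v Hx; apply HP, HS, Hx. Qed.

(** The four functions are the entries of the inverse of the matrix (f_ij), taken at (G1 y, G2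
    y). *)
Definition inverse_partials (V : plane -> Prop) (G1 G2 f11 f12 f21 f22 : plane -> R) : Prop :=
  let det x := f11 x * f22 x - f12 x * f21 x in
  pl_partials V G1 (fun y => f22 (G1 y, G2 y) / det (G1 y, G2 y))
    (fun y => - f12 (G1 y, G2 y) / det (G1 y, G2 y)) /\
  pl_partials V G2 (fun y => - f21 (G1 y, G2 y) / det (G1 y, G2 y))
    (fun y => f11 (G1 y, G2 y) / det (G1 y, G2 y)).

(** Along a coordinate line of V the curve (G1, G2) is carried by F to uniform motion with velocity
    (1, 0) or (0, 1). A Lipschitz bound is therefore the only regularity asked of G. *)
Lemma lipschitz_inverse_partials n (U V : plane -> Prop) F1 F2 f11 f12 f21 f22 G1 G2 :
  open U -> open V -> Cp n U f11 -> Cp n U f21 ->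
  pl_partials U F1 f11 f12 -> pl_partials U F2 f21 f22 ->
  (forall x, U x -> f11 x * f22 x - f12 x * f21 x <> 0) ->
  (forall y, V y -> U (G1 y, G2 y) /\ F1 (G1 y, G2 y) = fst y /\ F2 (G1 y, G2 y) = snd y) ->
  (forall x y, V x -> V y -> Rabs (G1 x - G1 y) <= 2 * pdist x y /\
    Rabs (G2 x - G2 y) <= 2 * pdist x y) ->
  inverse_partials V G1 G2 f11 f12 f21 f22.
Proof.
intros HU HV H11 H21 HP1 HP2 Hdet HG HL.
assert (HD : forall y, V y ->
  differentiable_pt_lim (fun a b => F1 (a, b)) (G1 y) (G2 y)
    (f11 (G1 y, G2 y)) (f12 (G1 y, G2 y)) /\
  differentiable_pt_lim (fun a b => F2 (a, b)) (G1 y) (G2 y)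
    (f21 (G1 y, G2 y)) (f22 (G1 y, G2 y))).
{ intros y Hy; split.
  - exact (pl_partials_differentiable n U F1 f11 f12 _ _ HU HP1 H11 (proj1 (HG y Hy))).
  - exact (pl_partials_differentiable n U F2 f21 f22 _ _ HU HP2 H21 (proj1 (HG y Hy))). }
assert (Hfst : forall u v, V (u, v) ->
  let x := (G1 (u, v), G2 (u, v)) in let D := f11 x * f22 x - f12 x * f21 x in
  is_derive (fun t => G1 (t, v)) u ((f22 x * 1 - f12 x * 0) / D) /\
  is_derive (fun t => G2 (t, v)) u ((f11 x * 0 - f21 x * 1) / D)).
{ intros u v Hy x D; destruct (HD _ Hy) as [D1 D2].
  apply (is_derive_inverse_curve (fun a b => F1 (a, b)) (fun a b => F2 (a, b))
    (fun t => G1 (t, v)) (fun t => G2 (t, v)) u _ _ _ _ 1 0 D1 D2).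
  - apply Hdet, HG, Hy.
  - apply (filter_imp (fun t : R => V (t, v))).
    + intros t Ht; destruct (HL _ _ Ht Hy) as [L1 L2].
      destruct (HG _ Ht) as [_ [-> ->]], (HG _ Hy) as [_ [-> ->]].
      assert (HM : pdist (t, v) (u, v) = Rabs (t - u)).
      { unfold pdist; simpl; rewrite Rminus_diag, Rabs_R0; apply Rmax_left, Rabs_pos. }
      rewrite HM in L1, L2; repeat split; auto; simpl; ring.
    + apply (open_preimage (fun t : R => (t, v)) V); auto; intros; cont. }
assert (Hsnd : forall u v, V (u, v) ->
  let x := (G1 (u, v), G2 (u, v)) in let D := f11 x * f22 x - f12 x * f21 x in
  is_derive (fun t => G1 (u, t)) v ((f22 x * 0 - f12 x * 1) / D) /\
  is_derive (fun t => G2 (u, t)) v ((f11 x * 1 - f21 x * 0) / D)).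
{ intros u v Hy x D; destruct (HD _ Hy) as [D1 D2].
  apply (is_derive_inverse_curve (fun a b => F1 (a, b)) (fun a b => F2 (a, b))
    (fun t => G1 (u, t)) (fun t => G2 (u, t)) v _ _ _ _ 0 1 D1 D2).
  - apply Hdet, HG, Hy.
  - apply (filter_imp (fun t : R => V (u, t))).
    + intros t Ht; destruct (HL _ _ Ht Hy) as [L1 L2].
      destruct (HG _ Ht) as [_ [-> ->]], (HG _ Hy) as [_ [-> ->]].
      assert (HM : pdist (u, t) (u, v) = Rabs (t - v)).
      { unfold pdist; simpl; rewrite Rminus_diag, Rabs_R0; apply Rmax_right, Rabs_pos. }
      rewrite HM in L1, L2; repeat split; auto; simpl; ring.
    + apply (open_preimage (fun t : R => (u, t)) V); auto; intros; cont. }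
split; intros u v Hy; split.
- refine (is_derive_eq _ _ _ _ (proj1 (Hfst u v Hy)) _); f_equal; ring.
- refine (is_derive_eq _ _ _ _ (proj1 (Hsnd u v Hy)) _); f_equal; ring.
- refine (is_derive_eq _ _ _ _ (proj2 (Hfst u v Hy)) _); f_equal; ring.
- refine (is_derive_eq _ _ _ _ (proj2 (Hsnd u v Hy)) _); f_equal; ring.
Qed.

Lemma continuous_lipschitz (V : plane -> Prop) (g : plane -> R) C x : open V -> V x ->
  (forall y, V y -> Rabs (g y - g x) <= C * pdist y x) -> continuous g x.
Proof.
intros HV Hx HL; apply (filterlim_locally (U := R_UniformSpace)); intros eps.
assert (HC := Rabs_pos C).
assert (He : 0 < eps / (Rabs C + 1)) by (apply Rdiv_lt_0_compat; [apply cond_pos | lra]).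
generalize (filter_and _ _ (HV x Hx) (locally_ball x (mkposreal _ He))); apply filter_imp.
intros y [HVy [H1 H2]]; change (Rabs (g y - g x) < eps).
change (Rabs (fst y - fst x) < eps / (Rabs C + 1)) in H1.
change (Rabs (snd y - snd x) < eps / (Rabs C + 1)) in H2.
assert (HM : pdist y x < eps / (Rabs C + 1)) by (apply Rmax_lub_lt; auto).
assert (HM0 := pdist_pos y x); assert (HCC := Rle_abs C).
apply Rle_lt_trans with (Rabs C * (eps / (Rabs C + 1))).
- eapply Rle_trans; [apply HL, HVy|]; nra.
- apply Rmult_lt_reg_r with (Rabs C + 1); [lra|].
  assert (Hep := cond_pos eps).
  replace (Rabs C * (eps / (Rabs C + 1)) * (Rabs C + 1)) with (Rabs C * eps) by (field; lra).
  nra.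
Qed.

(** Bootstrap: the partials of G are rational expressions in the f_ij taken at G, so class j of G
    gives class j + 1, until the class n of the f_ij stops the process. *)
Lemma Cp_inverse n (U V : plane -> Prop) f11 f12 f21 f22 G1 G2 : open U ->
  Cp n U f11 -> Cp n U f12 -> Cp n U f21 -> Cp n U f22 ->
  (forall x, U x -> f11 x * f22 x - f12 x * f21 x <> 0) ->
  (forall y, V y -> U (G1 y, G2 y)) -> Cp 0 V G1 -> Cp 0 V G2 ->
  inverse_partials V G1 G2 f11 f12 f21 f22 ->
  Cp (S n) V G1 /\ Cp (S n) V G2.
Proof.
intros HU H11 H12 H21 H22 Hdet HG HG1 HG2 [HP1 HP2].
assert (H : forall j, (j <= S n)%nat -> Cp j V G1 /\ Cp j V G2).
{ induction j as [|j IH]; intros Hj; [auto|].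
  destruct IH as [IH1 IH2]; [lia|].
  assert (HC : forall f, Cp n U f -> Cp j V (fun y => f (G1 y, G2 y))).
  { intros f Hf; apply (Cp_comp j _ U f); auto.
    apply (Cn_le j n); auto; lia. }
  assert (HI : Cp j V (fun y => / (f11 (G1 y, G2 y) * f22 (G1 y, G2 y) -
      f12 (G1 y, G2 y) * f21 (G1 y, G2 y)))).
  { apply Cn_inv; [intros z Hz; apply Hdet, HG, Hz|].
    apply Cn_minus; apply Cn_mult; apply HC; auto. }
  split; (eapply Cp_S_intro; [auto|eauto| |]);
    (apply Cn_mult; [|exact HI]); try apply Cn_opp; apply HC; auto. }
apply H; lia.
Qed.

(** On a square where the partials are within 1/8 of those of the identity, x - F x is Lipschitz
    with constant 1/4. Hence F is injective with a 2-Lipschitz inverse, and x |-> y + x - F x is a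
    contraction whose fixed point solves F x = y. *)
Lemma inverse_near_identity n (U : plane -> Prop) F1 F2 f11 f12 f21 f22 :
  open U -> U (0, 0) -> F1 (0, 0) = 0 -> F2 (0, 0) = 0 ->
  Cp (S n) U F1 -> Cp (S n) U F2 ->
  pl_partials U F1 f11 f12 -> pl_partials U F2 f21 f22 ->
  f11 (0, 0) = 1 -> f12 (0, 0) = 0 -> f21 (0, 0) = 0 -> f22 (0, 0) = 1 ->
  exists d r G1 G2, 0 < d /\ 0 < r /\ (forall x, sq d x -> U x) /\
    (forall y, sq r y -> sq d (G1 y, G2 y) /\
       F1 (G1 y, G2 y) = fst y /\ F2 (G1 y, G2 y) = snd y) /\
    (forall x y, sq d x -> sq d y -> F1 x = F1 y -> F2 x = F2 y -> x = y) /\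
    Cp (S n) (sq r) G1 /\ Cp (S n) (sq r) G2.
Proof.
intros HU HU0 F10 F20 HF1 HF2 HP1 HP2 E11 E12 E21 E22.
destruct (Cp_partials _ _ _ _ _ HU HF1 HP1) as [C11 C12].
destruct (Cp_partials _ _ _ _ _ HU HF2 HP2) as [C21 C22].
assert (HN : forall f (c : R), Cp n U f -> f (0, 0) = c ->
  locally (0, 0) (fun x : R * R => Rabs (f x - c) < / 8)).
{ intros f c Hf <-.
  assert (He : 0 < / 8) by lra.
  apply (proj1 (filterlim_locally (U := R_UniformSpace) f (f (0, 0)))
    (Cp_continuous _ _ _ _ Hf HU0) (mkposreal _ He)). }
assert (HL := filter_and _ _ (HU _ HU0) (filter_and _ _
  (filter_and _ _ (HN _ _ C11 E11) (HN _ _ C12 E12))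
  (filter_and _ _ (HN _ _ C21 E21) (HN _ _ C22 E22)))).
destruct (locally_sq _ HL) as [d [Hd HS]]; clear HN HL E11 E12 E21 E22.
assert (HSU : forall x, sq d x -> U x) by (intros x Hx; apply HS, Hx).
assert (HQ1 := pl_partials_subset _ _ _ _ _ HSU HP1).
assert (HQ2 := pl_partials_subset _ _ _ _ _ HSU HP2).
assert (L1 : forall x y, sq d x -> sq d y ->
  Rabs ((fst x - F1 x) - (fst y - F1 y)) <= / 4 * pdist x y).
{ intros x y Hx Hy.
  assert (HH := lipschitz_sq (fun x => fst x - F1 x) (fun x => 1 - f11 x) (fun x => 0 - f12 x) d (/ 8)).
  replace (/ 4) with (2 * / 8) by lra; apply HH; auto; [lra| |].
  - intros u v Huv; destruct (HQ1 u v Huv); simpl; split.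
    + apply (is_derive_minus (V := R_NormedModule) (fun t => t) (fun t => F1 (t, v)));
        auto using is_derive_Rid.
    + apply (is_derive_minus (V := R_NormedModule) (fun t => u) (fun t => F1 (u, t)));
        auto using is_derive_Rconst.
  - intros z Hz; destruct (HS z Hz) as [_ [[A B] _]].
    rewrite Rabs_minus_sym in A; rewrite Rabs_minus_sym in B; lra. }
assert (L2 : forall x y, sq d x -> sq d y ->
  Rabs ((snd x - F2 x) - (snd y - F2 y)) <= / 4 * pdist x y).
{ intros x y Hx Hy.
  assert (HH := lipschitz_sq (fun x => snd x - F2 x) (fun x => 0 - f21 x) (fun x => 1 - f22 x) d (/ 8)).
  replace (/ 4) with (2 * / 8) by lra; apply HH; auto; [lra| |].
  - intros u v Huv; destruct (HQ2 u v Huv); simpl; split.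
    + apply (is_derive_minus (V := R_NormedModule) (fun t => v) (fun t => F2 (t, v)));
        auto using is_derive_Rconst.
    + apply (is_derive_minus (V := R_NormedModule) (fun t => t) (fun t => F2 (u, t)));
        auto using is_derive_Rid.
  - intros z Hz; destruct (HS z Hz) as [_ [_ [A B]]].
    rewrite Rabs_minus_sym in A; rewrite Rabs_minus_sym in B; lra. }
assert (Hexp : forall x y, sq d x -> sq d y ->
  pdist x y <= 2 * pdist (F1 x, F2 x) (F1 y, F2 y)).
{ intros x y Hx Hy; specialize (L1 x y Hx Hy); specialize (L2 x y Hx Hy).
  assert (A1 := pdist_fst (F1 x, F2 x) (F1 y, F2 y)).
  assert (A2 := pdist_snd (F1 x, F2 x) (F1 y, F2 y)); simpl in A1, A2.
  set (e := pdist (F1 x, F2 x) (F1 y, F2 y)) in *.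
  assert (HM : pdist x y <= e + / 4 * pdist x y).
  { apply Rmax_lub.
    - replace (fst x - fst y) with ((F1 x - F1 y) + ((fst x - F1 x) - (fst y - F1 y))) by ring.
      eapply Rle_trans; [apply Rabs_triang | lra].
    - replace (snd x - snd y) with ((F2 x - F2 y) + ((snd x - F2 x) - (snd y - F2 y))) by ring.
      eapply Rle_trans; [apply Rabs_triang | lra]. }
  assert (H0 := pdist_pos x y); lra. }
(* For |y| < d/4 the contraction preserves the box of size d/2, as d/4 + (1/4)(d/2) < d/2. For other
   y the origin serves as a default. *)
assert (HE : forall y, exists x : plane, sq (d / 4) y -> sq d x /\ F1 x = fst y /\ F2 x = snd y).
{ intros y; destruct (Classical_Prop.classic (sq (d / 4) y)) as [Hy|Hy]; [|now exists (0, 0)].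
  assert (Hbox : forall x : plane, Rabs (fst x) <= d / 2 /\ Rabs (snd x) <= d / 2 -> sq d x).
  { intros x [A B]; split; lra. }
  destruct (contraction_fixpoint (fun x => fst y + (fst x - F1 x))
    (fun x => snd y + (snd x - F2 x)) (d / 2)) as [x [Hx [X1 X2]]]; [lra| | |].
  - intros x Hx; destruct Hy as [Y1 Y2].
    assert (A1 := L1 x (0, 0) (Hbox x Hx) (sq_origin d Hd)).
    assert (A2 := L2 x (0, 0) (Hbox x Hx) (sq_origin d Hd)); simpl in A1, A2.
    rewrite F10, !Rminus_0_r in A1; rewrite F20, !Rminus_0_r in A2.
    assert (HM : pdist x (0, 0) <= d / 2) by (apply Rmax_lub; simpl; rewrite Rminus_0_r; apply Hx).
    simpl; split; (eapply Rle_trans; [apply Rabs_triang | lra]).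
  - intros x x' Hx Hx'.
    assert (A1 := L1 x x' (Hbox x Hx) (Hbox x' Hx')).
    assert (A2 := L2 x x' (Hbox x Hx) (Hbox x' Hx')).
    assert (A3 := pdist_pos x x').
    replace (fst y + (fst x - F1 x) - (fst y + (fst x' - F1 x')))
      with (fst x - F1 x - (fst x' - F1 x')) by ring.
    replace (snd y + (snd x - F2 x) - (snd y + (snd x' - F2 x')))
      with (snd x - F2 x - (snd x' - F2 x')) by ring.
    split; lra.
  - exists x; intros _; split; [apply Hbox, Hx | lra]. }
set (G := fun y => proj1_sig (constructive_indefinite_description _ (HE y))).
assert (HG : forall y, sq (d / 4) y -> sq d (G y) /\ F1 (G y) = fst y /\ F2 (G y) = snd y).
{ intros y; unfold G; now destruct (constructive_indefinite_description _ (HE y)). }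
clearbody G.
assert (HG' : forall y, sq (d / 4) y -> sq d (fst (G y), snd (G y)) /\
  F1 (fst (G y), snd (G y)) = fst y /\ F2 (fst (G y), snd (G y)) = snd y).
{ intros y; rewrite <- surjective_pairing; apply HG. }
assert (HLip : forall x y, sq (d / 4) x -> sq (d / 4) y -> pdist (G x) (G y) <= 2 * pdist x y).
{ intros x y Hx Hy; destruct (HG x Hx) as [S1 [X1 X2]], (HG y Hy) as [S2 [Y1 Y2]].
  specialize (Hexp _ _ S1 S2); now rewrite X1, X2, Y1, Y2 in Hexp. }
assert (Hdet : forall x, sq d x -> f11 x * f22 x - f12 x * f21 x <> 0).
{ intros x Hx; destruct (HS x Hx) as [_ [[A B] [C D]]].
  apply Rabs_def2 in A; apply Rabs_def2 in B; apply Rabs_def2 in C; apply Rabs_def2 in D.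
  nra. }
assert (HI : inverse_partials (sq (d / 4)) (fun y => fst (G y)) (fun y => snd (G y)) f11 f12 f21 f22).
{ apply (lipschitz_inverse_partials n (sq d) (sq (d / 4)) F1 F2); auto;
    try apply open_sq; try (eapply Cp_subset; eauto; fail).
  intros x y Hx Hy; specialize (HLip x y Hx Hy).
  assert (A1 := pdist_fst (G x) (G y)); assert (A2 := pdist_snd (G x) (G y)); lra. }
exists d, (d / 4), (fun y => fst (G y)), (fun y => snd (G y)).
repeat (apply conj; [first [lra | assumption]|]); apply conj.
{ intros x y Hx Hy E1 E2; specialize (Hexp x y Hx Hy); rewrite E1, E2 in Hexp.
  assert (H0 : pdist (F1 y, F2 y) (F1 y, F2 y) = 0).
  { unfold pdist; rewrite !Rminus_diag, Rabs_R0; apply Rmax_left; lra. }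
  rewrite H0 in Hexp; assert (A1 := pdist_fst x y); assert (A2 := pdist_snd x y).
  destruct x as [x1 x2], y as [y1 y2]; simpl in *; f_equal; apply Rminus_diag_uniq;
    apply Rabs_eq_0; apply Rle_antisym; try apply Rabs_pos; lra. }
apply (Cp_inverse n (sq d) _ f11 f12 f21 f22); auto; try apply open_sq;
  try (eapply Cp_subset; eauto; fail).
- intros y Hy; apply HG', Hy.
- apply continuous_Cp0; intros x Hx.
  apply (continuous_lipschitz (sq (d / 4)) _ 2); auto; [apply open_sq|].
  intros y Hy; eapply Rle_trans; [apply pdist_fst | auto].
- apply continuous_Cp0; intros x Hx.
  apply (continuous_lipschitz (sq (d / 4)) _ 2); auto; [apply open_sq|].
  intros y Hy; eapply Rle_trans; [apply pdist_snd | auto].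
Qed.

Lemma pl_partials_lin (U : plane -> Prop) f g f1 f2 g1 g2 a b :
  pl_partials U f f1 f2 -> pl_partials U g g1 g2 ->
  pl_partials U (fun x => a * f x + b * g x) (fun x => a * f1 x + b * g1 x)
    (fun x => a * f2 x + b * g2 x).
Proof.
intros HP HQ u v Hx; destruct (HP u v Hx), (HQ u v Hx); split;
  apply is_derive_Rplus; now apply (is_derive_scal (fun t => _)).
Qed.

Lemma Cp_lin n (U : plane -> Prop) f g a b :
  Cp n U f -> Cp n U g -> Cp n U (fun x => a * f x + b * g x).
Proof. intros; apply Cn_plus; apply Cn_mult; auto; apply Cn_const. Qed.

(** Composing F with the inverse of its Jacobian matrix at the origin reduces to the case near the
    identity; the local inverse is then precomposed with the same matrix, [B1], [B2]. *)
Lemma inverse_function n (U : plane -> Prop) F1 F2 f11 f12 f21 f22 :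
  open U -> U (0, 0) -> F1 (0, 0) = 0 -> F2 (0, 0) = 0 ->
  Cp (S n) U F1 -> Cp (S n) U F2 ->
  pl_partials U F1 f11 f12 -> pl_partials U F2 f21 f22 ->
  f11 (0, 0) * f22 (0, 0) - f12 (0, 0) * f21 (0, 0) <> 0 ->
  exists d r G1 G2, 0 < d /\ 0 < r /\ (forall x, sq d x -> U x) /\
    (forall y, sq r y -> sq d (G1 y, G2 y) /\
       F1 (G1 y, G2 y) = fst y /\ F2 (G1 y, G2 y) = snd y) /\
    (forall x, sq d x -> sq r (F1 x, F2 x) ->
       (G1 (F1 x, F2 x), G2 (F1 x, F2 x)) = x) /\
    Cp (S n) (sq r) G1 /\ Cp (S n) (sq r) G2.
Proof.
intros HU HU0 F10 F20 HF1 HF2 HP1 HP2.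
set (a := f11 (0, 0)); set (b := f12 (0, 0)); set (c := f21 (0, 0)); set (e := f22 (0, 0)).
set (D := a * e - b * c); intros HD.
destruct (inverse_near_identity n U
  (fun x => e / D * F1 x + - b / D * F2 x) (fun x => - c / D * F1 x + a / D * F2 x)
  (fun x => e / D * f11 x + - b / D * f21 x) (fun x => e / D * f12 x + - b / D * f22 x)
  (fun x => - c / D * f11 x + a / D * f21 x) (fun x => - c / D * f12 x + a / D * f22 x))
  as [d [r [G1 [G2 [Hd [Hr [HSU [HG [HI [HG1 HG2]]]]]]]]]]; auto;
  try (now apply pl_partials_lin); try (now apply Cp_lin);
  try (rewrite F10, F20; ring).
- fold a b c e; unfold D; field; exact HD.
- fold a b c e; field; auto.
- fold a b c e; field; auto.
- fold a b c e; unfold D; field; exact HD.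
- set (B1 := fun y : plane => e / D * fst y + - b / D * snd y) in *.
  set (B2 := fun y : plane => - c / D * fst y + a / D * snd y) in *.
  assert (HB : locally (0, 0) (fun y : R * R => sq r (B1 y, B2 y))).
  { apply (open_preimage (fun y : R * R => (B1 y, B2 y)) (sq r)); [|apply open_sq|].
    - intros; unfold B1, B2; cont.
    - replace (B1 (0, 0), B2 (0, 0)) with (0, 0) by (unfold B1, B2; simpl; f_equal; ring).
      now apply sq_origin. }
  destruct (locally_sq _ HB) as [r' [Hr' HBr]].
  exists d, r', (fun y => G1 (B1 y, B2 y)), (fun y => G2 (B1 y, B2 y)).
  assert (HGF : forall y, sq r' y -> sq d (G1 (B1 y, B2 y), G2 (B1 y, B2 y)) /\
    F1 (G1 (B1 y, B2 y), G2 (B1 y, B2 y)) = fst y /\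
    F2 (G1 (B1 y, B2 y), G2 (B1 y, B2 y)) = snd y).
  { intros y Hy; destruct (HG _ (HBr y Hy)) as [A [E1 E2]]; split; auto.
    set (x := (G1 (B1 y, B2 y), G2 (B1 y, B2 y))) in *; simpl in E1, E2.
    assert (X1 : F1 x = a * (e / D * F1 x + - b / D * F2 x) +
      b * (- c / D * F1 x + a / D * F2 x)) by (unfold D; field; exact HD).
    assert (X2 : F2 x = c * (e / D * F1 x + - b / D * F2 x) +
      e * (- c / D * F1 x + a / D * F2 x)) by (unfold D; field; exact HD).
    rewrite E1, E2 in X1, X2; rewrite X1, X2.
    unfold B1, B2, D; split; field; exact HD. }
  repeat (apply conj; [assumption|]); apply conj; [|split].
  + intros x Hx Hy; destruct (HGF _ Hy) as [A [E1 E2]]; simpl in E1, E2.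
    apply HI; auto; now rewrite E1, E2.
  + apply (Cp_comp (S n) _ (sq r) G1); [apply open_sq | assumption | | | intros z Hz; apply HBr, Hz];
      (apply (Cp_lin _ _ fst snd); [apply Cn_fst | apply Cn_snd]).
  + apply (Cp_comp (S n) _ (sq r) G2); [apply open_sq | assumption | | | intros z Hz; apply HBr, Hz];
      (apply (Cp_lin _ _ fst snd); [apply Cn_fst | apply Cn_snd]).
Qed.

(** * Means over dilations and rotations *)

(* Multiplication by [p + i q]: dilations for [q = 0], rotations for [(p, q) = (cos t, sin t)]. *)
Definition cmul (p q : R) (x : plane) : plane :=
  (p * fst x - q * snd x, q * fst x + p * snd x).

(** One weighted mean over a path of conformal linear maps covers the Hadamard coefficients, the
    radial mean and both rotation integrals. *)
Definition conf_int (a b : R) (phi al be : R -> R) (f : plane -> R) (x : plane) : R :=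
  RInt (fun s => phi s * f (cmul (al s) (be s) x)) a b.

Definition conf_stable (a b : R) (al be : R -> R) (U : plane -> Prop) : Prop :=
  forall s x, a <= s <= b -> U x -> U (cmul (al s) (be s) x).

Lemma Cn_cmul n O (al be : R -> R) :
  (forall s, continuous al s) -> (forall s, continuous be s) ->
  Cn n O (fun z => fst (cmul (al (fst z)) (be (fst z)) (snd z))) /\
  Cn n O (fun z => snd (cmul (al (fst z)) (be (fst z)) (snd z))).
Proof.
intros Ha Hb; cbn [cmul fst snd]; split;
  [apply Cn_minus | apply Cn_plus]; apply Cn_mult;
  first [now apply Cn_param | apply Cn_fst | apply Cn_snd].
Qed.

Lemma open_cmul_preimage (al be : R -> R) (U : plane -> Prop) :
  (forall s, continuous al s) -> (forall s, continuous be s) -> open U ->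
  open (fun z : space => U (cmul (al (fst z)) (be (fst z)) (snd z))).
Proof.
intros Ha Hb HU.
apply (open_preimage (fun z : space => cmul (al (fst z)) (be (fst z)) (snd z)) U); auto.
intros z; assert (Ha' : continuous (fun z : space => al (fst z)) z)
  by (apply (continuous_comp (fun z : space => fst z) al); auto; cont).
assert (Hb' : continuous (fun z : space => be (fst z)) z)
  by (apply (continuous_comp (fun z : space => fst z) be); auto; cont).
unfold cmul; cont.
Qed.

Lemma Cn_conf_integrand n (phi al be : R -> R) (U : plane -> Prop) f :
  (forall s, continuous phi s) ->
  (forall s, continuous al s) -> (forall s, continuous be s) -> open U -> Cp n U f ->
  Cn n (fun z => U (cmul (al (fst z)) (be (fst z)) (snd z)))
    (fun z => phi (fst z) * f (cmul (al (fst z)) (be (fst z)) (snd z))).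
Proof.
intros Hp Ha Hb HU Hf; apply Cn_mult; [now apply Cn_param|].
destruct (Cn_cmul n (fun z => U (cmul (al (fst z)) (be (fst z)) (snd z))) al be Ha Hb).
now apply (Cp_comp n _ U f).
Qed.

Lemma Cp_conf_int n a b (phi al be : R -> R) (U : plane -> Prop) f : a <= b ->
  (forall s, continuous phi s) ->
  (forall s, continuous al s) -> (forall s, continuous be s) -> open U ->
  conf_stable a b al be U -> Cp n U f -> Cp n U (conf_int a b phi al be f).
Proof.
intros Hab Hp Ha Hb HU HS Hf.
apply (Cn_RInt n a b (fun z => U (cmul (al (fst z)) (be (fst z)) (snd z))) U
  (fun z => phi (fst z) * f (cmul (al (fst z)) (be (fst z)) (snd z)))); auto.
- now apply open_cmul_preimage.
- now apply Cn_conf_integrand.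
Qed.

Lemma continuous_conf_integrand a b (phi al be : R -> R) (U : plane -> Prop) f s x :
  (forall s, continuous phi s) ->
  (forall s, continuous al s) -> (forall s, continuous be s) -> open U ->
  conf_stable a b al be U -> Cp 0 U f -> U x -> a <= s <= b ->
  continuous (fun s => phi s * f (cmul (al s) (be s) x)) s.
Proof.
intros Hp Ha Hb HU HS Hf Hx Hs.
apply (continuous_slice (fun z => phi (fst z) * f (cmul (al (fst z)) (be (fst z)) (snd z))) s x).
eapply Cn_continuous; [now apply (Cn_conf_integrand 0 phi al be U)|].
now apply HS.
Qed.

Lemma ex_RInt_conf_integrand a b (phi al be : R -> R) (U : plane -> Prop) f x : a <= b ->
  (forall s, continuous phi s) ->
  (forall s, continuous al s) -> (forall s, continuous be s) -> open U ->
  conf_stable a b al be U -> Cp 0 U f -> U x ->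
  ex_RInt (fun s => phi s * f (cmul (al s) (be s) x)) a b.
Proof.
intros Hab Hp Ha Hb HU HS Hf Hx.
apply (ex_RInt_continuous (V := R_CompleteNormedModule)).
rewrite Rmin_left, Rmax_right by lra; intros s Hs.
now apply (continuous_conf_integrand a b phi al be U).
Qed.

Lemma RInt_Rplus (f g : R -> R) a b : ex_RInt f a b -> ex_RInt g a b ->
  RInt (fun s => f s + g s) a b = RInt f a b + RInt g a b.
Proof. exact (RInt_plus (V := R_CompleteNormedModule) f g a b). Qed.

Lemma RInt_Rscal (f : R -> R) c a b : ex_RInt f a b ->
  RInt (fun s => c * f s) a b = c * RInt f a b.
Proof. exact (RInt_scal (V := R_CompleteNormedModule) f a b c). Qed.

Lemma ex_RInt_Rplus (f g : R -> R) a b : ex_RInt f a b -> ex_RInt g a b ->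
  ex_RInt (fun s => f s + g s) a b.
Proof. exact (ex_RInt_plus (V := R_CompleteNormedModule) f g a b). Qed.

Lemma ex_RInt_Rscal (f : R -> R) c a b : ex_RInt f a b -> ex_RInt (fun s => c * f s) a b.
Proof. exact (ex_RInt_scal (V := R_CompleteNormedModule) f a b c). Qed.

Lemma continuous_Rmult_all (f g : R -> R) :
  (forall s, continuous f s) -> (forall s, continuous g s) ->
  forall s, continuous (fun s => f s * g s) s.
Proof. intros Hf Hg s; apply (continuous_Rmult f g); auto. Qed.

(** The matrix of multiplication by al + i be has columns (al, be) and (- be, al). Absorbing al and
    be into the weight keeps the partials within the family [conf_int]. *)
Lemma pl_partials_conf_int a b (phi al be : R -> R) (U : plane -> Prop) f f1 f2 : a <= b ->
  (forall s, continuous phi s) ->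
  (forall s, continuous al s) -> (forall s, continuous be s) -> open U ->
  conf_stable a b al be U -> Cp 0 U f -> Cp 0 U f1 -> Cp 0 U f2 -> pl_partials U f f1 f2 ->
  pl_partials U (conf_int a b phi al be f)
    (fun x => conf_int a b (fun s => phi s * al s) al be f1 x +
              conf_int a b (fun s => phi s * be s) al be f2 x)
    (fun x => conf_int a b (fun s => phi s * al s) al be f2 x +
              -1 * conf_int a b (fun s => phi s * be s) al be f1 x).
Proof.
intros Hab Hp Ha Hb HU HS Hf Hf1 Hf2 HP.
assert (Hpa := continuous_Rmult_all _ _ Hp Ha); assert (Hpb := continuous_Rmult_all _ _ Hp Hb).
set (L := fun z : space => cmul (al (fst z)) (be (fst z)) (snd z)).
set (O := fun z : space => U (L z)).
set (F1 := fun z => phi (fst z) * al (fst z) * f1 (L z) + phi (fst z) * be (fst z) * f2 (L z)).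
set (F2 := fun z => phi (fst z) * al (fst z) * f2 (L z) + -1 * (phi (fst z) * be (fst z) * f1 (L z))).
assert (HF : Cn 0 O (fun z => phi (fst z) * f (L z))) by now apply Cn_conf_integrand.
assert (HC : forall g, Cp 0 U g -> Cn 0 O (fun z => phi (fst z) * al (fst z) * g (L z)) /\
  Cn 0 O (fun z => phi (fst z) * be (fst z) * g (L z))).
{ intros g Hg; split.
  - exact (Cn_conf_integrand 0 _ al be U g Hpa Ha Hb HU Hg).
  - exact (Cn_conf_integrand 0 _ al be U g Hpb Ha Hb HU Hg). }
assert (HF1 : Cn 0 O F1) by exact (Cn_plus _ _ _ _ (proj1 (HC f1 Hf1)) (proj2 (HC f2 Hf2))).
assert (HF2 : Cn 0 O F2)
  by exact (Cn_plus _ _ _ _ (proj1 (HC f2 Hf2))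
    (Cn_mult _ _ _ _ (Cn_const 0 O (-1)) (proj2 (HC f1 Hf1)))).
assert (HPF : partials O (fun z => phi (fst z) * f (L z)) F1 F2).
{ intros s u v Hz; unfold O, F1, F2, L, cmul in *; cbn [fst snd] in *.
  assert (HD := pl_partials_differentiable 0 U f f1 f2 _ _ HU HP Hf1 Hz).
  assert (Hlin : forall p q c : R, is_derive (fun t => p * t + c) q p).
  { intros; auto_derive; auto; ring. }
  assert (Hlin' : forall p q c : R, is_derive (fun t => c + p * t) q p).
  { intros; auto_derive; auto; ring. }
  assert (Hlin'' : forall p q c : R, is_derive (fun t => c - p * t) q (- p)).
  { intros; auto_derive; auto; ring. }
  split; (eapply is_derive_eq; [apply is_derive_scal|]).
  - exact (is_derive_comp_2d (fun a b => f (a, b)) (fun t => al s * t - be s * v)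
      (fun t => be s * t + al s * v) u _ _ _ _ HD (Hlin _ _ (- (be s * v))) (Hlin _ _ _)).
  - ring.
  - exact (is_derive_comp_2d (fun a b => f (a, b)) (fun t => al s * u - be s * t)
      (fun t => be s * u + al s * t) v _ _ _ _ HD (Hlin'' _ _ _) (Hlin' _ _ _)).
  - ring. }
assert (HQ := partials_RInt a b O U _ F1 F2 Hab (open_cmul_preimage al be U Ha Hb HU) HU HS
  (proj1 HF) (proj1 HF1) (proj1 HF2) HPF).
assert (HE : forall phi g x, (forall s, continuous phi s) -> Cp 0 U g -> U x ->
  ex_RInt (fun s => phi s * g (cmul (al s) (be s) x)) a b).
{ intros chi g x Hchi Hg Hx; now apply (ex_RInt_conf_integrand a b chi al be U). }
intros u v Hx; destruct (HQ 0 u v Hx) as [D1 D2]; split.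
- refine (is_derive_eq _ _ _ _ D1 _).
  assert (E1 := HE _ f1 (u, v) Hpa Hf1 Hx); assert (E2 := HE _ f2 (u, v) Hpb Hf2 Hx).
  exact (RInt_Rplus _ _ _ _ E1 E2).
- refine (is_derive_eq _ _ _ _ D2 _).
  assert (E1 := HE _ f2 (u, v) Hpa Hf2 Hx); assert (E2 := HE _ f1 (u, v) Hpb Hf1 Hx).
  assert (E3 := ex_RInt_Rscal _ (-1) _ _ E2).
  refine (eq_trans (RInt_Rplus _ _ _ _ E1 E3) _).
  exact (f_equal (Rplus _) (RInt_Rscal _ _ _ _ E2)).
Qed.

(* Fundamental theorem of calculus for [s |-> psi s * f ((al s + i be s) x)]. *)
Lemma conf_int_by_parts a b (psi al be psi' al' be' : R -> R) (U : plane -> Prop) f f1 f2 x :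
  a <= b -> open U -> conf_stable a b al be U ->
  (forall s, is_derive psi s (psi' s)) -> (forall s, is_derive al s (al' s)) ->
  (forall s, is_derive be s (be' s)) ->
  (forall s, continuous psi' s) -> (forall s, continuous al' s) -> (forall s, continuous be' s) ->
  Cp 0 U f -> Cp 0 U f1 -> Cp 0 U f2 -> pl_partials U f f1 f2 -> U x ->
  conf_int a b psi' al be f x +
  (fst x * (conf_int a b (fun s => psi s * al' s) al be f1 x +
            conf_int a b (fun s => psi s * be' s) al be f2 x) +
   snd x * (conf_int a b (fun s => psi s * al' s) al be f2 x +
            -1 * conf_int a b (fun s => psi s * be' s) al be f1 x)) =
  psi b * f (cmul (al b) (be b) x) - psi a * f (cmul (al a) (be a) x).
Proof.
intros Hab HU HS Dp Da Db Cp' Ca' Cb' Hf Hf1 Hf2 HP Hx.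
assert (HCd : forall (g g' : R -> R), (forall s, is_derive g s (g' s)) -> forall s, continuous g s).
{ intros g g' Hg s; apply (ex_derive_continuous (V := R_NormedModule)); eexists; apply Hg. }
assert (Cps := HCd _ _ Dp); assert (Ca := HCd _ _ Da); assert (Cb := HCd _ _ Db).
set (L := fun s => cmul (al s) (be s) x).
assert (Hpa := continuous_Rmult_all _ _ Cps Ca'); assert (Hpb := continuous_Rmult_all _ _ Cps Cb').
assert (HE : forall phi g, (forall s, continuous phi s) -> Cp 0 U g ->
  ex_RInt (fun s => phi s * g (L s)) a b).
{ intros phi g Hphi Hg; now apply (ex_RInt_conf_integrand a b phi al be U). }
assert (HC : forall phi g s, (forall s, continuous phi s) -> Cp 0 U g -> a <= s <= b ->
  continuous (fun s => phi s * g (L s)) s).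
{ intros phi g s Hphi Hg Hs; now apply (continuous_conf_integrand a b phi al be U). }
set (df := fun s => psi' s * f (L s) + (fst x * (psi s * al' s * f1 (L s) + psi s * be' s * f2 (L s)) +
  snd x * (psi s * al' s * f2 (L s) + -1 * (psi s * be' s * f1 (L s))))).
assert (HI : is_RInt df a b (psi b * f (L b) - psi a * f (L a))).
{ apply (is_RInt_derive (V := R_CompleteNormedModule) (fun s => psi s * f (L s)) df);
    rewrite Rmin_left, Rmax_right by lra; intros s Hs.
  - assert (HD := pl_partials_differentiable 0 U f f1 f2 (fst (L s)) (snd (L s)) HU HP Hf1 (HS s x Hs Hx)).
    assert (H1 : is_derive (fun s => fst (L s)) s (al' s * fst x - be' s * snd x)).
    { unfold L, cmul; cbn [fst snd].
      apply (is_derive_minus (V := R_NormedModule) (fun s => al s * fst x) (fun s => be s * snd x));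
        apply (is_derive_scal_l (V := R_NormedModule)); auto. }
    assert (H2 : is_derive (fun s => snd (L s)) s (be' s * fst x + al' s * snd x)).
    { unfold L, cmul; cbn [fst snd].
      apply (is_derive_Rplus (fun s => be s * fst x) (fun s => al s * snd x));
        apply (is_derive_scal_l (V := R_NormedModule)); auto. }
    assert (H3 := is_derive_comp_2d (fun a b => f (a, b)) (fun s => fst (L s)) (fun s => snd (L s))
      s _ _ _ _ HD H1 H2).
    refine (is_derive_eq _ _ _ _ (is_derive_Rmult psi (fun s => f (L s)) s _ _ (Dp s) H3) _).
    unfold df, L, cmul; cbn [fst snd]; ring.
  - assert (A0 := HC psi' f s Cp' Hf Hs).
    assert (A1 := HC _ f1 s Hpa Hf1 Hs); assert (A2 := HC _ f2 s Hpb Hf2 Hs).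
    assert (A3 := HC _ f2 s Hpa Hf2 Hs); assert (A4 := HC _ f1 s Hpb Hf1 Hs).
    assert (K : forall c : R, continuous (fun _ : R => c) s) by (intros; cont).
    exact (continuous_Rplus _ _ _ A0 (continuous_Rplus _ _ _
      (continuous_Rmult _ _ _ (K (fst x)) (continuous_Rplus _ _ _ A1 A2))
      (continuous_Rmult _ _ _ (K (snd x))
        (continuous_Rplus _ _ _ A3 (continuous_Rmult _ _ _ (K (-1)) A4))))). }
apply (is_RInt_unique (V := R_CompleteNormedModule)) in HI; fold (L a) (L b).
rewrite <- HI; unfold df, conf_int; fold L.
assert (E0 := HE psi' f Cp' Hf).
assert (E1 := HE _ f1 Hpa Hf1); assert (E2 := HE _ f2 Hpb Hf2).
assert (E3 := HE _ f2 Hpa Hf2); assert (E4 := HE _ f1 Hpb Hf1); cbv beta in *.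
assert (E5 := ex_RInt_Rscal _ (-1) _ _ E4).
assert (E6 := ex_RInt_Rplus _ _ _ _ E1 E2); assert (E7 := ex_RInt_Rplus _ _ _ _ E3 E5).
assert (E8 := ex_RInt_Rscal _ (fst x) _ _ E6); assert (E9 := ex_RInt_Rscal _ (snd x) _ _ E7).
assert (E10 := ex_RInt_Rplus _ _ _ _ E8 E9).
rewrite (RInt_Rplus _ _ _ _ E0 E10), (RInt_Rplus _ _ _ _ E8 E9),
  (RInt_Rscal _ _ _ _ E6), (RInt_Rscal _ _ _ _ E7), (RInt_Rplus _ _ _ _ E1 E2),
  (RInt_Rplus _ _ _ _ E3 E5), (RInt_Rscal _ _ _ _ E4); reflexivity.
Qed.

Lemma conf_int_ext a b (phi psi al be : R -> R) f x :
  (forall s, phi s = psi s) -> conf_int a b phi al be f x = conf_int a b psi al be f x.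
Proof. intros H; apply RInt_ext; intros; now rewrite H. Qed.

Lemma conf_int_0 a b (phi al be : R -> R) f x :
  (forall s, phi s = 0) -> conf_int a b phi al be f x = 0.
Proof.
intros H; unfold conf_int; rewrite (RInt_ext _ (fun _ => 0)).
- rewrite RInt_const; apply Rmult_0_r.
- intros s _; rewrite H; apply Rmult_0_l.
Qed.

Lemma conf_int_scal a b c (phi al be : R -> R) (U : plane -> Prop) f x : a <= b ->
  (forall s, continuous phi s) -> (forall s, continuous al s) -> (forall s, continuous be s) ->
  open U -> conf_stable a b al be U -> Cp 0 U f -> U x ->
  conf_int a b (fun s => c * phi s) al be f x = c * conf_int a b phi al be f x.
Proof.
intros Hab Hp Ha Hb HU HS Hf Hx; unfold conf_int.
rewrite (RInt_ext _ (fun s => c * (phi s * f (cmul (al s) (be s) x)))) by (intros; simpl; ring).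
exact (RInt_Rscal _ _ _ _ (ex_RInt_conf_integrand a b phi al be U f x Hab Hp Ha Hb HU HS Hf Hx)).
Qed.

(** * Dilations: Hadamard's lemma and the radial mean *)

Definition star_shaped (U : plane -> Prop) : Prop :=
  conf_stable 0 1 (fun s => s) (fun _ => 0) U.

Lemma cmul_1 x : cmul 1 0 x = x.
Proof. destruct x; unfold cmul; simpl; f_equal; ring. Qed.

Lemma cmul_0 x : cmul 0 0 x = (0, 0).
Proof. destruct x; unfold cmul; simpl; f_equal; ring. Qed.

(** Integrating d/ds f (s x) over [0, 1] exhibits A and B as means of the partials along the segment
    from the origin, hence one class below f. *)
Lemma hadamard n (U : plane -> Prop) f f1 f2 : open U -> star_shaped U ->
  Cp (S n) U f -> pl_partials U f f1 f2 ->
  exists A B, Cp n U A /\ Cp n U B /\ A (0, 0) = f1 (0, 0) /\ B (0, 0) = f2 (0, 0) /\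
    forall x, U x -> f x = f (0, 0) + fst x * A x + snd x * B x.
Proof.
intros HU HS Hf HP.
destruct (Cp_partials _ _ _ _ _ HU Hf HP) as [Hf1 Hf2].
assert (H01 : 0 <= 1) by lra.
assert (K : forall c : R, forall s : R, continuous (fun _ : R => c) s) by (intros; cont).
assert (I : forall s : R, continuous (fun s : R => s) s) by (intros; cont).
assert (C0 : forall g m, Cp m U g -> Cp 0 U g) by (intros g m; apply Cn_le; lia).
assert (HA0 : forall g, conf_int 0 1 (fun _ => 1) (fun s => s) (fun _ => 0) g (0, 0) = g (0, 0)).
{ intros g; unfold conf_int; rewrite (RInt_ext _ (fun _ => g (0, 0))).
  - rewrite RInt_const; unfold scal; simpl; unfold mult; simpl; ring.
  - intros s _; unfold cmul; simpl; rewrite Rmult_1_l; f_equal; f_equal; ring. }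
exists (conf_int 0 1 (fun _ => 1) (fun s => s) (fun _ => 0) f1),
  (conf_int 0 1 (fun _ => 1) (fun s => s) (fun _ => 0) f2).
repeat apply conj; auto.
- now apply Cp_conf_int.
- now apply Cp_conf_int.
- intros x Hx.
  (* The constant weight 1 leaves f x - f (0, 0) as boundary terms. *)
  assert (H := conf_int_by_parts 0 1 (fun _ => 1) (fun s => s) (fun _ => 0) (fun _ => 0)
    (fun _ => 1) (fun _ => 0) U f f1 f2 x H01 HU HS
    (fun s => is_derive_Rconst 1 s) is_derive_Rid (fun s => is_derive_Rconst 0 s)
    (K 0) (K 1) (K 0) (C0 _ _ Hf) (C0 _ _ Hf1) (C0 _ _ Hf2) HP Hx); cbv beta in H.
  rewrite cmul_1, cmul_0, (conf_int_0 _ _ (fun _ => 0)) in H by auto.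
  rewrite !(conf_int_0 _ _ (fun _ => 1 * 0)) in H by (intros; ring).
  rewrite !(conf_int_ext _ _ (fun _ => 1 * 1) (fun _ => 1)) in H by (intros; ring).
  lra.
Qed.

(** For a rotation-invariant function this is its average over the disc of radius |x|; it is the K
    of the construction. *)
Definition radial_mean : (plane -> R) -> plane -> R :=
  conf_int 0 1 (fun s => 2 * s) (fun s => s) (fun _ => 0).

Lemma Cp_radial_mean n (U : plane -> Prop) f : open U -> star_shaped U -> Cp n U f ->
  Cp n U (radial_mean f).
Proof. intros HU HS Hf; apply Cp_conf_int; auto; try lra; intros; cont. Qed.

Lemma radial_mean_euler n (U : plane -> Prop) f : open U -> star_shaped U -> Cp (S n) U f ->
  exists k1 k2, pl_partials U (radial_mean f) k1 k2 /\
    forall x, U x -> radial_mean f x + (fst x * k1 x + snd x * k2 x) / 2 = f x.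
Proof.
intros HU HS Hf.
destruct (Cp_S _ _ _ Hf) as [f1 [f2 [HP [Hf1 Hf2]]]].
assert (H01 : 0 <= 1) by lra.
assert (K : forall c : R, forall s : R, continuous (fun _ : R => c) s) by (intros; cont).
assert (I : forall s : R, continuous (fun s : R => s) s) by (intros; cont).
assert (I2 : forall s : R, continuous (fun s : R => 2 * s) s) by (intros; cont).
assert (II : forall s : R, continuous (fun s : R => s * s) s) by (intros; cont).
assert (C0 : forall g m, Cp m U g -> Cp 0 U g) by (intros g m; apply Cn_le; lia).
assert (DII : forall s : R, is_derive (fun s => s * s) s (2 * s)).
{ intros; auto_derive; auto; ring. }
apply C0 in Hf; apply C0 in Hf1; apply C0 in Hf2.
eexists; eexists; split.
- apply (pl_partials_conf_int 0 1 (fun s => 2 * s) (fun s => s) (fun _ => 0) U f f1 f2); auto.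
- intros x Hx; cbv beta.
  (* The weight s^2 has derivative 2 s, the weight of the radial mean, and vanishes at 0, so f x is
     the only boundary term. *)
  assert (H := conf_int_by_parts 0 1 (fun s => s * s) (fun s => s) (fun _ => 0) (fun s => 2 * s)
    (fun _ => 1) (fun _ => 0) U f f1 f2 x H01 HU HS
    DII is_derive_Rid (fun s => is_derive_Rconst 0 s)
    I2 (K 1) (K 0) Hf Hf1 Hf2 HP Hx); cbv beta in H.
  rewrite cmul_1, cmul_0 in H.
  rewrite !(conf_int_0 _ _ (fun s => s * s * 0)) in H by (intros; ring).
  rewrite !(conf_int_0 _ _ (fun s => 2 * s * 0)) by (intros; ring).
  rewrite !(conf_int_ext _ _ (fun s => s * s * 1) (fun s => s * s)) in H by (intros; ring).
  rewrite !(conf_int_ext _ _ (fun s => 2 * s * s) (fun s => 2 * (s * s))) by (intros; ring).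
  rewrite (conf_int_scal 0 1 2 (fun s => s * s) _ _ U f1), 
    (conf_int_scal 0 1 2 (fun s => s * s) _ _ U f2) by auto.
  unfold radial_mean; lra.
Qed.

(** * Rotations: angular derivative and invariance *)

Definition rotation_stable (U : plane -> Prop) : Prop :=
  forall t x, U x -> U (cmul (cos t) (sin t) x).

Definition rot_int (psi : R -> R) : (plane -> R) -> plane -> R :=
  conf_int 0 (2 * PI) psi cos sin.

Lemma Cp_rot_int n (psi : R -> R) (U : plane -> Prop) f : (forall s, continuous psi s) ->
  open U -> rotation_stable U -> Cp n U f -> Cp n U (rot_int psi f).
Proof.
assert (H := PI_RGT_0); intros Hp HU HS Hf.
assert (Hab : 0 <= 2 * PI) by lra.
exact (Cp_conf_int n 0 (2 * PI) psi cos sin U f Hab Hp continuous_cos continuous_sin HU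
  (fun s x _ => HS s x) Hf).
Qed.

(** Under the integral the angular derivative becomes d/dt of f (R_t x), and integration by parts
    follows; both boundary terms sit at x because a full turn is the identity. A constant weight
    gives invariance, a linear one solves the angular equation. *)
Lemma rot_int_angular n (psi psi' : R -> R) (U : plane -> Prop) f :
  (forall s, is_derive psi s (psi' s)) -> (forall s, continuous psi' s) ->
  open U -> rotation_stable U -> Cp (S n) U f ->
  exists g1 g2, pl_partials U (rot_int psi f) g1 g2 /\
    forall x, U x -> fst x * g2 x - snd x * g1 x =
      (psi (2 * PI) - psi 0) * f x - rot_int psi' f x.
Proof.
assert (HPI := PI_RGT_0); intros Dp Hp' HU HS Hf.
destruct (Cp_S _ _ _ Hf) as [f1 [f2 [HP [Hf1 Hf2]]]].
assert (H01 : 0 <= 2 * PI) by lra.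
assert (Hp : forall s, continuous psi s).
{ intros s; apply (ex_derive_continuous (V := R_NormedModule)); eexists; apply Dp. }
assert (Hsn : forall s, continuous (fun s => - sin s) s) by (intros; cont).
assert (C0 : forall g m, Cp m U g -> Cp 0 U g) by (intros g m; apply Cn_le; lia).
assert (HS' : conf_stable 0 (2 * PI) cos sin U) by (intros s x _; apply HS).
assert (Hps := continuous_Rmult_all _ _ Hp continuous_sin).
apply C0 in Hf; apply C0 in Hf1; apply C0 in Hf2.
eexists; eexists; split.
- exact (pl_partials_conf_int 0 (2 * PI) psi cos sin U f f1 f2 H01 Hp
    continuous_cos continuous_sin HU HS' Hf Hf1 Hf2 HP).
- intros x Hx; cbv beta.
  assert (H := conf_int_by_parts 0 (2 * PI) psi cos sin psi' (fun s => - sin s) cos U f f1 f2 x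
    H01 HU HS' Dp is_derive_cos is_derive_sin Hp' Hsn continuous_cos Hf Hf1 Hf2 HP Hx).
  rewrite cos_2PI, sin_2PI, cos_0, sin_0, cmul_1 in H.
  rewrite !(conf_int_ext _ _ (fun s => psi s * - sin s) (fun s => -1 * (psi s * sin s)))
    in H by (intros; ring).
  rewrite (conf_int_scal 0 (2 * PI) (-1) (fun s => psi s * sin s) _ _ U f1),
    (conf_int_scal 0 (2 * PI) (-1) (fun s => psi s * sin s) _ _ U f2) in H
    by auto using continuous_cos, continuous_sin.
  unfold rot_int; lra.
Qed.

(** The derivative of t |-> g (R_t x) is the angular derivative of g at R_t x. *)
Lemma rotation_invariant n (U : plane -> Prop) g g1 g2 : open U -> rotation_stable U ->
  pl_partials U g g1 g2 -> Cp n U g1 ->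
  (forall x, U x -> fst x * g2 x - snd x * g1 x = 0) ->
  forall t x, U x -> g (cmul (cos t) (sin t) x) = g x.
Proof.
intros HU HS HP Hg1 H0 t x Hx.
set (h := fun t => g (cmul (cos t) (sin t) x)).
assert (Dh : forall t, is_derive h t 0).
{ intros s; assert (Hs := HS s x Hx).
  assert (HD := pl_partials_differentiable n U g g1 g2 _ _ HU HP Hg1 Hs).
  assert (D1 : is_derive (fun s => cos s * fst x - sin s * snd x) s
    (- sin s * fst x - cos s * snd x)) by (auto_derive; auto; ring).
  assert (D2 : is_derive (fun s => sin s * fst x + cos s * snd x) s
    (cos s * fst x - sin s * snd x)) by (auto_derive; auto; ring).
  refine (is_derive_eq _ _ _ _ (is_derive_comp_2d (fun a b => g (a, b))
    (fun s => cos s * fst x - sin s * snd x) (fun s => sin s * fst x + cos s * snd x)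
    s _ _ _ _ HD D1 D2) _).
  rewrite <- (H0 _ Hs); unfold cmul; simpl; ring. }
assert (E : h t = h 0).
{ destruct (Rtotal_order t 0) as [Ht | [-> | Ht]]; auto.
  - apply (eq_is_derive (V := R_NormedModule) h t 0); auto.
  - symmetry; apply (eq_is_derive (V := R_NormedModule) h 0 t); auto. }
unfold h in E; rewrite E, cos_0, sin_0; now rewrite cmul_1.
Qed.

Lemma polar_form x : exists t, x = cmul (cos t) (sin t) (radius x, 0).
Proof.
destruct x as [u v]; unfold radius; simpl fst; simpl snd.
set (N := u ^ 2 + v ^ 2).
assert (HN : 0 <= N) by (unfold N; nra).
destruct (Req_dec N 0) as [E|E].
- exists 0; rewrite E, sqrt_0, cos_0, sin_0; unfold cmul; simpl.
  assert (u = 0) by (unfold N in E; nra); assert (v = 0) by (unfold N in E; nra).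
  subst; f_equal; ring.
- assert (HNp : 0 < N) by lra.
  assert (Hr := sqrt_lt_R0 _ HNp); assert (Hrr := sqrt_sqrt N HN); set (r := sqrt N) in *.
  assert (Hu : -1 <= u / r <= 1).
  { assert (Hur : Rabs u <= r).
    { apply Rsqr_incr_0_var; [|lra]; rewrite <- Rsqr_abs; unfold Rsqr, N in *; nra. }
    apply Rabs_le_between in Hur.
    split; apply (Rmult_le_reg_r r); auto; unfold Rdiv; rewrite Rmult_assoc, Rinv_l; lra. }
  assert (Hsin : r * sqrt (1 - (u / r)²) = Rabs v).
  { rewrite <- (sqrt_Rsqr_abs v), <- (sqrt_square r) at 1 by lra.
    rewrite <- sqrt_mult_alt by nra; f_equal; unfold Rsqr.
    replace (r * r * (1 - u / r * (u / r))) with (r * r - u * u) by (field; lra).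
    rewrite Hrr; unfold N; ring. }
  (* [acos] only reaches the upper half plane; below it the angle is negated. *)
  destruct (Rle_dec 0 v) as [Hv|Hv].
  + exists (acos (u / r)); rewrite cos_acos, sin_acos by auto; unfold cmul; simpl.
    rewrite Rabs_pos_eq in Hsin by auto; f_equal; [field; lra | lra].
  + exists (- acos (u / r)); rewrite cos_neg, sin_neg, cos_acos, sin_acos by auto; unfold cmul; simpl.
    rewrite Rabs_left in Hsin by lra; f_equal; [field; lra | lra].
Qed.

(** * Even functions *)

Definition strip (T : R) (x : plane) : Prop := - T < fst x < T.

Lemma open_strip T : open (strip T).
Proof.
apply open_and; [apply (open_gt_cont (fun x : R * R => fst x)) |
                 apply (open_lt_cont (fun x : R * R => fst x))]; intros; cont.
Qed.

(** Functions of one variable are regarded as constant in the second coordinate, so that the plane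
    calculus and the inverse function theorem serve for them too. *)
Definition C1d (n : nat) (T : R) (f : R -> R) : Prop := Cp n (strip T) (fun x => f (fst x)).

Lemma Cp_restrict_axis n (U : plane -> Prop) T f : open U -> Cp n U f ->
  (forall t, - T < t < T -> U (t, 0)) -> C1d n T (fun t => f (t, 0)).
Proof.
intros HU Hf HS; apply (Cp_comp n _ U f); auto.
- apply Cn_fst.
- apply Cn_const.
Qed.

Lemma C1d_S n T f : C1d (S n) T f ->
  exists f', (forall t, - T < t < T -> is_derive f t (f' t)) /\ C1d n T f'.
Proof.
intros Hf; destruct (Cp_S _ _ _ Hf) as [f1 [f2 [HP [H1 _]]]].
exists (fun t => f1 (t, 0)); split.
- intros t Ht; apply (HP t 0 Ht).
- apply (Cp_restrict_axis n (strip T)); auto; apply open_strip.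
Qed.

Lemma C1d_S_intro n T (f f' : R -> R) :
  (forall t, - T < t < T -> is_derive f t (f' t)) -> C1d n T f' -> C1d (S n) T f.
Proof.
intros Hd Hf'; apply (Cp_S_intro _ _ _ (fun x => f' (fst x)) (fun _ => 0)); auto.
- apply continuous_Cp0; intros x Hx; apply (continuous_comp (fun x : R * R => fst x) f); [cont|].
  apply (ex_derive_continuous (V := R_NormedModule)); eexists; apply Hd, Hx.
- intros u v Hx; exact (conj (Hd u Hx) (is_derive_Rconst (f u) v)).
- exact (Cn_const n _ 0).
Qed.

Lemma C1d_continuous n T f t : C1d n T f -> - T < t < T -> continuous f t.
Proof.
intros Hf Ht; apply (continuous_comp (fun t : R => (t, 0)) (fun x => f (fst x))); [cont|].
exact (Cp_continuous n (strip T) _ (t, 0) Hf Ht).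
Qed.

Lemma locally_interval (T t : R) : - T < t < T -> locally t (fun s : R => - T < s < T).
Proof.
apply (open_and (fun s : R => - T < s) (fun s : R => s < T)); [apply open_gt | apply open_lt].
Qed.

Lemma C1d_primitive n T f c : C1d n T f ->
  exists F, F 0 = c /\ C1d (S n) T F /\ forall t, - T < t < T -> is_derive F t (f t).
Proof.
intros Hf.
assert (HD : forall t, - T < t < T -> is_derive (fun t => c + RInt f 0 t) t (f t)).
{ intros t Ht; refine (is_derive_eq _ _ _ _ (is_derive_Rplus (fun _ => c) (fun t => RInt f 0 t)
    t _ _ (is_derive_Rconst c t) _) (Rplus_0_l _)).
  apply (is_derive_RInt (V := R_NormedModule) f (fun t => RInt f 0 t) 0 t).
  - apply (filter_imp (fun t : R => - T < t < T)).
    + intros s Hs; apply (RInt_correct (V := R_CompleteNormedModule)).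
      apply (ex_RInt_continuous (V := R_CompleteNormedModule)).
      intros z Hz; apply (C1d_continuous n T); auto.
      revert Hz; unfold Rmin, Rmax; destruct (Rle_dec 0 s); lra.
    + now apply locally_interval.
  - now apply (C1d_continuous n T). }
exists (fun t => c + RInt f 0 t); split; [|split; [|exact HD]].
- rewrite RInt_point; apply Rplus_0_r.
- exact (C1d_S_intro n T _ f HD Hf).
Qed.

Lemma null_derivative_interval (g : R -> R) T : (forall t, - T < t < T -> is_derive g t 0) ->
  forall t, - T < t < T -> g t = g 0.
Proof.
intros Hg t Ht; destruct (Rtotal_order t 0) as [H | [-> | H]]; auto.
- apply (eq_is_derive (V := R_NormedModule) g t 0); auto; intros s Hs; apply Hg; lra.
- symmetry; apply (eq_is_derive (V := R_NormedModule) g 0 t); auto; intros s Hs; apply Hg; lra.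
Qed.

(* An even function of [r] is a function of [r^2 / 2], with half as many derivatives: the
   derivative of [J] is the analogous function for the even function [f' r / r]. *)
Lemma even_function_of_square m T f : 0 < T -> C1d (2 * m) T f ->
  (forall t, - T < t < T -> f (- t) = f t) ->
  exists J, C1d m (T ^ 2 / 2) J /\ forall t, - T < t < T -> J (t ^ 2 / 2) = f t.
Proof.
intros HT; revert f; induction m as [|m IH]; intros f Hf He.
(* The argument is sqrt (2 t) for t >= 0 and 0 for t < 0: a continuous extension to the negative
   half of the interval. *)
- exists (fun t => f (sqrt (t + Rabs t))); split.
  + apply continuous_Cp0; intros x Hx.
    apply (continuous_comp (fun x : R * R => sqrt (fst x + Rabs (fst x))) f).
    * apply (continuous_comp (fun x : R * R => fst x + Rabs (fst x)) sqrt); [|apply continuous_sqrt].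
      apply (continuous_Rplus (fun x : R * R => fst x)); [cont|].
      apply (continuous_comp (fun x : R * R => fst x) Rabs); [cont | apply continuous_Rabs].
    * apply (C1d_continuous 0 T); auto; unfold strip in Hx.
      assert (H := sqrt_pos (fst x + Rabs (fst x))); split; [lra|].
      rewrite <- (sqrt_pow2 T) by lra; apply sqrt_lt_1_alt.
      unfold Rabs; destruct (Rcase_abs (fst x)); nra.
  + intros t Ht; rewrite Rabs_pos_eq by nra.
    replace (t ^ 2 / 2 + t ^ 2 / 2) with (t²) by (unfold Rsqr; field).
    rewrite sqrt_Rsqr_abs; unfold Rabs; destruct (Rcase_abs t); auto.
- replace (2 * S m)%nat with (S (S (2 * m))) in Hf by lia.
  destruct (C1d_S _ _ _ Hf) as [f' [Df Hf']], (C1d_S _ _ _ Hf') as [f'' [Df' Hf'']].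
  assert (Ho : forall t, - T < t < T -> f' (- t) = - f' t).
  { intros t Ht.
    assert (H1 : is_derive (fun t => f (- t)) t (-1 * f' (- t))).
    { apply (is_derive_Rcomp f (fun t => - t)); [apply Df; lra | auto_derive; auto]. }
    assert (H2 : is_derive (fun t => f (- t)) t (f' t)).
    { apply (is_derive_ext_loc f); [|now apply Df].
      apply (filter_imp (fun t : R => - T < t < T)); [intros; symmetry; auto|].
      now apply locally_interval. }
    apply is_derive_unique in H1; apply is_derive_unique in H2; lra. }
  assert (H0 : f' 0 = 0) by (specialize (Ho 0); rewrite Ropp_0 in Ho; lra).
  (* The derivative f' is odd, so it vanishes at 0 and Hadamard's lemma gives f' t = t A(t, 0) with
     A one class lower and even. *)
  destruct (hadamard (2 * m) (strip T) (fun x => f' (fst x)) (fun x => f'' (fst x)) (fun _ => 0))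
    as [A [B [HA [_ [_ [_ HAf]]]]]]; auto.
  { apply open_strip. }
  { intros s x Hs Hx; unfold strip, cmul in *; simpl; nra. }
  { intros u v Hx; exact (conj (Df' u Hx) (is_derive_Rconst (f' u) v)). }
  assert (HQ : forall t, - T < t < T -> f' t = t * A (t, 0)).
  { intros t Ht; rewrite (HAf (t, 0) Ht) at 1; simpl; rewrite H0.
    ring. }
  destruct (IH (fun t => A (t, 0))) as [K [HK HKf]].
  { apply (Cp_restrict_axis _ (strip T)); auto; apply open_strip. }
  { intros t Ht; destruct (Req_dec t 0) as [-> | Hn]; [now rewrite Ropp_0|].
    apply (Rmult_eq_reg_l t); auto; rewrite <- HQ by auto.
    assert (E := HQ (- t)); rewrite Ho in E by auto; lra. }
  (* By the chain rule J (t^2 / 2) has derivative t K (t^2 / 2) = f' t, and the constant is fixed by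
     the value at 0. *)
  destruct (C1d_primitive _ _ _ (f 0) HK) as [J [J0 [HJ DJ]]].
  exists J; split; auto; intros t Ht; apply Rminus_diag_uniq.
  rewrite (null_derivative_interval (fun t => J (t ^ 2 / 2) - f t) T); auto.
  + replace (0 ^ 2 / 2) with 0 by field; rewrite J0; ring.
  + intros s Hs.
    assert (Hs2 : - (T ^ 2 / 2) < s ^ 2 / 2 < T ^ 2 / 2) by nra.
    assert (Dsq : is_derive (fun s => s ^ 2 / 2) s s) by (auto_derive; auto; field).
    assert (D1 := is_derive_Rcomp J (fun s => s ^ 2 / 2) s _ _ (DJ _ Hs2) Dsq).
    refine (is_derive_eq _ _ _ _ (is_derive_minus (V := R_NormedModule) _ _ _ _ _ D1 (Df s Hs)) _).
    rewrite HKf, HQ by auto; apply Rminus_diag.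
Qed.

(** * Open discs about the origin *)

Lemma radius_sqr x : radius x ^ 2 = fst x ^ 2 + snd x ^ 2.
Proof. unfold radius; rewrite pow2_sqrt; [auto | nra]. Qed.

Lemma radius_pos x : 0 <= radius x.
Proof. apply sqrt_pos. Qed.

Lemma open_disc_iff r x : 0 < r -> open_disc r x <-> fst x ^ 2 + snd x ^ 2 < r ^ 2.
Proof.
intros Hr; rewrite <- radius_sqr; unfold open_disc; assert (H := radius_pos x); split; nra.
Qed.

Lemma open_open_disc r : open (open_disc r).
Proof.
apply (open_lt_cont radius r); intros x.
apply (continuous_comp (fun x : R * R => fst x ^ 2 + snd x ^ 2) sqrt); [|apply continuous_sqrt].
simpl; cont.
Qed.

Lemma star_shaped_open_disc r : 0 < r -> star_shaped (open_disc r).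
Proof.
intros Hr s x Hs Hx; apply open_disc_iff; auto; apply (open_disc_iff r x) in Hx; auto.
replace (fst (cmul s 0 x) ^ 2 + snd (cmul s 0 x) ^ 2)
  with (s * s * (fst x ^ 2 + snd x ^ 2)) by (unfold cmul; simpl; ring).
assert (H1 : s * s <= 1) by nra; assert (H2 := pow2_ge_0 (fst x)); assert (H3 := pow2_ge_0 (snd x)).
apply Rle_lt_trans with (2 := Hx); nra.
Qed.

Lemma rotation_stable_open_disc r : 0 < r -> rotation_stable (open_disc r).
Proof.
intros Hr t x Hx; apply open_disc_iff; auto; apply (open_disc_iff r x) in Hx; auto.
assert (H := sin2_cos2 t); unfold Rsqr in H.
unfold cmul; simpl in *.
replace ((cos t * fst x - sin t * snd x) * ((cos t * fst x - sin t * snd x) * 1) +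
  (sin t * fst x + cos t * snd x) * ((sin t * fst x + cos t * snd x) * 1))
  with ((sin t * sin t + cos t * cos t) * (fst x * fst x + snd x * snd x)) by ring.
rewrite H; lra.
Qed.

(** * Normalization of the area form *)

Lemma pl_partials_mult (U : plane -> Prop) f g f1 f2 g1 g2 :
  pl_partials U f f1 f2 -> pl_partials U g g1 g2 ->
  pl_partials U (fun x => f x * g x) (fun x => f1 x * g x + f x * g1 x)
    (fun x => f2 x * g x + f x * g2 x).
Proof.
intros HP HQ u v Hx; destruct (HP u v Hx) as [A B], (HQ u v Hx) as [C D].
exact (conj (is_derive_Rmult _ _ _ _ _ A C) (is_derive_Rmult _ _ _ _ _ B D)).
Qed.

Lemma pl_partials_inv (U : plane -> Prop) f f1 f2 : (forall x, U x -> f x <> 0) ->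
  pl_partials U f f1 f2 ->
  pl_partials U (fun x => / f x) (fun x => - f1 x / f x ^ 2) (fun x => - f2 x / f x ^ 2).
Proof.
intros H0 HP u v Hx; destruct (HP u v Hx) as [A B].
exact (conj (is_derive_inv (fun t => f (t, v)) u _ A (H0 _ Hx))
            (is_derive_inv (fun t => f (u, t)) v _ B (H0 _ Hx))).
Qed.

Lemma pl_partials_sqrt (U : plane -> Prop) f f1 f2 : (forall x, U x -> 0 < f x) ->
  pl_partials U f f1 f2 ->
  pl_partials U (fun x => sqrt (f x)) (fun x => f1 x / (2 * sqrt (f x)))
    (fun x => f2 x / (2 * sqrt (f x))).
Proof.
intros H0 HP u v Hx; destruct (HP u v Hx) as [A B].
exact (conj (is_derive_sqrt (fun t => f (t, v)) u _ A (H0 _ Hx))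
            (is_derive_sqrt (fun t => f (u, t)) v _ B (H0 _ Hx))).
Qed.

Lemma is_derive_scaled_rotation (g u X Y : R -> R) (t g' u' X' Y' : R) :
  is_derive g t g' -> is_derive u t u' -> is_derive X t X' -> is_derive Y t Y' ->
  is_derive (fun t => g t * (X t * cos (u t) - Y t * sin (u t))) t
    (g' * (X t * cos (u t) - Y t * sin (u t)) +
     g t * ((X' - Y t * u') * cos (u t) - (Y' + X t * u') * sin (u t))) /\
  is_derive (fun t => g t * (X t * sin (u t) + Y t * cos (u t))) t
    (g' * (X t * sin (u t) + Y t * cos (u t)) +
     g t * ((X' - Y t * u') * sin (u t) + (Y' + X t * u') * cos (u t))).
Proof.
intros Hg Hu HX HY.
assert (Hc := is_derive_Rcomp cos u t _ _ (is_derive_cos (u t)) Hu).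
assert (Hs := is_derive_Rcomp sin u t _ _ (is_derive_sin (u t)) Hu).
split.
- refine (is_derive_eq _ _ _ _ (is_derive_Rmult g _ t _ _ Hg
    (is_derive_minus (V := R_NormedModule) _ _ t _ _
      (is_derive_Rmult _ _ _ _ _ HX Hc) (is_derive_Rmult _ _ _ _ _ HY Hs))) _).
  unfold minus, plus, opp; simpl; ring.
- refine (is_derive_eq _ _ _ _ (is_derive_Rmult g _ t _ _ Hg
    (is_derive_Rplus _ _ t _ _
      (is_derive_Rmult _ _ _ _ _ HX Hs) (is_derive_Rmult _ _ _ _ _ HY Hc))) _).
  ring.
Qed.

(** In polar coordinates the map is (r, phi) |-> (g r, phi + u), of determinant g (g + r d_r g) (1 +
    d_phi u) for radial g. The Cartesian form of this identity also holds at the origin. *)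
Lemma pl_partials_scaled_rotation (U : plane -> Prop) g u g1 g2 u1 u2 :
  pl_partials U g g1 g2 -> pl_partials U u u1 u2 ->
  exists y11 y12 y21 y22,
    pl_partials U (fun x => g x * (fst x * cos (u x) - snd x * sin (u x))) y11 y12 /\
    pl_partials U (fun x => g x * (fst x * sin (u x) + snd x * cos (u x))) y21 y22 /\
    forall x, U x -> fst x * g2 x - snd x * g1 x = 0 ->
      y11 x * y22 x - y12 x * y21 x =
      (g x ^ 2 + g x * (fst x * g1 x + snd x * g2 x)) * (1 + (fst x * u2 x - snd x * u1 x)).
Proof.
intros HP HQ.
exists (fun x => g1 x * (fst x * cos (u x) - snd x * sin (u x)) +
  g x * ((1 - snd x * u1 x) * cos (u x) - (0 + fst x * u1 x) * sin (u x))).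
exists (fun x => g2 x * (fst x * cos (u x) - snd x * sin (u x)) +
  g x * ((0 - snd x * u2 x) * cos (u x) - (1 + fst x * u2 x) * sin (u x))).
exists (fun x => g1 x * (fst x * sin (u x) + snd x * cos (u x)) +
  g x * ((1 - snd x * u1 x) * sin (u x) + (0 + fst x * u1 x) * cos (u x))).
exists (fun x => g2 x * (fst x * sin (u x) + snd x * cos (u x)) +
  g x * ((0 - snd x * u2 x) * sin (u x) + (1 + fst x * u2 x) * cos (u x))).
assert (H : forall a b : R, U (a, b) -> _) by (intros a b Hx; exact (conj
  (is_derive_scaled_rotation (fun t => g (t, b)) (fun t => u (t, b)) (fun t => t) (fun _ => b) a
     _ _ _ _ (proj1 (HP a b Hx)) (proj1 (HQ a b Hx)) (is_derive_Rid a) (is_derive_Rconst b a))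
  (is_derive_scaled_rotation (fun t => g (a, t)) (fun t => u (a, t)) (fun _ => a) (fun t => t) b
     _ _ _ _ (proj2 (HP a b Hx)) (proj2 (HQ a b Hx)) (is_derive_Rconst a b) (is_derive_Rid b)))).
repeat apply conj.
- intros a b Hx; exact (conj (proj1 (proj1 (H a b Hx))) (proj1 (proj2 (H a b Hx)))).
- intros a b Hx; exact (conj (proj2 (proj1 (H a b Hx))) (proj2 (proj2 (H a b Hx)))).
- intros x _ Hang; assert (HT := sin2_cos2 (u x)); unfold Rsqr in HT.
  set (C := cos (u x)) in *; set (S := sin (u x)) in *; clearbody C S.
  set (D := fst x * u2 x - snd x * u1 x).
  transitivity ((S * S + C * C) * (g x ^ 2 + g x ^ 2 * D + g x * (fst x * g1 x + snd x * g2 x) +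
    g x * (fst x ^ 2 + snd x ^ 2) * (g1 x * u2 x - u1 x * g2 x))); [unfold D; ring|].
  rewrite HT.
  (* Uses |x|^2 (grad g ^ grad u) = (x . grad g) (x ^ grad u) - (x . grad u) (x ^ grad g), where x ^
     grad g is the vanishing angular derivative. *)
  transitivity ((g x ^ 2 + g x * (fst x * g1 x + snd x * g2 x)) * (1 + D) -
    g x * (fst x * u1 x + snd x * u2 x) * (fst x * g2 x - snd x * g1 x)); [unfold D; ring|].
  rewrite Hang; ring.
Qed.

Lemma angular_derivative_invariant n (U : plane -> Prop) g g1 g2 : open U ->
  pl_partials U g g1 g2 -> Cp n U g1 ->
  (forall t x, U x -> g (cmul (cos t) (sin t) x) = g x) ->
  forall x, U x -> fst x * g2 x - snd x * g1 x = 0.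
Proof.
intros HU HP Hg1 HI x Hx.
assert (Hx' : U (cos 0 * fst x - sin 0 * snd x, sin 0 * fst x + cos 0 * snd x)).
{ replace (_, _) with (cmul 1 0 x) by (now rewrite cos_0, sin_0); now rewrite cmul_1. }
assert (HD := pl_partials_differentiable n U g g1 g2 _ _ HU HP Hg1 Hx').
assert (D1 : is_derive (fun s => cos s * fst x - sin s * snd x) 0
  (- sin 0 * fst x - cos 0 * snd x)) by (auto_derive; auto; ring).
assert (D2 : is_derive (fun s => sin s * fst x + cos s * snd x) 0
  (cos 0 * fst x - sin 0 * snd x)) by (auto_derive; auto; ring).
assert (D := is_derive_comp_2d (fun a b => g (a, b))
  (fun s => cos s * fst x - sin s * snd x) (fun s => sin s * fst x + cos s * snd x)
  0 _ _ _ _ HD D1 D2).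
apply (is_derive_ext _ (fun _ => g x)) in D; [|intros t; exact (HI t x Hx)].
assert (E := is_derive_unique _ _ _ D); rewrite Derive_const in E.
rewrite E; rewrite cos_0, sin_0.
replace (1 * fst x - 0 * snd x, 0 * fst x + 1 * snd x) with x;
  [ring | destruct x; simpl; f_equal; ring].
Qed.

(** Rotations commute with dilations. *)
Lemma radial_mean_invariant (U : plane -> Prop) q : star_shaped U ->
  (forall t x, U x -> q (cmul (cos t) (sin t) x) = q x) ->
  forall t x, U x -> radial_mean q (cmul (cos t) (sin t) x) = radial_mean q x.
Proof.
intros HS HI t x Hx; apply RInt_ext; intros s Hs.
rewrite Rmin_left, Rmax_right in Hs by lra.
rewrite <- (HI t (cmul s 0 x)) by (apply HS; auto; lra).
f_equal; f_equal; unfold cmul; simpl; f_equal; ring.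
Qed.

Lemma conf_int_pos a b (phi al be : R -> R) (U : plane -> Prop) f x : a < b ->
  (forall s, continuous phi s) ->
  (forall s, continuous al s) -> (forall s, continuous be s) -> open U ->
  conf_stable a b al be U -> Cp 0 U f -> U x ->
  (forall s, a < s < b -> 0 < phi s) -> (forall x, U x -> 0 < f x) ->
  0 < conf_int a b phi al be f x.
Proof.
intros Hab Hp Ha Hb HU HS Hf Hx H1 H2; apply RInt_gt_0; auto.
- intros s Hs; apply Rmult_lt_0_compat; [now apply H1 | apply H2, HS; auto; lra].
- intros s Hs; exact (continuous_conf_integrand a b phi al be U f s x Hp Ha Hb HU HS Hf Hx Hs).
Qed.

(* [r^2 K / 2] is the antiderivative, as a function of [r], of [r q]. *)
Lemma radial_mean_profile m rho q : 0 < rho ->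
  (forall t x, open_disc rho x -> q (cmul (cos t) (sin t) x) = q x) ->
  Cp (S (2 * m)) (open_disc rho) q ->
  exists I J, C1d (S m) (rho ^ 2 / 2) I /\ I 0 = 0 /\ J 0 = q (0, 0) /\
    (forall t, - (rho ^ 2 / 2) < t < rho ^ 2 / 2 -> is_derive I t (J t)) /\
    forall x, open_disc rho x ->
      radial_mean q x * (fst x ^ 2 + snd x ^ 2) / 2 = I ((fst x ^ 2 + snd x ^ 2) / 2).
Proof.
intros Hrho HI Hq.
assert (HU := open_open_disc rho); assert (HS := star_shaped_open_disc rho Hrho).
assert (Hax : forall t, - rho < t < rho -> open_disc rho (t, 0)).
{ intros t Ht; apply open_disc_iff; auto; simpl; nra. }
assert (HP := Cp_restrict_axis _ _ rho q HU (Cn_pred _ _ _ Hq) Hax).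
destruct (even_function_of_square m rho (fun t => q (t, 0)) Hrho HP) as [J [HJ HJq]].
(* Rotation by a half turn makes the restriction of q to the axis even. *)
{ intros t Ht; rewrite <- (HI PI (t, 0)) by auto; rewrite cos_PI, sin_PI.
  f_equal; unfold cmul; simpl; f_equal; ring. }
destruct (C1d_primitive _ _ _ 0 HJ) as [I [I0 [HI1 DI]]].
destruct (radial_mean_euler _ _ _ HU HS Hq) as [k1 [k2 [HK HE]]].
exists I, J; split; [exact HI1|]; split; [exact I0|]; split; [|split; [exact DI|]].
{ transitivity (J (0 ^ 2 / 2)); [f_equal; field | apply (HJq 0); lra]. }
intros x Hx; destruct (polar_form x) as [t Et].
assert (Hr : 0 <= radius x < rho) by (split; [apply radius_pos | exact Hx]).
rewrite <- radius_sqr.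
replace (radial_mean q x) with (radial_mean q (radius x, 0)).
2: { rewrite Et at 2; symmetry; apply (radial_mean_invariant (open_disc rho)); auto; apply Hax; lra. }
symmetry; apply Rminus_diag_uniq.
(* By invariance only the positive half axis matters. There the derivative of h is r (q - K - r k1 /
   2), which vanishes by the Euler identity. *)
set (h := fun r => I (r ^ 2 / 2) - radial_mean q (r, 0) * (r ^ 2) / 2).
change (h (radius x) = 0); rewrite (null_derivative_interval h rho); [| |lra].
- unfold h; replace (0 ^ 2 / 2) with 0 by field; rewrite I0; field.
- intros r Hrr; assert (Hx' := Hax r Hrr).
  assert (Hs2 : - (rho ^ 2 / 2) < r ^ 2 / 2 < rho ^ 2 / 2) by nra.
  assert (Dsq : is_derive (fun s => s ^ 2 / 2) r r) by (auto_derive; auto; field).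
  assert (D1 := is_derive_Rcomp I (fun s => s ^ 2 / 2) r _ _ (DI _ Hs2) Dsq).
  assert (D2 := is_derive_Rmult (fun r => radial_mean q (r, 0)) (fun s => s ^ 2 / 2) r _ _
    (proj1 (HK r 0 Hx')) Dsq).
  assert (D3 := is_derive_minus (V := R_NormedModule) _ _ _ _ _ D1 D2).
  apply (is_derive_ext _ h) in D3.
  + refine (is_derive_eq _ _ _ _ D3 _).
    rewrite (HJq r Hrr); specialize (HE _ Hx'); simpl in HE.
    rewrite <- HE; unfold minus, plus, opp; simpl; field.
  + intros s; unfold h, minus, plus, opp; simpl; field.
Qed.

(** Positivity of p passes to its mean q and to the radial mean K, which makes sqrt K and w / q as
    smooth as p; it also gives J 0 = q (0, 0) > 0, so that I can be inverted near 0. *)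
Lemma area_normalization m n rho p : 0 < rho -> (2 * m <= n)%nat ->
  Cp (S n) (open_disc rho) p -> (forall x, open_disc rho x -> 0 < p x) ->
  exists Y1 Y2 y11 y12 y21 y22 I J,
    Cp (S n) (open_disc rho) Y1 /\ Cp (S n) (open_disc rho) Y2 /\
    pl_partials (open_disc rho) Y1 y11 y12 /\ pl_partials (open_disc rho) Y2 y21 y22 /\
    (forall x, open_disc rho x -> y11 x * y22 x - y12 x * y21 x = p x) /\
    Y1 (0, 0) = 0 /\ Y2 (0, 0) = 0 /\
    C1d (S m) (rho ^ 2 / 2) I /\ I 0 = 0 /\ 0 < J 0 /\
    (forall t, - (rho ^ 2 / 2) < t < rho ^ 2 / 2 -> is_derive I t (J t)) /\
    forall x, open_disc rho x -> (Y1 x ^ 2 + Y2 x ^ 2) / 2 = I ((fst x ^ 2 + snd x ^ 2) / 2).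
Proof.
intros Hrho Hmn Hp Hpos.
set (U := open_disc rho).
assert (HU : open U) by apply open_open_disc.
assert (HS : star_shaped U) by now apply star_shaped_open_disc.
assert (HRot : rotation_stable U) by now apply rotation_stable_open_disc.
assert (HPI := PI_RGT_0); set (c := / (2 * PI)).
assert (Hc : 0 < c) by (apply Rinv_0_lt_compat; lra).
assert (Kc : forall k s : R, continuous (fun _ : R => k) s) by (intros; cont).
assert (Ic : forall s : R, continuous (fun s : R => c * s) s) by (intros; cont).
assert (C0 : forall g k, Cp k U g -> Cp 0 U g) by (intros g k; apply Cn_le; lia).
set (q := rot_int (fun _ => c) p).
assert (Hq : Cp (S n) U q) by exact (Cp_rot_int (S n) _ U p (Kc c) HU HRot Hp).
destruct (rot_int_angular n (fun _ => c) (fun _ => 0) U p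
  (fun s => is_derive_Rconst c s) (Kc 0) HU HRot Hp) as [q1 [q2 [HPq Hangq]]].
assert (Hangq0 : forall x, U x -> fst x * q2 x - snd x * q1 x = 0).
{ intros x Hx; rewrite Hangq by auto; unfold rot_int; rewrite conf_int_0 by auto; ring. }
destruct (Cp_partials _ _ _ _ _ HU Hq HPq) as [Hq1 _].
assert (HIq := rotation_invariant n U q q1 q2 HU HRot HPq Hq1 Hangq0).
assert (H2PI : 0 < 2 * PI) by lra.
assert (Hqpos : forall x, U x -> 0 < q x).
{ intros x Hx; exact (conf_int_pos 0 (2 * PI) (fun _ => c) cos sin U p x H2PI (Kc c)
    continuous_cos continuous_sin HU (fun s x _ => HRot s x) (C0 _ _ Hp) Hx
    (fun _ _ => Hc) Hpos). }
set (w := rot_int (fun s => c * s) p).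
assert (Hw : Cp (S n) U w) by exact (Cp_rot_int (S n) _ U p Ic HU HRot Hp).
assert (Dcs : forall s : R, is_derive (fun s : R => c * s) s c) by (intros; auto_derive; auto; ring).
destruct (rot_int_angular n (fun s => c * s) (fun _ => c) U p Dcs (Kc c) HU HRot Hp)
  as [w1 [w2 [HPw Hangw]]].
(* The weight c s grows by 1 over a full turn, which produces p; its derivative c produces q. *)
assert (Hangw0 : forall x, U x -> fst x * w2 x - snd x * w1 x = p x - q x).
{ intros x Hx; rewrite Hangw by auto; fold q; unfold c; field; lra. }
set (K := radial_mean q).
assert (HK : Cp (S n) U K) by now apply Cp_radial_mean.
destruct (radial_mean_euler n U q HU HS Hq) as [k1 [k2 [HPK HE]]].
destruct (Cp_partials _ _ _ _ _ HU HK HPK) as [Hk1 _].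
assert (Hangk := angular_derivative_invariant n U K k1 k2 HU HPK Hk1
  (radial_mean_invariant U q HS HIq)).
assert (H01 : 0 < 1) by lra.
assert (I2 : forall s : R, continuous (fun s : R => 2 * s) s) by (intros; cont).
assert (Is : forall s : R, continuous (fun s : R => s) s) by (intros; cont).
assert (H2s : forall s, 0 < s < 1 -> 0 < 2 * s) by (intros; lra).
assert (HKpos : forall x, U x -> 0 < K x).
{ intros x Hx; exact (conf_int_pos 0 1 (fun s => 2 * s) (fun s => s) (fun _ => 0) U q x H01
    I2 Is (Kc 0) HU HS (C0 _ _ Hq) Hx H2s Hqpos). }
assert (Hqn0 : forall x, U x -> q x <> 0) by (intros x Hx; specialize (Hqpos x Hx); lra).
assert (HPg := pl_partials_sqrt U K k1 k2 HKpos HPK).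
assert (HPu := pl_partials_mult U w _ _ _ _ _ HPw (pl_partials_inv U q q1 q2 Hqn0 HPq)).
destruct (pl_partials_scaled_rotation U _ _ _ _ _ _ HPg HPu)
  as [y11 [y12 [y21 [y22 [HY1 [HY2 Hdet]]]]]].
assert (Hg : Cp (S n) U (fun x => sqrt (K x))) by (apply Cn_sqrt; auto; intros z; apply HKpos).
assert (Hu : Cp (S n) U (fun x => w x * / q x)).
{ apply (Cn_mult (S n) _ (fun z => w (snd z)) (fun z => / q (snd z))); auto.
  apply (Cn_inv (S n) _ (fun z => q (snd z))); auto; intros z; apply Hqn0. }
destruct (Cn_sin_cos _ _ _ Hu) as [Hsu Hcu].
assert (Hq' : Cp (S (2 * m)) U q) by (apply (Cn_le (S (2 * m)) (S n)); auto; lia).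
destruct (radial_mean_profile m rho q Hrho HIq Hq') as [I [J [HI [I0 [J0 [DI HIK]]]]]].
exists (fun x => sqrt (K x) * (fst x * cos (w x * / q x) - snd x * sin (w x * / q x))).
exists (fun x => sqrt (K x) * (fst x * sin (w x * / q x) + snd x * cos (w x * / q x))).
exists y11, y12, y21, y22, I, J.
assert (H1 := Cn_fst (S n) (fun z => U (snd z))); assert (H2 := Cn_snd (S n) (fun z => U (snd z))).
split; [|split; [|split; [exact HY1|split; [exact HY2|split; [|split; [|split; [|
  split; [exact HI|split; [exact I0|split; [|split; [exact DI|]]]]]]]]]]].
- exact (Cn_mult _ _ _ _ Hg (Cn_minus _ _ _ _ (Cn_mult _ _ _ _ H1 Hcu) (Cn_mult _ _ _ _ H2 Hsu))).
- exact (Cn_mult _ _ _ _ Hg (Cn_plus _ _ _ _ (Cn_mult _ _ _ _ H1 Hsu) (Cn_mult _ _ _ _ H2 Hcu))).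
- intros x Hx; assert (HKx := HKpos x Hx); assert (Hsq := sqrt_lt_R0 _ HKx).
  assert (Hss := pow2_sqrt (K x) (Rlt_le _ _ HKx)).
  assert (Hqx := Hqn0 x Hx).
  rewrite (Hdet x Hx), Hss.
  (* For g = sqrt K, g^2 + g (x . grad g) = K + (x . grad K) / 2 = q. The other factor is 1 + d_phi
     (w / q) by the quotient rule, and equals p / q. *)
  + transitivity (q x * (1 + ((fst x * w2 x - snd x * w1 x) / q x -
      w x * (fst x * q2 x - snd x * q1 x) / q x ^ 2))).
    * f_equal; [rewrite <- (HE x Hx); fold K; field; lra | field; auto].
    * rewrite (Hangw0 x Hx), (Hangq0 x Hx); field; auto.
  + transitivity ((fst x * k2 x - snd x * k1 x) / (2 * sqrt (K x))); [field; lra|].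
    rewrite (Hangk x Hx); field; lra.
- simpl; ring.
- simpl; ring.
- rewrite J0; apply Hqpos, open_disc_iff; auto; simpl; nra.
- intros x Hx; rewrite <- (HIK x Hx); fold K.
  assert (HKx := HKpos x Hx); assert (Hss := pow2_sqrt (K x) (Rlt_le _ _ HKx)).
  assert (HT := sin2_cos2 (w x * / q x)); unfold Rsqr in HT.
  set (C := cos (w x * / q x)) in *; set (S := sin (w x * / q x)) in *; clearbody C S.
  transitivity (sqrt (K x) ^ 2 * (S * S + C * C) * (fst x ^ 2 + snd x ^ 2) / 2); [field|].
  rewrite Hss, HT; field.
Qed.

(** * Morse chart *)

(** The product rule does not apply to a merely continuous phi, but the difference quotient at 0 is
    phi itself. *)
Lemma is_derive_id_mult_0 (phi : R -> R) :
  continuous phi 0 -> is_derive (fun t => t * phi t) 0 (phi 0).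
Proof.
intros Hc; apply is_derive_Reals; intros eps Heps.
destruct (proj1 (filterlim_locally (U := R_UniformSpace) phi (phi 0)) Hc (mkposreal _ Heps))
  as [d Hd].
exists d; intros h Hh Hhd.
replace ((((0 + h) * phi (0 + h) - 0 * phi 0) / h - phi 0)) with (phi h - phi 0)
  by (rewrite Rplus_0_l; field; auto).
apply Hd; change (Rabs (h - 0) < d); now rewrite Rminus_0_r.
Qed.

(** Hadamard's lemma is applied to H and again to both coefficients, which vanish at the origin
    because dH does; each application costs one derivative. *)
Lemma hadamard_2 n (U : plane -> Prop) H : open U -> star_shaped U -> U (0, 0) ->
  Cp (S (S n)) U H -> H (0, 0) = 0 -> (forall v, diff1 H (0, 0) v = 0) ->
  exists a b c, Cp n U a /\ Cp n U b /\ Cp n U c /\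
    forall x, U x -> 2 * H x = a x * fst x ^ 2 + 2 * b x * fst x * snd x + c x * snd x ^ 2.
Proof.
intros HU HS HU0 HH H0 HD.
destruct (Cp_S _ _ _ HH) as [H1 [H2 [HP [HH1 HH2]]]].
destruct (hadamard _ U H H1 H2 HU HS HH HP) as [A [B [HA [HB [A0 [B0 HAB]]]]]].
destruct (pl_partials_Derive U H H1 H2 (0, 0) HP HU0) as [E1 E2]; simpl in E1, E2.
assert (HA0 : A (0, 0) = 0).
{ rewrite A0; specialize (HD (1, 0)); unfold diff1, pd, partial_derive, curry2 in HD; simpl in HD.
  rewrite E1 in HD; lra. }
assert (HB0 : B (0, 0) = 0).
{ rewrite B0; specialize (HD (0, 1)); unfold diff1, pd, partial_derive, curry2 in HD; simpl in HD.
  rewrite E2 in HD; lra. }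
destruct (Cp_S _ _ _ HA) as [A1 [A2 [HPA _]]], (Cp_S _ _ _ HB) as [B1 [B2 [HPB _]]].
destruct (hadamard _ U A A1 A2 HU HS HA HPA) as [a [b1 [Ha [Hb1 [_ [_ EA]]]]]].
destruct (hadamard _ U B B1 B2 HU HS HB HPB) as [b2 [c [Hb2 [Hc [_ [_ EB]]]]]].
(* The two mixed terms are merged into a single b; the zero summands only match the form of
   [Cp_lin]. *)
exists (fun x => 2 * a x + 0 * a x), (fun x => 1 * b1 x + 1 * b2 x), (fun x => 2 * c x + 0 * c x).
split; [now apply Cp_lin|split; [now apply Cp_lin|split; [now apply Cp_lin|]]].
intros x Hx; rewrite (HAB x Hx), (EA x Hx), (EB x Hx), H0, HA0, HB0; ring.
Qed.

(** With coefficients of class C^1, H is differentiated formally only once. On an axis the first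
    derivative is t times a continuous function, whose derivative at 0 is read off directly. *)
Lemma diff2_of_quadratic_form (U : plane -> Prop) H a b c : open U -> U (0, 0) ->
  Cp 1 U a -> Cp 1 U b -> Cp 1 U c ->
  (forall x, U x -> 2 * H x = a x * fst x ^ 2 + 2 * b x * fst x * snd x + c x * snd x ^ 2) ->
  forall v, diff2 H (0, 0) v =
    a (0, 0) * fst v ^ 2 + 2 * b (0, 0) * fst v * snd v + c (0, 0) * snd v ^ 2.
Proof.
intros HU HU0 Ha Hb Hc HE.
destruct (Cp_S _ _ _ Ha) as [a1 [a2 [Pa [Ca1 Ca2]]]], (Cp_S _ _ _ Hb) as [b1 [b2 [Pb _]]],
  (Cp_S _ _ _ Hc) as [c1 [c2 [Pc [Cc1 Cc2]]]].
assert (HU1 : locally 0 (fun t : R => U (t, 0))).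
{ apply (open_preimage (fun t : R => (t, 0)) U); auto; intros; cont. }
assert (HU2 : locally 0 (fun t : R => U (0, t))).
{ apply (open_preimage (fun t : R => (0, t)) U); auto; intros; cont. }
assert (C1 : forall f, Cp 0 U f -> continuous (fun t : R => f (t, 0)) 0).
{ intros f Hf; apply (continuous_comp (fun t : R => (t, 0)) f); [cont|].
  exact (Cp_continuous 0 U f (0, 0) Hf HU0). }
assert (C2 : forall f, Cp 0 U f -> continuous (fun t : R => f (0, t)) 0).
{ intros f Hf; apply (continuous_comp (fun t : R => (0, t)) f); [cont|].
  exact (Cp_continuous 0 U f (0, 0) Hf HU0). }
apply (Cn_le 0 1) in Ha as Ca; [|lia]; apply (Cn_le 0 1) in Hb as Cb; [|lia].
apply (Cn_le 0 1) in Hc as Cc; [|lia].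
assert (quad : forall (A B C : R -> R) (t z A' B' C' : R),
  is_derive A t A' -> is_derive B t B' -> is_derive C t C' ->
  is_derive (fun s => / 2 * (A s * s ^ 2 + 2 * B s * s * z + C s * z ^ 2)) t
   (/ 2 * (A' * t ^ 2 + A t * (2 * t) + 2 * (B' * t + B t) * z + C' * z ^ 2))).
{ intros A B C t z A' B' C' DA DB DC; auto_derive; [repeat split; eexists; eassumption|].
  replace (Derive (fun x => A x) t) with A' by (symmetry; now apply is_derive_unique).
  replace (Derive (fun x => B x) t) with B' by (symmetry; now apply is_derive_unique).
  replace (Derive (fun x => C x) t) with C' by (symmetry; now apply is_derive_unique); ring. }
assert (quad' : forall (A B C : R -> R) (t z A' B' C' : R),
  is_derive A z A' -> is_derive B z B' -> is_derive C z C' ->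
  is_derive (fun s => / 2 * (A s * t ^ 2 + 2 * B s * t * s + C s * s ^ 2)) z
   (/ 2 * (A' * t ^ 2 + 2 * t * (B' * z + B z) + C' * z ^ 2 + C z * (2 * z)))).
{ intros A B C t z A' B' C' DA DB DC; auto_derive; [repeat split; eexists; eassumption|].
  replace (Derive (fun x => A x) z) with A' by (symmetry; now apply is_derive_unique).
  replace (Derive (fun x => B x) z) with B' by (symmetry; now apply is_derive_unique).
  replace (Derive (fun x => C x) z) with C' by (symmetry; now apply is_derive_unique); ring. }
assert (HD : forall t z, U (t, z) -> is_derive (fun t => H (t, z)) t
   (/ 2 * (a1 (t, z) * t ^ 2 + a (t, z) * (2 * t) + 2 * (b1 (t, z) * t + b (t, z)) * z +
     c1 (t, z) * z ^ 2)) /\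
   is_derive (fun z => H (t, z)) z
   (/ 2 * (a2 (t, z) * t ^ 2 + 2 * t * (b2 (t, z) * z + b (t, z)) +
     c2 (t, z) * z ^ 2 + c (t, z) * (2 * z)))).
{ intros t z Hx.
  assert (L1 : locally t (fun s : R => U (s, z))).
  { apply (open_preimage (fun s : R => (s, z)) U); auto; intros; cont. }
  assert (L2 : locally z (fun s : R => U (t, s))).
  { apply (open_preimage (fun s : R => (t, s)) U); auto; intros; cont. }
  assert (Hh : forall x, U x -> / 2 * (a x * fst x ^ 2 + 2 * b x * fst x * snd x + c x * snd x ^ 2) = H x).
  { intros x Hx'; rewrite <- HE by auto; field. }
  destruct (Pa t z Hx) as [Da1 Da2], (Pb t z Hx) as [Db1 Db2], (Pc t z Hx) as [Dc1 Dc2].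
  split.
  - apply (is_derive_ext_loc (fun s => / 2 * (a (s, z) * s ^ 2 + 2 * b (s, z) * s * z + c (s, z) * z ^ 2))).
    + revert L1; apply filter_imp; intros s Hs; exact (Hh (s, z) Hs).
    + exact (quad (fun s => a (s, z)) (fun s => b (s, z)) (fun s => c (s, z)) t z _ _ _ Da1 Db1 Dc1).
  - apply (is_derive_ext_loc (fun s => / 2 * (a (t, s) * t ^ 2 + 2 * b (t, s) * t * s + c (t, s) * s ^ 2))).
    + revert L2; apply filter_imp; intros s Hs; exact (Hh (t, s) Hs).
    + exact (quad' (fun s => a (t, s)) (fun s => b (t, s)) (fun s => c (t, s)) t z _ _ _ Da2 Db2 Dc2). }
assert (E20 : pd 2 0 H (0, 0) = a (0, 0)).
{ unfold pd, partial_derive, curry2; simpl.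
  rewrite (Derive_ext_loc _ (fun t : R => t * (/ 2 * a1 (t, 0) * t + a (t, 0)))).
  - apply is_derive_unique.
    refine (is_derive_eq _ _ _ _ (is_derive_id_mult_0 (fun t => / 2 * a1 (t, 0) * t + a (t, 0)) _) _).
    + assert (X1 := C1 _ Ca1); assert (X2 := C1 _ Ca); cont.
    + ring.
  - revert HU1; apply filter_imp; intros t Ht; destruct (HD t 0 Ht) as [D _].
    refine (eq_trans (is_derive_unique _ _ _ D) _); field. }
assert (E11 : pd 1 1 H (0, 0) = b (0, 0)).
{ unfold pd, partial_derive, curry2; simpl.
  rewrite (Derive_ext_loc _ (fun t : R => t * (/ 2 * a2 (t, 0) * t + b (t, 0)))).
  - apply is_derive_unique.
    refine (is_derive_eq _ _ _ _ (is_derive_id_mult_0 (fun t => / 2 * a2 (t, 0) * t + b (t, 0)) _) _).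
    + assert (X1 := C1 _ Ca2); assert (X2 := C1 _ Cb); cont.
    + ring.
  - revert HU1; apply filter_imp; intros t Ht; destruct (HD t 0 Ht) as [_ D].
    refine (eq_trans (is_derive_unique _ _ _ D) _); field. }
assert (E02 : pd 0 2 H (0, 0) = c (0, 0)).
{ unfold pd, partial_derive, curry2; simpl.
  rewrite (Derive_ext_loc _ (fun t : R => t * (/ 2 * c2 (0, t) * t + c (0, t)))).
  - apply is_derive_unique.
    refine (is_derive_eq _ _ _ _ (is_derive_id_mult_0 (fun t => / 2 * c2 (0, t) * t + c (0, t)) _) _).
    + assert (X1 := C2 _ Cc2); assert (X2 := C2 _ Cc); cont.
    + ring.
  - revert HU2; apply filter_imp; intros t Ht; destruct (HD 0 t Ht) as [_ D].
    refine (eq_trans (is_derive_unique _ _ _ D) _); field. }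
intros v; unfold diff2; rewrite E20, E11, E02; ring.
Qed.

Lemma pl_partials_fst U : pl_partials U fst (fun _ => 1) (fun _ => 0).
Proof. intros u v _; exact (conj (is_derive_Rid u) (is_derive_Rconst u v)). Qed.

Lemma pl_partials_snd U : pl_partials U snd (fun _ => 0) (fun _ => 1).
Proof. intros u v _; exact (conj (is_derive_Rconst v u) (is_derive_Rid v)). Qed.

(* The square root of the Hessian is taken by completing the square. *)
Lemma morse_chart n rho H : 0 < rho -> Cp (S (S (S n))) (open_disc rho) H ->
  H (0, 0) = 0 -> (forall v, diff1 H (0, 0) v = 0) ->
  (forall v, v <> (0, 0) -> 0 < diff2 H (0, 0) v) ->
  exists d M1 M2 m11 m12 m21 m22, 0 < d /\ (forall x, sq d x -> open_disc rho x) /\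
    Cp (S n) (sq d) M1 /\ Cp (S n) (sq d) M2 /\
    pl_partials (sq d) M1 m11 m12 /\ pl_partials (sq d) M2 m21 m22 /\
    M1 (0, 0) = 0 /\ M2 (0, 0) = 0 /\
    0 < m11 (0, 0) * m22 (0, 0) - m12 (0, 0) * m21 (0, 0) /\
    forall x, sq d x -> H x = (M1 x ^ 2 + M2 x ^ 2) / 2.
Proof.
intros Hrho HH H0 HD1 HD2.
assert (HU := open_open_disc rho); assert (HS := star_shaped_open_disc rho Hrho).
assert (HU0 : open_disc rho (0, 0)) by (apply open_disc_iff; auto; simpl; nra).
destruct (hadamard_2 (S n) _ H HU HS HU0 HH H0 HD1) as [a [b [c [Ha [Hb [Hc HE]]]]]].
assert (Hq := diff2_of_quadratic_form _ H a b c HU HU0 (Cn_le 1 (S n) _ _ ltac:(lia) Ha)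
  (Cn_le 1 (S n) _ _ ltac:(lia) Hb) (Cn_le 1 (S n) _ _ ltac:(lia) Hc) HE).
assert (Ha0 : 0 < a (0, 0)).
{ assert (H1 : (1, 0) <> (0, 0)) by (intros E; injection E; lra).
  specialize (HD2 _ H1); rewrite Hq in HD2; simpl in HD2; lra. }
(* D is the determinant of the form; its sign is tested on the vector (- b, a), where the form takes
   the value a D. *)
set (D := fun x => a x * c x - b x * b x).
assert (HD0 : 0 < D (0, 0)).
{ assert (H1 : (- b (0, 0), a (0, 0)) <> (0, 0)) by (intros E; injection E; lra).
  specialize (HD2 _ H1); rewrite Hq in HD2; cbn [fst snd] in HD2.
  apply (Rmult_lt_reg_l (a (0, 0))); auto; unfold D; rewrite Rmult_0_r.
  eapply Rlt_le_trans; [exact HD2 | apply Req_le; ring]. }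
assert (HDC : Cp (S n) (open_disc rho) D) by (apply Cn_minus; apply Cn_mult; auto).
assert (HL : locally (0, 0) (fun x : R * R => open_disc rho x /\ 0 < a x /\ 0 < D x)).
{ assert (HP : forall f, Cp (S n) (open_disc rho) f -> 0 < f (0, 0) ->
    locally (0, 0) (fun x : R * R => 0 < f x)).
  { intros f Hf Hf0; apply (Cp_continuous _ _ _ _ Hf HU0 (fun t => 0 < t)).
    apply (open_gt 0); exact Hf0. }
  exact (filter_and _ _ (HU _ HU0) (filter_and _ _ (HP a Ha Ha0) (HP D HDC HD0))). }
destruct (locally_sq _ HL) as [d [Hd HV]].
assert (HVU : forall x, sq d x -> open_disc rho x) by (intros x Hx; apply HV, Hx).
assert (HVa : forall x, sq d x -> 0 < a x) by (intros x Hx; apply HV, Hx).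
assert (HVD : forall x, sq d x -> 0 < D x) by (intros x Hx; apply HV, Hx).
apply (Cp_subset _ _ (sq d)) in Ha; auto; apply (Cp_subset _ _ (sq d)) in Hb; auto.
apply (Cp_subset _ _ (sq d)) in HDC; auto.
(* From a u^2 + 2 b u v + c v^2 = (al u + be v)^2 + (ga v)^2 with al = sqrt a, be = b / al and ga =
   sqrt D / al. *)
set (al := fun x => sqrt (a x)).
assert (Hal : Cp (S n) (sq d) al) by (apply Cn_sqrt; auto; intros z; apply HVa).
assert (Halp : forall x, sq d x -> 0 < al x) by (intros x Hx; apply sqrt_lt_R0; auto).
assert (Hial : Cp (S n) (sq d) (fun x => / al x)).
{ apply (Cn_inv (S n) _ (fun z => al (snd z))); auto; intros z Hz.
  specialize (Halp _ Hz); lra. }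
set (be := fun x => b x * / al x).
assert (Hbe : Cp (S n) (sq d) be) by exact (Cn_mult _ _ _ _ Hb Hial).
set (ga := fun x => sqrt (D x) * / al x).
assert (HsD : Cp (S n) (sq d) (fun x => sqrt (D x))) by (apply Cn_sqrt; auto; intros z; apply HVD).
assert (Hga : Cp (S n) (sq d) ga) by exact (Cn_mult _ _ _ _ HsD Hial).
destruct (Cp_S _ _ _ Hal) as [al1 [al2 [Pal _]]], (Cp_S _ _ _ Hbe) as [be1 [be2 [Pbe _]]],
  (Cp_S _ _ _ Hga) as [ga1 [ga2 [Pga _]]].
assert (P1 := pl_partials_fst (sq d)); assert (P2 := pl_partials_snd (sq d)).
assert (Q1 := pl_partials_lin _ _ _ _ _ _ _ 1 1 (pl_partials_mult _ _ _ _ _ _ _ Pal P1)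
  (pl_partials_mult _ _ _ _ _ _ _ Pbe P2)).
assert (Q2 := pl_partials_mult _ _ _ _ _ _ _ Pga P2).
assert (F1 := Cn_fst (S n) (fun z => sq d (snd z))); assert (F2 := Cn_snd (S n) (fun z => sq d (snd z))).
assert (S0 := sq_origin d Hd).
eexists d, _, _, _, _, _, _; split; [exact Hd|]; split; [exact HVU|].
split; [|split; [|split; [exact Q1|split; [exact Q2|split; [|split; [|split]]]]]].
- apply (Cp_lin (S n) (sq d) (fun x => al x * fst x) (fun x => be x * snd x)).
  + exact (Cn_mult _ _ _ _ Hal F1).
  + exact (Cn_mult _ _ _ _ Hbe F2).
- exact (Cn_mult _ _ _ _ Hga F2).
- simpl; ring.
- simpl; ring.
(* At the origin the derivatives of al, be, ga are multiplied by zero coordinates, leaving the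
   triangular determinant al ga. *)
- simpl fst; simpl snd.
  assert (Hg0 : 0 < ga (0, 0)).
  { apply Rmult_lt_0_compat; [apply sqrt_lt_R0; auto | apply Rinv_0_lt_compat; auto]. }
  specialize (Halp _ S0); match goal with |- 0 < ?e => replace e with (al (0, 0) * ga (0, 0)) by ring end.
  now apply Rmult_lt_0_compat.
- intros x Hx.
  assert (Hax := HVa x Hx); assert (HDx := HVD x Hx); assert (Hx' := Halp x Hx).
  assert (A2 : al x ^ 2 = a x) by (apply pow2_sqrt; lra).
  assert (D2 : sqrt (D x) ^ 2 = D x) by (apply pow2_sqrt; lra).
  apply (Rmult_eq_reg_l 2); [|lra]; rewrite (HE x (HVU x Hx)).
  transitivity ((al x ^ 2 * fst x ^ 2 + 2 * b x * fst x * snd x +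
    (b x ^ 2 + sqrt (D x) ^ 2) / al x ^ 2 * snd x ^ 2)).
  + rewrite D2, A2; unfold D; field; lra.
  + unfold be, ga; field; lra.
Qed.

(** * Jacobians of composites; regularity and inversion in one variable *)

Lemma pl_partials_ext (U : plane -> Prop) f g f1 f2 : open U ->
  (forall x, U x -> f x = g x) -> pl_partials U f f1 f2 -> pl_partials U g f1 f2.
Proof.
intros HU HE HP u v Hx; destruct (HP u v Hx) as [A B]; split.
- apply (is_derive_ext_loc (fun t => f (t, v))); [|exact A].
  apply (filter_imp (fun t : R => U (t, v))); [intros t; apply HE|].
  apply (open_preimage (fun t : R => (t, v)) U); auto; intros; cont.
- apply (is_derive_ext_loc (fun t => f (u, t))); [|exact B].
  apply (filter_imp (fun t : R => U (u, t))); [intros t; apply HE|].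
  apply (open_preimage (fun t : R => (u, t)) U); auto; intros; cont.
Qed.

Lemma pl_partials_unique (U : plane -> Prop) f f1 f2 g1 g2 x :
  pl_partials U f f1 f2 -> pl_partials U f g1 g2 -> U x -> f1 x = g1 x /\ f2 x = g2 x.
Proof.
intros HP HQ Hx; destruct (pl_partials_Derive _ _ _ _ x HP Hx) as [<- <-].
now apply pl_partials_Derive with (1 := HQ).
Qed.

Lemma pl_partials_comp n (U V : plane -> Prop) f f1 f2 X X1 X2 Y Y1 Y2 :
  open U -> pl_partials U f f1 f2 -> Cp n U f1 ->
  pl_partials V X X1 X2 -> pl_partials V Y Y1 Y2 -> (forall x, V x -> U (X x, Y x)) ->
  pl_partials V (fun x => f (X x, Y x))
    (fun x => f1 (X x, Y x) * X1 x + f2 (X x, Y x) * Y1 x)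
    (fun x => f1 (X x, Y x) * X2 x + f2 (X x, Y x) * Y2 x).
Proof.
intros HU HP Hf1 HX HY HS u v Hx.
destruct (HX u v Hx) as [A1 A2], (HY u v Hx) as [B1 B2].
assert (D := pl_partials_differentiable n U f f1 f2 _ _ HU HP Hf1 (HS _ Hx)).
exact (conj
  (is_derive_comp_2d (fun a b => f (a, b)) (fun t => X (t, v)) (fun t => Y (t, v)) u _ _ _ _ D A1 B1)
  (is_derive_comp_2d (fun a b => f (a, b)) (fun t => X (u, t)) (fun t => Y (u, t)) v _ _ _ _ D A2 B2)).
Qed.

(** The partials z_ij of the composite are arbitrary, so the multiplication rule applies to pairs
    obtained independently of the chain rule. *)
Lemma jacobian_comp n (U V : plane -> Prop) F1 F2 f11 f12 f21 f22
    X Y x1 x2 y1 y2 z11 z12 z21 z22 x :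
  open U -> pl_partials U F1 f11 f12 -> pl_partials U F2 f21 f22 -> Cp n U f11 -> Cp n U f21 ->
  pl_partials V X x1 x2 -> pl_partials V Y y1 y2 -> (forall x, V x -> U (X x, Y x)) ->
  pl_partials V (fun x => F1 (X x, Y x)) z11 z12 ->
  pl_partials V (fun x => F2 (X x, Y x)) z21 z22 -> V x ->
  z11 x * z22 x - z12 x * z21 x =
  (f11 (X x, Y x) * f22 (X x, Y x) - f12 (X x, Y x) * f21 (X x, Y x)) *
  (x1 x * y2 x - x2 x * y1 x).
Proof.
intros HU P1 P2 C1 C2 HX HY HS Q1 Q2 Hx.
destruct (pl_partials_unique V _ _ _ _ _ x Q1
  (pl_partials_comp n U V _ _ _ _ _ _ _ _ _ HU P1 C1 HX HY HS) Hx) as [-> ->].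
destruct (pl_partials_unique V _ _ _ _ _ x Q2
  (pl_partials_comp n U V _ _ _ _ _ _ _ _ _ HU P2 C2 HX HY HS) Hx) as [-> ->].
ring.
Qed.

(** The total function [Derive_n] is compared with a function of known class on the open interval,
    where locality lets the next derivative be taken. *)
Lemma C1d_Derive_n n T f j : C1d n T f -> (j <= n)%nat ->
  exists g, C1d (n - j) T g /\ forall t, - T < t < T -> Derive_n f j t = g t.
Proof.
intros Hf; induction j as [|j IH]; intros Hj.
- exists f; split; [now rewrite Nat.sub_0_r | now intros].
- destruct IH as [g [Hg HE]]; [lia|].
  replace (n - j)%nat with (S (n - S j)) in Hg by lia.
  destruct (C1d_S _ _ _ Hg) as [g' [Dg Hg']]; exists g'; split; auto.
  intros t Ht; simpl; rewrite (Derive_ext_loc _ g).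
  + now apply is_derive_unique, Dg.
  + apply (filter_imp (fun t : R => - T < t < T)); [exact HE|].
    now apply locally_interval.
Qed.

Lemma C1d_class_C1d n T f : C1d n T f -> class_C1d n (fun t => - T < t < T) f.
Proof.
intros Hf t Ht j Hj.
assert (HL : locally t (fun t : R => - T < t < T)).
{ now apply locally_interval. }
split.
- destruct j as [|j]; simpl; auto.
  destruct (C1d_Derive_n n T f j Hf) as [g [Hg HE]]; [lia|].
  replace (n - j)%nat with (S (n - S j)) in Hg by lia.
  destruct (C1d_S _ _ _ Hg) as [g' [Dg _]].
  apply (ex_derive_ext_loc g).
  + revert HL; apply filter_imp; intros s Hs; symmetry; now apply HE.
  + exists (g' t); now apply Dg.
- destruct (C1d_Derive_n n T f j Hf Hj) as [g [Hg HE]].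
  apply (continuous_ext_loc _ g).
  + revert HL; apply filter_imp; intros s Hs; symmetry; now apply HE.
  + now apply (C1d_continuous (n - j) T).
Qed.

Lemma open_disc_sq r x : open_disc r x -> sq r x.
Proof.
unfold open_disc; intros H; assert (HN := radius_sqr x); assert (H0 := radius_pos x).
assert (H1 := pow2_ge_0 (fst x)); assert (H2 := pow2_ge_0 (snd x)).
split; (apply Rle_lt_trans with (2 := H); apply Rsqr_incr_0_var; auto;
  rewrite <- Rsqr_abs, !Rsqr_pow2; lra).
Qed.

Lemma open_disc_origin r : 0 < r -> open_disc r (0, 0).
Proof. intros Hr; apply open_disc_iff; auto; simpl; nra. Qed.

Lemma open_continuous_preimage (V D : plane -> Prop) (f g : plane -> R) : open V -> open D ->
  (forall x, V x -> continuous f x) -> (forall x, V x -> continuous g x) ->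
  open (fun x => V x /\ D (f x, g x)).
Proof.
intros HV HD Hf Hg x [Hx HDx].
exact (filter_and _ _ (HV x Hx) (continuous_pair f g x (Hf x Hx) (Hg x Hx) D (HD _ HDx))).
Qed.

(* [h] is the first component of the inverse of [(t, v) |-> (I t, v)]. *)
Lemma inverse_function_1d m T I J : 0 < T -> C1d (S m) T I -> I 0 = 0 -> J 0 <> 0 ->
  (forall t, - T < t < T -> is_derive I t (J t)) ->
  exists d r h, 0 < d /\ 0 < r /\ C1d (S m) r h /\ h 0 = 0 /\ Derive h 0 <> 0 /\
    forall t, Rabs t < d -> Rabs (I t) < r -> h (I t) = t.
Proof.
intros HT HI I0 J0 DI.
assert (HP : pl_partials (strip T) (fun x => I (fst x)) (fun x => J (fst x)) (fun _ => 0)).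
{ intros u v Hx; exact (conj (DI u Hx) (is_derive_Rconst (I u) v)). }
assert (Hdet : J (fst (0, 0)) * 1 - 0 * 0 <> 0) by (simpl; rewrite Rmult_1_r, Rmult_0_l, Rminus_0_r; exact J0).
assert (HT0 : strip T (0, 0)) by (unfold strip; simpl; lra).
destruct (inverse_function m (strip T) (fun x => I (fst x)) snd _ _ _ _ (open_strip T) HT0 I0
  eq_refl HI (Cn_snd _ _) HP (pl_partials_snd _) Hdet)
  as [d [r [h [h2 [Hd [Hr [HdT [HF [HG [Hh _]]]]]]]]]].
assert (Hax : forall t, - r < t < r -> sq r (t, 0)).
{ intros t Ht; split; simpl; [apply Rabs_def1; lra | now rewrite Rabs_R0]. }
assert (Hinv : forall t, Rabs t < d -> Rabs (I t) < r -> h (I t, 0) = t).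
{ intros t Ht HIt; assert (E := HG (t, 0)); simpl in E.
  assert (E' := E ltac:(split; simpl; rewrite ?Rabs_R0; auto) ltac:(split; simpl; rewrite ?Rabs_R0; auto)).
  now injection E'. }
assert (h0 : h (0, 0) = 0).
{ rewrite <- I0 at 1; apply Hinv; rewrite ?I0, Rabs_R0; auto. }
assert (HC : C1d (S m) r (fun t => h (t, 0))) by (apply (Cp_restrict_axis _ (sq r)); auto; apply open_sq).
exists d, r, (fun t => h (t, 0)); split; [exact Hd|]; split; [exact Hr|]; split; [exact HC|].
split; [exact h0|split; [|exact Hinv]].
destruct (C1d_S _ _ _ HC) as [h' [Dh _]].
assert (Hr0 : - r < 0 < r) by lra.
(* Differentiating I (h t) = t at 0 gives h'(0) J(0) = 1, so h'(0) cannot vanish. *)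
assert (E : is_derive (fun t : R => t) 0 (h' 0 * J (h (0, 0)))).
{ assert (D0 : is_derive I (h (0, 0)) (J (h (0, 0)))) by (rewrite h0; apply DI; lra).
  apply (is_derive_ext_loc (fun t : R => I (h (t, 0)))).
  - apply (filter_imp (fun t : R => - r < t < r)).
    + intros t Ht; destruct (HF _ (Hax t Ht)) as [_ [E _]]; exact E.
    + now apply locally_interval.
  - exact (is_derive_Rcomp I (fun t => h (t, 0)) 0 _ _ D0 (Dh 0 Hr0)). }
rewrite (is_derive_unique _ _ _ (Dh 0 Hr0)); intros Hz.
assert (E1 := eq_trans (eq_sym (is_derive_unique _ _ _ E)) (is_derive_unique _ _ _ (is_derive_Rid 0))).
rewrite Hz in E1; lra.
Qed.

(* Psi is defined on an open neighbourhood U of 0 in the disc of radius rho: it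
   cannot in general be defined on the whole disc, where H may have other
   critical points.  The function h of the action I in [0, rho'^2/2) is asked to
   be smooth on the symmetric open interval, so that h'(0) is an ordinary
   derivative. *)
Theorem theoremD1 :
  forall (rho : R) (k : nat) (H : plane -> R),
    0 < rho ->
    (4 <= k)%nat ->
    class_C k (open_disc rho) H ->
    H origin = 0 ->
    (forall v : plane, diff1 H origin v = 0) ->
    (forall v : plane, v <> origin -> 0 < diff2 H origin v) ->
    exists (U : plane -> Prop) (rho' : R) (Psi : plane -> plane) (h : R -> R),
      open U /\ U origin /\ (forall x, U x -> open_disc rho x) /\
      0 < rho' /\
      diffeomorphism (k - 3) U (open_disc rho') Psi /\
      area_preserving U Psi /\
      Psi origin = origin /\
      class_C1d (k / 2 - 1) (fun t => - (rho' ^ 2 / 2) < t < rho' ^ 2 / 2) h /\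
      h 0 = 0 /\
      Derive h 0 <> 0 /\
      (forall x, U x -> H x = h (action (Psi x))).
Proof.
intros rho k H Hrho Hk HC H0 HD1 HD2.
(* From here on k = n + 4, so k - 3 = n + 1; with m = [n/2] the class of h is m + 1. *)
destruct (Nat.le_exists_sub 4 k Hk) as [n [-> _]].
replace (n + 4)%nat with (S (S (S (S n)))) in * by lia.
replace (S (S (S (S n))) - 3)%nat with (S n) by lia.
set (m := (n / 2)%nat).
assert (Hm : (2 * m <= n)%nat) by (apply Nat.Div0.mul_div_le).
replace (S (S (S (S n))) / 2 - 1)%nat with (S m).
2: { replace (S (S (S (S n)))) with (n + 2 * 2)%nat by lia; rewrite Nat.div_add by lia.
     unfold m; lia. }
apply class_C_Cp in HC.
destruct (morse_chart (S n) rho H Hrho HC H0 HD1 HD2)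
  as [d [M1 [M2 [m11 [m12 [m21 [m22 [Hd [Hdr [HM1 [HM2 [PM1 [PM2 [M10 [M20 [Hdet HM]]]]]]]]]]]]]]]].
assert (Hdet0 := Rgt_not_eq _ _ Hdet).
destruct (Cp_partials _ _ _ _ _ (open_sq d) HM1 PM1) as [Cm11 Cm12].
destruct (Cp_partials _ _ _ _ _ (open_sq d) HM2 PM2) as [Cm21 Cm22].
destruct (inverse_function (S n) (sq d) M1 M2 _ _ _ _ (open_sq d) (sq_origin d Hd) M10 M20
  HM1 HM2 PM1 PM2 Hdet0) as [d1 [r1 [G1 [G2 [Hd1 [Hr1 [Hd1d [HMG [HGM [HG1 HG2]]]]]]]]]].
destruct (Cp_S _ _ _ HG1) as [g11 [g12 [PG1 [Cg11 Cg12]]]].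
destruct (Cp_S _ _ _ HG2) as [g21 [g22 [PG2 [Cg21 Cg22]]]].
set (p := fun y => g11 y * g22 y - g12 y * g21 y).
assert (Hp : Cp (S n) (sq r1) p) by
  exact (Cn_minus _ _ _ _ (Cn_mult _ _ _ _ Cg11 Cg22) (Cn_mult _ _ _ _ Cg12 Cg21)).
set (jM := fun x => m11 x * m22 x - m12 x * m21 x).
(* The determinants of M and of its inverse multiply to 1, since M composed with the inverse is the
   identity. *)
assert (Hjp : forall y, sq r1 y -> jM (G1 y, G2 y) * p y = 1).
{ intros y Hy; unfold jM, p.
  assert (Q1 : pl_partials (sq r1) (fun y => M1 (G1 y, G2 y)) (fun _ => 1) (fun _ => 0)).
  { apply (pl_partials_ext _ fst); [apply open_sq | | apply pl_partials_fst].
    intros z Hz; symmetry; apply HMG, Hz. }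
  assert (Q2 : pl_partials (sq r1) (fun y => M2 (G1 y, G2 y)) (fun _ => 0) (fun _ => 1)).
  { apply (pl_partials_ext _ snd); [apply open_sq | | apply pl_partials_snd].
    intros z Hz; symmetry; apply HMG, Hz. }
  assert (HS : forall x, sq r1 x -> sq d (G1 x, G2 x)) by (intros x Hx; apply Hd1d, HMG, Hx).
  rewrite <- (jacobian_comp (S n) (sq d) (sq r1) M1 M2 _ _ _ _ G1 G2 _ _ _ _ _ _ _ _ y
    (open_sq d) PM1 PM2 Cm11 Cm21 PG1 PG2 HS Q1 Q2 Hy); ring. }
assert (S1 := sq_origin r1 Hr1).
assert (G0 : (G1 (0, 0), G2 (0, 0)) = (0, 0)).
{ assert (E := HGM (0, 0) (sq_origin d1 Hd1)); rewrite M10, M20 in E; exact (E S1). }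
(* The sign of the Morse determinant enters here: it makes p positive near the origin, as the
   normalization requires. *)
assert (Hp0 : 0 < p (0, 0)).
{ assert (E := Hjp _ S1); rewrite G0 in E; change (0 < jM (0, 0)) in Hdet; nra. }
assert (HL : locally (0, 0) (fun y : R * R => sq r1 y /\ 0 < p y)).
{ apply filter_and; [now apply sq_locally|].
  apply (Cp_continuous _ _ _ _ Hp S1 (fun t => 0 < t)), (open_gt 0), Hp0. }
destruct (locally_sq _ HL) as [R0 [HR0 HR0p]].
assert (HR0sq : forall y, open_disc R0 y -> sq r1 y) by (intros y Hy; apply HR0p, open_disc_sq, Hy).
destruct (area_normalization m n R0 p HR0 Hm (Cp_subset _ _ _ _ HR0sq Hp))
  as [Y1 [Y2 [y11 [y12 [y21 [y22 [I [J [HY1 [HY2 [PY1 [PY2 [HdetY [Y10 [Y20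
      [HI [I0 [J0 [DI HIY]]]]]]]]]]]]]]]]]]].
{ intros y Hy; apply HR0p, open_disc_sq, Hy. }
assert (HT : 0 < R0 ^ 2 / 2) by nra.
destruct (inverse_function_1d m _ I J HT HI I0 (Rgt_not_eq _ _ J0) DI)
  as [d3 [r3 [h [Hd3 [Hr3 [Hh [h0 [Dh0 HhI]]]]]]]].
(* R1 <= 1 and R1 <= d3 give R1^2 / 2 < d3, so that H = |M|^2 / 2 stays where h inverts I. *)
set (R1 := Rmin R0 (Rmin 1 d3)).
assert (HR1 : 0 < R1) by (repeat apply Rmin_glb_lt; lra).
assert (HR10 : R1 <= R0) by apply Rmin_l.
assert (HR11 : R1 <= 1) by (eapply Rle_trans; [apply Rmin_r | apply Rmin_l]).
assert (HR13 : R1 <= d3) by (eapply Rle_trans; [apply Rmin_r | apply Rmin_r]).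
assert (HL2 : locally (0, 0) (fun x : R * R => sq d1 x /\ open_disc R1 (M1 x, M2 x))).
{ apply (open_continuous_preimage (sq d1) (open_disc R1) M1 M2); try apply open_sq.
  - apply open_open_disc.
  - intros x Hx; exact (Cp_continuous _ _ _ _ HM1 (Hd1d x Hx)).
  - intros x Hx; exact (Cp_continuous _ _ _ _ HM2 (Hd1d x Hx)).
  - split; [now apply sq_origin | rewrite M10, M20; now apply open_disc_origin]. }
destruct (locally_sq _ HL2) as [d2 [Hd2 HS2]].
assert (Hd21 : forall x, sq d2 x -> sq d1 x) by (intros x Hx; apply HS2, Hx).
assert (Hd2d : forall x, sq d2 x -> sq d x) by (intros x Hx; apply Hd1d, Hd21, Hx).
assert (HMR : forall x, sq d2 x -> open_disc R0 (M1 x, M2 x)).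
{ intros x Hx; destruct (HS2 x Hx) as [_ Hx']; unfold open_disc in *; lra. }
set (Psi1 := fun x => Y1 (M1 x, M2 x)); set (Psi2 := fun x => Y2 (M1 x, M2 x)).
assert (HM1' : Cp (S n) (sq d2) M1) by (apply Cn_pred; apply (Cp_subset _ (sq d)); auto).
assert (HM2' : Cp (S n) (sq d2) M2) by (apply Cn_pred; apply (Cp_subset _ (sq d)); auto).
assert (HMR' : forall z : space, sq d2 (snd z) -> open_disc R0 (M1 (snd z), M2 (snd z)))
  by (intros z; apply HMR).
assert (HP1 : Cp (S n) (sq d2) Psi1) by
  exact (Cp_comp _ _ _ Y1 _ _ (open_open_disc R0) HY1 HM1' HM2' HMR').
assert (HP2 : Cp (S n) (sq d2) Psi2) by
  exact (Cp_comp _ _ _ Y2 _ _ (open_open_disc R0) HY2 HM1' HM2' HMR').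
destruct (Cp_S _ _ _ HP1) as [p11 [p12 [PP1 _]]], (Cp_S _ _ _ HP2) as [p21 [p22 [PP2 _]]].
assert (HdetP : forall x, sq d2 x -> p11 x * p22 x - p12 x * p21 x = 1).
{ intros x Hx.
  destruct (Cp_partials _ _ _ _ _ (open_open_disc R0) HY1 PY1) as [Cy11 _].
  destruct (Cp_partials _ _ _ _ _ (open_open_disc R0) HY2 PY2) as [Cy21 _].
  rewrite (jacobian_comp n (open_disc R0) (sq d2) Y1 Y2 _ _ _ _ M1 M2 _ _ _ _ _ _ _ _ x
    (open_open_disc R0) PY1 PY2 Cy11 Cy21 (pl_partials_subset _ _ _ _ _ Hd2d PM1)
    (pl_partials_subset _ _ _ _ _ Hd2d PM2) HMR PP1 PP2 Hx).
  assert (Hx1 := HR0sq _ (HMR x Hx)).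
  (* The determinant is p (M x) times that of dM at x, and x is the image of M x under the inverse
     chart. *)
  rewrite (HdetY _ (HMR x Hx)), <- (Hjp _ Hx1), (HGM x (Hd21 x Hx) Hx1); unfold jM; ring. }
assert (Psi10 : Psi1 (0, 0) = 0) by (unfold Psi1; now rewrite M10, M20).
assert (Psi20 : Psi2 (0, 0) = 0) by (unfold Psi2; now rewrite M10, M20).
assert (S2 := sq_origin d2 Hd2).
assert (HdetP0 : p11 (0, 0) * p22 (0, 0) - p12 (0, 0) * p21 (0, 0) <> 0)
  by (rewrite HdetP by auto; lra).
destruct (inverse_function n (sq d2) Psi1 Psi2 _ _ _ _ (open_sq d2) S2 Psi10 Psi20
  HP1 HP2 PP1 PP2 HdetP0) as [d4 [r4 [Q1 [Q2 [Hd4 [Hr4 [Hd42 [HPQ [HQP [HQ1 HQ2]]]]]]]]]].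
(* As for R1: rho' <= 1 and rho' <= r3 give rho'^2 / 2 < r3, the range of actions on which h is
   defined. *)
set (rho' := Rmin r4 (Rmin 1 r3)).
assert (Hrho' : 0 < rho') by (repeat apply Rmin_glb_lt; lra).
assert (Hrho4 : rho' <= r4) by apply Rmin_l.
assert (Hrho1 : rho' <= 1) by (eapply Rle_trans; [apply Rmin_r | apply Rmin_l]).
assert (Hrho3 : rho' <= r3) by (eapply Rle_trans; [apply Rmin_r | apply Rmin_r]).
assert (Hdisc4 : forall y, open_disc rho' y -> sq r4 y).
{ intros y Hy; apply (sq_le rho'); auto; now apply open_disc_sq. }
(* Taking a preimage of the round disc makes the map onto: the local inverse carries the whole disc
   back into U. *)
set (U := fun x => sq d4 x /\ open_disc rho' (Psi1 x, Psi2 x)).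
assert (HUd2 : forall x, U x -> sq d2 x) by (intros x [Hx _]; apply Hd42, Hx).
assert (HU : open U).
{ apply (open_continuous_preimage (sq d4) (open_disc rho') Psi1 Psi2).
  - apply open_sq.
  - apply open_open_disc.
  - intros x Hx; exact (Cp_continuous _ _ _ _ HP1 (Hd42 x Hx)).
  - intros x Hx; exact (Cp_continuous _ _ _ _ HP2 (Hd42 x Hx)). }
exists U, rho', (fun x => (Psi1 x, Psi2 x)), h.
split; [exact HU|].
split. { split; [now apply sq_origin |].
  change (open_disc rho' (Psi1 (0, 0), Psi2 (0, 0))); rewrite Psi10, Psi20.
  now apply open_disc_origin. }
split. { intros x Hx; apply Hdr, Hd2d, HUd2, Hx. }
split; [exact Hrho'|].
split.
{ split; [split; (apply Cp_class_C; [exact HU|]); apply (Cp_subset _ (sq d2)); auto|].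
  split; [intros x Hx; apply Hx|].
  exists (fun y => (Q1 y, Q2 y)); split; [|split; [|split]].
  - split; (apply Cp_class_C; [apply open_open_disc|]); apply (Cp_subset _ (sq r4)); auto.
  - intros y Hy; destruct (HPQ y (Hdisc4 y Hy)) as [A [E1 E2]]; split; auto.
    rewrite E1, E2; now destruct y.
  - intros x [Hx1 Hx2]; apply HQP; auto.
  - intros y Hy; destruct (HPQ y (Hdisc4 y Hy)) as [A [E1 E2]].
    rewrite E1, E2; now destruct y. }
split.
{ intros x Hx v w; assert (Hx2 := HUd2 x Hx).
  destruct (pl_partials_Derive _ _ _ _ x PP1 Hx2) as [E11 E12].
  destruct (pl_partials_Derive _ _ _ _ x PP2 Hx2) as [E21 E22].
  assert (T : forall v, tangent_map (fun x => (Psi1 x, Psi2 x)) x v =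
    (p11 x * fst v + p12 x * snd v, p21 x * fst v + p22 x * snd v)).
  { intros u; rewrite <- E11, <- E12, <- E21, <- E22; reflexivity. }
  rewrite !T; unfold omega0; simpl.
  transitivity ((p11 x * p22 x - p12 x * p21 x) * (fst v * snd w - snd v * fst w)); [ring|].
  rewrite (HdetP x Hx2); ring. }
split. { change ((Psi1 (0, 0), Psi2 (0, 0)) = (0, 0)); now rewrite Psi10, Psi20. }
split.
{ intros t Ht; apply (C1d_class_C1d (S m) r3 h Hh t); nra. }
split; [exact h0|]; split; [exact Dh0|].
(* The action of the image is I (|M x|^2 / 2) = I (H x), and h undoes I because H x < d3 and I (H x)
   < r3. *)
intros x Hx; assert (Hx2 := HUd2 x Hx); destruct Hx as [_ Hx].
assert (E := HIY _ (HMR x Hx2)); fold (Psi1 x) (Psi2 x) in E; cbn [fst snd] in E.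
unfold action; rewrite radius_sqr; cbn [fst snd]; rewrite E.
assert (HN := HM x (Hd2d x Hx2)); rewrite <- HN.
apply (open_disc_iff _ _ Hrho') in Hx; cbn [fst snd] in Hx.
destruct (HS2 x Hx2) as [_ HxR]; apply (open_disc_iff _ _ HR1) in HxR; cbn [fst snd] in HxR.
assert (A1 := pow2_ge_0 (Psi1 x)); assert (A2 := pow2_ge_0 (Psi2 x)).
assert (A3 := pow2_ge_0 (M1 x)); assert (A4 := pow2_ge_0 (M2 x)).
symmetry; apply HhI; rewrite HN, ?Rabs_pos_eq; try rewrite <- E; nra.
Qed.
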